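(* Let $\mu\in\mathbb{R}$ and $0<s<t\le T$, let $\{W_r^{(\mu,1)}\}_{r\ge0}$ be a Brownian motion with drift $\mu$ and unit variance parameter, and let $M_{(s,t)}^{(\mu,1)}=\max_{s\le r\le t}W_r^{(\mu,1)}$. Let $F_{M_{(s,t)}}(\cdot;\mu)$ be the distribution function of $M_{(s,t)}^{(\mu,1)}$ and $\zeta_2(v)=F_{M_{(s,t)}}^{-1}(v;\mu)$. Then the copula $C_{W_T,M_{(s,t)}}(\cdot,\cdot;\mu)$ of the pair $(W_T^{(\mu,1)},M_{(s,t)}^{(\mu,1)})$ is given, for $(u,v)\in(0,1)^2$, by $$\begin{aligned}C_{W_T,M_{(s,t)}}(u,v;\mu)={}&\Phi_3\left(\Phi^{-1}(u),\frac{\zeta_2(v)-\mu t}{\sqrt t},\frac{\zeta_2(v)-\mu s}{\sqrt s};\sqrt{\frac tT},\sqrt{\frac sT},\sqrt{\frac st}\right)\\&-e^{2\mu\zeta_2(v)}\,\Phi_3\left(\Phi^{-1}(u)-\frac{2\zeta_2(v)}{\sqrt T},\frac{-\zeta_2(v)-\mu t}{\sqrt t},\frac{\zeta_2(v)+\mu s}{\sqrt s};\sqrt{\frac tT},-\sqrt{\frac sT},-\sqrt{\frac st}\right).\end{aligned}$$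
   Context: $\Phi$ denotes the standard normal distribution function, and $\Phi_3(z_1,z_2,z_3;\rho_{12},\rho_{13},\rho_{23})=\mathbb{P}\{Z_1\le z_1,Z_2\le z_2,Z_3\le z_3\}$ where $(Z_1,Z_2,Z_3)$ is a (possibly degenerate) trivariate normal vector with standard normal margins and correlations $\mathrm{corr}(Z_i,Z_j)=\rho_{ij}$. A Brownian motion with drift $\mu$ and unit variance parameter is the process $W_r^{(\mu,1)}=W_r+\mu r$, where $\{W_r\}$ is a standard Brownian motion started at $0$. For a distribution function $F$, $F^{-1}(u)=\inf\{x: F(x)\ge u\}$ for $u\in(0,1)$. For random variables $X_1,X_2$ with continuous distribution functions $F_1,F_2$ and joint distribution function $F$, the copula of $(X_1,X_2)$ is the unique function $C:[0,1]^2\to[0,1]$ that is a distribution function with uniform margins and satisfies $F(x_1,x_2)=C(F_1(x_1),F_2(x_2))$ for all $x_1,x_2$; equivalently $C(u_1,u_2)=F(F_1^{-1}(u_1),F_2^{-1}(u_2))$ for $(u_1,u_2)\in(0,1)^2$. *)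

(* Defs.v *)
From mathcomp Require Export all_boot all_order all_algebra.
From mathcomp Require Export all_classical all_reals all_analysis.

Set Implicit Arguments.
Unset Strict Implicit.
Unset Printing Implicit Defensive.

Import Order.TTheory GRing.Theory Num.Theory.
Import numFieldNormedType.Exports.

Local Open Scope classical_set_scope.
Local Open Scope ring_scope.

(* The library's [cdf] takes a bundled random variable and is extended-real
   valued; these versions take plain functions because a running maximum does
   not come with a measurability proof. *)
Definition df d (Omega : measurableType d) (R : realType)
    (P : probability Omega R) (X : Omega -> R) (x : R) : R :=
  fine (P [set w | X w <= x]).

Definition joint_df d (Omega : measurableType d) (R : realType)
    (P : probability Omega R) (X Y : Omega -> R) (x y : R) : R :=
  fine (P [set w | X w <= x /\ Y w <= y]).

(* Meaningful for 0 < u < 1, where the set is nonempty and bounded below. *)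
Definition quantile (R : realType) (F : R -> R) (u : R) : R :=
  inf [set x | u <= F x].

Definition Phi (R : realType) (x : R) : R := fine (normal_prob 0 1 `]-oo, x]).

Section trivariate_normal.
Variable R : realType.

(* Law of three independent standard normal variables. *)
Definition std_normal3 : set (R * R * R) -> \bar R :=
  ((normal_prob (0 : R) 1 \x normal_prob (0 : R) 1) \x normal_prob (0 : R) 1)%E.

Definition col3 (x : R * R * R) : 'cV[R]_3 :=
  \col_i [:: x.1.1; x.1.2; x.2]`_i.

Definition linmap3 (A : 'M[R]_3) (x : R * R * R) : R * R * R :=
  let z := A *m col3 x in
  (z (inord 0) 0, z (inord 1) 0, z (inord 2) 0).

Definition corr_mx3 (r12 r13 r23 : R) : 'M[R]_3 :=
  \matrix_(i, j) (nth [::] [:: [:: 1; r12; r13];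
                               [:: r12; 1; r23];
                               [:: r13; r23; 1]] i)`_j.

(* A centered, possibly degenerate, normal vector with covariance matrix S is
   one distributed as A N, with N standard normal and A A^T = S; A may be
   singular. *)
Definition normal_law3 (S : 'M[R]_3) (Q : probability (R * R * R)%type R) :=
  exists2 A : 'M[R]_3, A *m A^T = S &
    forall B, measurable B -> Q B = std_normal3 (linmap3 A @^-1` B).

(* The common value of Q (Z1 <= z1, Z2 <= z2, Z3 <= z3) over all such laws Q:
   Q is determined by its covariance matrix, and exists as soon as that matrix
   is positive semidefinite (the value is the junk 0 otherwise). *)
Definition Phi3 (z1 z2 z3 r12 r13 r23 : R) : R :=
  xget 0 [set p | exists2 Q : probability (R * R * R)%type R,
    normal_law3 (corr_mx3 r12 r13 r23) Q &
    p = fine (Q [set x | [/\ x.1.1 <= z1, x.1.2 <= z2 & x.2 <= z3]])].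

End trivariate_normal.

Section brownian_motion.
Context d (Omega : measurableType d) (R : realType) (P : probability Omega R).

(* Only nonnegative times matter. Taking arbitrary measurable B i (setT
   included) makes the product rule mutual independence of the increments. *)
Record brownian_motion (W : R -> {RV P >-> R}) : Prop := BrownianMotion {
  bm_start : forall w, W 0 w = 0 ;
  bm_continuous : forall w, {within `[0, +oo[, continuous (fun r : R => W r w)} ;
  bm_normal : forall q r : R, 0 <= q -> q < r ->
    forall B : set R, measurable B ->
    P [set w | B (W r w - W q w)] = normal_prob 0 (Num.sqrt (r - q)) B ;
  bm_independent : forall (n : nat) (a : nat -> R),
    0 <= a 0%N -> (forall i, (i < n)%N -> a i < a i.+1) ->
    forall B : nat -> set R, (forall i, measurable (B i)) ->
    P [set w | forall i, (i < n)%N -> B i (W (a i.+1) w - W (a i) w)] =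
    (\prod_(0 <= i < n) P [set w | B i (W (a i.+1) w - W (a i) w)%R])%E }.

Definition drifted (W : R -> {RV P >-> R}) (mu r : R) (w : Omega) : R :=
  W r w + mu * r.

(* The supremum is attained when the paths of X are continuous. *)
Definition path_max (X : R -> Omega -> R) (s t : R) (w : Omega) : R :=
  sup [set X r w | r in `[s, t]].

End brownian_motion.

(* C is, on the unit square, the distribution function of a law with uniform
   margins; its values outside the square are irrelevant. *)
Definition is_copula (R : realType) (C : R -> R -> R) : Prop :=
  exists Q : probability (R * R)%type R,
    [/\ forall B, measurable B -> Q (B `*` setT) = uniform_prob (@ltr01 R) B,
        forall B, measurable B -> Q (setT `*` B) = uniform_prob (@ltr01 R) B &
        forall u v, u \in `[0, 1] -> v \in `[0, 1] ->
          (C u v)%:E = Q (`]-oo, u] `*` `]-oo, v]) ].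

Definition copula_of d (Omega : measurableType d) (R : realType)
    (P : probability Omega R) (X1 X2 : Omega -> R) (C : R -> R -> R) : Prop :=
  is_copula C /\
  forall x1 x2, joint_df P X1 X2 x1 x2 = C (df P X1 x1) (df P X2 x2).

(* Main.v *)
From HB Require Import structures.
Require Import Defs.
From mathcomp Require Import measurable_realfun ring lra.

Set Implicit Arguments.
Unset Strict Implicit.
Unset Printing Implicit Defensive.

Import Order.TTheory GRing.Theory Num.Theory.
Import numFieldNormedType.Exports.

Local Open Scope classical_set_scope.
Local Open Scope ring_scope.

(** The maximum over [s, t] stays below [y] when the path starts below [y] at
    time [s] and does not cross [y] afterwards. Sample the path on a finite grid
    and stop it at the first grid time above [y]. By independence of increments,
    and since reflecting a normal variable costs an exponential density,
    a path restarted from [y] at that time has as much mass in {X_t < y, X_T <= x}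
    as in its mirror image across [y] weighted by exp(-2 mu (X_t - y)). As the
    mesh tends to 0 the overshoot vanishes, and dominated convergence gives
    P(M <= y, X_T <= x) = P(X_s <= y, X_t < y, X_T <= x)
      - E[exp(-2 mu (X_t - y)); X_s <= y, X_t > y, 2 y - 2 X_t + X_T <= x].
    A Gaussian tilt of the increments turns the second term into exp(2 mu y)
    times an orthant probability. Both orthants are values of [Phi3], because
    the law of a centered normal vector is determined by its covariance. The
    resulting formula is continuous in [y], so [M] has no atoms and its
    distribution function takes the value [v] at its [v]-quantile. *)

(** If Y is normal with mean mu v and variance v, the law of - Y has density exp(- 2 mu Y) with
    respect to that of Y, whatever v is. So one weight serves every crossing time, and the
    reflection identities can be added up over the grid. The increment from t to T is left alone by
    the reflection; this is why the mirrored end value is 2 y - 2 X_t + X_T. Independence is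
    available only at fixed times, and the grid stands in for the strong Markov property. A path
    caught at a grid time is already above y, so it is translated back to y: the identity is then
    exact for each mesh, and only the limit removes the translation. The functions in the limit are
    discontinuous, so boundaries must be null. Every null set used there is a hyperplane with a
    nonzero coefficient on W_s, where s > 0; hence t = T, which makes the normal vectors degenerate,
    needs no separate treatment. The absence of atoms of the maximum is read off from the joint
    formula itself. *)

Section image_measure.
Context d1 d2 (T1 : measurableType d1) (T2 : measurableType d2) (R : realType).

Definition image_measure (m : {measure set T1 -> \bar R}) (f : T1 -> T2)
    (mf : measurable_fun [set: T1] f) : {measure set T2 -> \bar R} :=
  measure_function_pushforward__canonical__measure_function_Measure m mf.

Lemma image_measureE m f mf A : @image_measure m f mf A = m (f @^-1` A).
Proof. by []. Qed.

Lemma ge0_integral_image_measure m f mf (g : T2 -> \bar R) :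
  measurable_fun setT g -> (forall y, (0 <= g y)%E) ->
  (\int[@image_measure m f mf]_y g y = \int[m]_x g (f x))%E.
Proof. by move=> mg g0; rewrite /image_measure ge0_integral_pushforward. Qed.

End image_measure.

Lemma integral_indicT d (T : measurableType d) (R : realType)
    (m : {measure set T -> \bar R}) (A : set T) :
  measurable A -> (\int[m]_x (\1_A x)%:E = m A)%E.
Proof. by move=> mA; rewrite integral_indic// setIT. Qed.

(** * Gaussian integrals *)

Section lebesgue_affine.
Local Open Scope ereal_scope.
Context {R : realType}.
Local Notation mu := (@lebesgue_measure R).

Lemma measurable_affine (a b : R) :
  measurable_fun [set: R] (fun x : R => a * x + b)%R.
Proof. by apply: measurable_funD => //; exact: measurable_funM. Qed.

(** Uniqueness of Lebesgue measure reduces the claim to half-open intervals, whose preimage has its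
    length divided by [a]. *)
Lemma lebesgue_measure_affine (a b : R) (a0 : (0 < a)%R) (A : set R) :
  measurable A ->
  mu A = a%:E * mu ((fun x : R => a * x + b)%R @^-1` A).
Proof.
move=> mA.
pose f : R -> measurableTypeR R := (fun x : R => a * x + b)%R.
have mf : measurable_fun setT f by exact: measurable_affine.
pose m := mscale (NngNum (ltW a0)) (image_measure mu mf).
rewrite (@lebesgue_measure_unique R m)//.
move=> _ [[u v]] _ <- /=.
rewrite /m /mscale/= /pushforward.
have -> : f @^-1` `]u, v]%classic = `]((u - b) / a)%R, ((v - b) / a)%R]%classic.
  apply/seteqP; split => x /=; rewrite /f !in_itv/= ltr_pdivrMr// ler_pdivlMr//;
    by rewrite ltrBlDr lerBrDr [(x * a)%R]mulrC.
rewrite !lebesgue_measure_itv/= !lte_fin ltr_pM2r ?invr_gt0// ltrD2r.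
case: ifPn => _; last by rewrite mule0.
rewrite -!EFinB -EFinM; congr EFin.
by rewrite -mulrBl mulrCA divff ?gt_eqF// mulr1 opprB addrA subrK.
Qed.

Lemma ge0_integral_affine (a b : R) (a0 : (0 < a)%R) (f : R -> \bar R) :
  measurable_fun setT f -> (forall x, 0 <= f x) ->
  \int[mu]_x f x = a%:E * \int[mu]_x f (a * x + b)%R.
Proof.
move=> mf f0.
pose h : R -> measurableTypeR R := (fun x : R => a * x + b)%R.
have mh : measurable_fun setT h by exact: measurable_affine.
rewrite (eq_measure_integral (mscale (NngNum (ltW a0)) (image_measure mu mh))); last first.
  by move=> A mA _; exact: (lebesgue_measure_affine b a0 mA).
by rewrite ge0_integral_mscale// ge0_integral_image_measure.
Qed.

Lemma ge0_integral_shift (b : R) (f : R -> \bar R) :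
  measurable_fun setT f -> (forall x, 0 <= f x) ->
  \int[mu]_x f x = \int[mu]_x f (x + b)%R.
Proof.
move=> mf f0; rewrite (@ge0_integral_affine 1 b ltr01)// mul1e.
by under eq_integral do rewrite mul1r.
Qed.

Lemma ge0_integral_opp (f : R -> \bar R) :
  measurable_fun setT f -> (forall x, 0 <= f x) ->
  \int[mu]_x f x = \int[mu]_x f (- x)%R.
Proof.
move=> mf f0.
pose h : R -> measurableTypeR R := -%R.
have mh : measurable_fun setT h by exact: oppr_measurable.
rewrite (eq_measure_integral (image_measure mu mh)); last first.
  by move=> A mA _; exact/esym/lebesgue_measureN.
by rewrite ge0_integral_image_measure.
Qed.

End lebesgue_affine.

Section gaussian.
Local Open Scope ereal_scope.
Context {R : realType}.
Local Notation mu := (@lebesgue_measure R).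

(** The abstract Radon-Nikodym derivative and [normal_pdf] have the same integral over every
    measurable set, hence agree almost everywhere. *)
Lemma ge0_integral_normal_prob (m s : R) (f : R -> \bar R) :
  measurable_fun setT f -> (forall x, 0 <= f x) ->
  \int[normal_prob m s]_x f x = \int[mu]_x (f x * (normal_pdf m s x)%:E).
Proof.
move=> mf f0.
have dom := normal_prob_dominates m s.
pose nu : {finite_measure set (measurableTypeR R) -> \bar R} := normal_prob m s.
rewrite -(@Radon_Nikodym_SigmaFinite.change_of_variables _ _ R nu mu dom)//=.
have gi := Radon_Nikodym_SigmaFinite.f_integrable dom.
apply: ge0_ae_eq_integral => //=.
- by apply: emeasurable_funM => //; exact: measurable_int gi.
- by apply: emeasurable_funM => //; apply/measurable_EFinP; exact: measurable_normal_pdf.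
- by move=> x _; rewrite mule_ge0//; exact: Radon_Nikodym_SigmaFinite.f_ge0.
- by move=> x _; rewrite mule_ge0// lee_fin normal_pdf_ge0.
apply: ae_eqe_mul2l => /=.
apply: integral_ae_eq => //=.
- by apply/measurable_EFinP; exact: measurable_normal_pdf.
- by move=> E _ mE; rewrite -Radon_Nikodym_SigmaFinite.f_integral.
Qed.

Lemma ge0_integral_normal_scale (s : R) (f : R -> \bar R) : (0 < s)%R ->
  measurable_fun setT f -> (forall x, 0 <= f x) ->
  \int[normal_prob 0 s]_x f x = \int[normal_prob 0 1]_x f (s * x)%R.
Proof.
move=> s0 mf f0; have ms : measurable_fun setT (fun x : R => s * x)%R by exact: measurable_funM.
have mpdf t := @measurable_normal_pdf R 0 t.
have mfs : measurable_fun setT (fun x : R => f (s * x)%R).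
  exact: (measurableT_comp mf ms).
rewrite (ge0_integral_normal_prob 0 s mf f0).
rewrite (ge0_integral_normal_prob 0 1 mfs (fun x => f0 _)).
rewrite (@ge0_integral_affine _ s 0 s0)//; first last.
- by move=> x; rewrite mule_ge0// lee_fin normal_pdf_ge0.
- by apply: emeasurable_funM => //; apply/measurable_EFinP.
under eq_integral do rewrite addr0.
rewrite -ge0_integralZl//=; last 3 first.
- apply: emeasurable_funM; first exact: measurableT_comp.
  by apply/measurable_EFinP; exact: measurableT_comp.
- by move=> x _; rewrite mule_ge0// lee_fin normal_pdf_ge0.
- by rewrite lee_fin ltW.
apply: eq_integral => x _; rewrite muleCA; congr (_ * _).
rewrite -EFinM !normal_pdfE ?gt_eqF// /normal_peak /normal_fun; congr EFin.
rewrite !subr0 mulrA; congr (_ * expR _)%R.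
  rewrite expr1n mul1r -mulrnAr sqrtrM ?sqr_ge0// sqrtr_sqr gtr0_norm//.
  by rewrite invfM mulrA divff ?gt_eqF// mul1r.
have ss : (s ^+ 2 + s ^+ 2)%R != 0%R.
  by apply: lt0r_neq0; apply: addr_gt0; apply: exprn_gt0.
rewrite !mulr2n; field; exact: ss.
Qed.

Lemma normal_prob_scale (s : R) (B : set R) : (0 < s)%R -> measurable B ->
  normal_prob 0 s B = normal_prob 0 1 ((fun x : R => s * x)%R @^-1` B).
Proof.
move=> s0 mB.
have mB' : measurable ((fun x : R => s * x)%R @^-1` B).
  by rewrite -[X in measurable X]setTI; exact: measurable_funM.
rewrite -(integral_indicT (normal_prob 0 s) mB).
rewrite -(integral_indicT (normal_prob 0 1) mB').
apply: (ge0_integral_normal_scale s0 (f := fun x => (\1_B x)%:E)).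
  exact/measurable_EFinP/measurable_indic.
by move=> x; rewrite lee_fin.
Qed.

Lemma ge0_integral_normal_opp (f : R -> \bar R) :
  measurable_fun setT f -> (forall x, 0 <= f x) ->
  \int[normal_prob 0 1]_x f x = \int[normal_prob 0 1]_x f (- x)%R.
Proof.
move=> mf f0.
have mpdf t := @measurable_normal_pdf R 0 t.
have mfo : measurable_fun setT (fun x : R => f (- x)%R).
  have mo : measurable_fun setT (fun x : R => - x)%R by exact: oppr_measurable.
  exact: (measurableT_comp mf mo).
rewrite (ge0_integral_normal_prob 0 1 mf f0).
rewrite (ge0_integral_normal_prob 0 1 mfo (fun x => f0 _)).
have mfp : measurable_fun setT (fun x => f x * (normal_pdf 0 1 x)%:E).
  by apply: emeasurable_funM => //; apply/measurable_EFinP.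
have fp0 x : 0 <= f x * (normal_pdf 0 1 x)%:E.
  by rewrite mule_ge0// lee_fin normal_pdf_ge0.
rewrite (ge0_integral_opp mfp fp0).
apply: eq_integral => x _; congr (_ * _%:E).
by rewrite !normal_pdfE ?oner_eq0// /normal_fun !subr0 sqrrN.
Qed.

(* Completing the square: the density of [- x - c] at the standard normal law. *)
Lemma ge0_integral_normal_tilt (c : R) (f : R -> \bar R) :
  measurable_fun setT f -> (forall x, 0 <= f x) ->
  \int[normal_prob 0 1]_x f x =
  \int[normal_prob 0 1]_x (f (- x - c)%R * (expR (- (c * x) - c ^+ 2 / 2))%:E).
Proof.
move=> mf f0.
have mpdf t := @measurable_normal_pdf R 0 t.
have ma : measurable_fun setT (fun x : R => - x - c)%R by exact: measurable_funB.
have me : measurable_fun setT (fun x : R => expR (- (c * x) - c ^+ 2 / 2)%R).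
  by apply: measurableT_comp => //; apply: measurable_funB => //;
     apply: measurableT_comp => //; exact: measurable_funM.
have mfa : measurable_fun setT
    (fun x : R => f (- x - c)%R * (expR (- (c * x) - c ^+ 2 / 2))%:E).
  apply: emeasurable_funM; first exact: (measurableT_comp mf ma).
  exact/measurable_EFinP.
have fa0 x : 0 <= f (- x - c)%R * (expR (- (c * x) - c ^+ 2 / 2))%:E.
  by rewrite mule_ge0// lee_fin expR_ge0.
rewrite (ge0_integral_normal_prob 0 1 mf f0).
rewrite (ge0_integral_normal_prob 0 1 mfa fa0).
have mfp : measurable_fun setT (fun x => f x * (normal_pdf 0 1 x)%:E).
  by apply: emeasurable_funM => //; apply/measurable_EFinP.
have fp0 x : 0 <= f x * (normal_pdf 0 1 x)%:E.
  by rewrite mule_ge0// lee_fin normal_pdf_ge0.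
have msh : measurable_fun setT (fun x : R => x - c)%R by exact: measurable_funB.
rewrite (ge0_integral_shift (- c) mfp fp0).
rewrite (ge0_integral_opp (measurableT_comp mfp msh) (fun x => fp0 _)) /=.
apply: eq_integral => x _; rewrite -muleA; congr (_ * _).
rewrite -EFinM !normal_pdfE ?oner_eq0// /normal_fun; congr EFin.
rewrite mulrCA -expRD; congr (_ * expR _)%R.
by rewrite !subr0 !mulr2n; field.
Qed.

End gaussian.

(* [normal_prob] lives on [measurableTypeR R], whose display differs from that
   of [R]; this is the standard normal law as a probability on [R] itself. *)
Definition gauss1 (R : realType) : set R -> \bar R := normal_prob 0 1.
Arguments gauss1 : clear implicits.

Section gauss1.
Local Open Scope ereal_scope.
Context {R : realType}.
Local Notation N := (@normal_prob R 0 1).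

Let gauss1_semi_sigma_additive : semi_sigma_additive (gauss1 R).
Proof. exact: (@measure_semi_sigma_additive _ _ _ N). Qed.

HB.instance Definition _ := isMeasure.Build _ R R (gauss1 R)
  (measure0 N) (measure_ge0 N) gauss1_semi_sigma_additive.

HB.instance Definition _ :=
  Measure_isProbability.Build _ R R (gauss1 R) (@probability_setT _ _ _ N).

Lemma ge0_integral_gauss1 (f : R -> \bar R) :
  measurable_fun setT f -> (forall x, 0 <= f x) ->
  \int[gauss1 R]_x f x = \int[N]_x f x.
Proof.
move=> mf f0.
have mid : measurable_fun setT (id : measurableTypeR R -> R) by exact: measurable_id.
rewrite (eq_measure_integral (image_measure N mid)); last first.
  by move=> A mA _; rewrite image_measureE.
by rewrite (ge0_integral_image_measure N mid mf f0).
Qed.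

Lemma ge0_integral_gauss1_opp (f : R -> \bar R) :
  measurable_fun setT f -> (forall x, 0 <= f x) ->
  \int[gauss1 R]_x f x = \int[gauss1 R]_x f (- x)%R.
Proof.
move=> mf f0.
have mo : measurable_fun setT (fun x : R => f (- x)%R).
  have mo : measurable_fun setT (fun x : R => - x)%R by exact: oppr_measurable.
  exact: (measurableT_comp mf mo).
rewrite (ge0_integral_gauss1 mf f0) (ge0_integral_gauss1 mo (fun x => f0 _)).
exact: ge0_integral_normal_opp.
Qed.

Lemma ge0_integral_gauss1_tilt (c : R) (f : R -> \bar R) :
  measurable_fun setT f -> (forall x, 0 <= f x) ->
  \int[gauss1 R]_x f x =
  \int[gauss1 R]_x (f (- x - c)%R * (expR (- (c * x) - c ^+ 2 / 2))%:E).
Proof.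
move=> mf f0.
have ma : measurable_fun setT (fun x : R => - x - c)%R by exact: measurable_funB.
have me : measurable_fun setT (fun x : R => expR (- (c * x) - c ^+ 2 / 2)%R).
  by apply: measurableT_comp => //; apply: measurable_funB => //;
     apply: measurableT_comp => //; exact: measurable_funM.
have mfa : measurable_fun setT
    (fun x : R => f (- x - c)%R * (expR (- (c * x) - c ^+ 2 / 2))%:E).
  apply: emeasurable_funM; first exact: (measurableT_comp mf ma).
  exact/measurable_EFinP.
have fa0 x : 0 <= f (- x - c)%R * (expR (- (c * x) - c ^+ 2 / 2))%:E.
  by rewrite mule_ge0// lee_fin expR_ge0.
rewrite (ge0_integral_gauss1 mf f0) (ge0_integral_gauss1 mfa fa0).
exact: ge0_integral_normal_tilt.
Qed.

Lemma gauss1_set1 (c : R) : gauss1 R [set c] = 0.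
Proof.
have /null_content_dominatesP := normal_prob_dominates (0 : R) 1.
by apply => //; exact: lebesgue_measure_set1.
Qed.

Lemma gauss1_scale (s : R) (B : set R) : (0 < s)%R -> measurable B ->
  normal_prob 0 s B = gauss1 R ((fun x : R => s * x)%R @^-1` B).
Proof. exact: normal_prob_scale. Qed.

End gauss1.

(** * Rotation invariance *)

Section rotation.
Local Open Scope ereal_scope.
Context {R : realType}.
Local Notation mu := (@lebesgue_measure R).
Local Notation N := (gauss1 R).

Lemma measurable_lin2 (a b c e : R) :
  measurable_fun setT (fun z : R * R => (a * z.1 + b * z.2, c * z.1 + e * z.2)%R).
Proof.
by apply: measurable_fun_pair; apply: measurable_funD; apply: measurable_funM.
Qed.

Lemma ge0_integral_shear1 (p : R) (g : R * R -> \bar R) :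
  measurable_fun setT g -> (forall z, 0 <= g z) ->
  \int[mu]_x \int[mu]_y g (x, p * x + y)%R = \int[mu]_x \int[mu]_y g (x, y).
Proof.
move=> mg g0; apply: eq_integral => x _.
have mgx : measurable_fun setT (fun y => g (x, y)).
  exact: (measurableT_comp mg (measurable_pair1 x)).
rewrite [RHS](ge0_integral_shift (p * x) mgx (fun y => g0 _)).
by apply: eq_integral => y _; rewrite addrC.
Qed.

(** Fubini moves the sheared variable inside, where each slice is merely translated. *)
Lemma ge0_integral_shear2 (p : R) (g : R * R -> \bar R) :
  measurable_fun setT g -> (forall z, 0 <= g z) ->
  \int[mu]_x \int[mu]_y g (x + p * y, y)%R = \int[mu]_x \int[mu]_y g (x, y).
Proof.
move=> mg g0.
have mg' : measurable_fun setT (fun z : R * R => g (z.1 + p * z.2, z.2)%R).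
  apply: measurableT_comp => //; apply: measurable_fun_pair => //.
  by apply: measurable_funD => //; exact: measurable_funM.
rewrite (fubini_tonelli (m1 := mu) (m2 := mu) (fun z : R * R => g (z.1 + p * z.2, z.2)%R) mg' (fun z => g0 _)).
rewrite (fubini_tonelli (m1 := mu) (m2 := mu) g mg g0).
apply: eq_integral => y _ /=.
have mgy : measurable_fun setT (fun x => g (x, y)).
  exact: (measurableT_comp mg (measurable_pair2 y)).
by rewrite [RHS](ge0_integral_shift (p * y) mgy (fun x => g0 _)).
Qed.

Lemma ge0_integral_gauss1_pdf (f : R -> \bar R) :
  measurable_fun setT f -> (forall x, 0 <= f x) ->
  \int[N]_x f x = \int[mu]_x (f x * (normal_pdf 0 1 x)%:E).
Proof.
move=> mf f0; rewrite (ge0_integral_gauss1 mf f0).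
exact: ge0_integral_normal_prob.
Qed.

Lemma ge0_integral_normal2 (f : R * R -> \bar R) :
  measurable_fun setT f -> (forall z, 0 <= f z) ->
  \int[N \x N]_z f z = \int[mu]_x \int[mu]_y
     (f (x, y) * (normal_pdf 0 1 x * normal_pdf 0 1 y)%:E).
Proof.
move=> mf f0; have mpdf t := @measurable_normal_pdf R 0 t.
have mF := measurable_fun_fubini_tonelli_F (m2 := N) f mf f0.
rewrite (fubini_tonelli1 (m1 := N) (m2 := N) f mf f0) (ge0_integral_gauss1_pdf mF); last first.
  by move=> x; exact: integral_ge0.
apply: eq_integral => x _; rewrite /fubini_F.
have mfx : measurable_fun setT (fun y => f (x, y)).
  exact: (measurableT_comp mf (measurable_pair1 x)).
rewrite (ge0_integral_gauss1_pdf mfx (fun y => f0 _)).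
rewrite -ge0_integralZr//=; last 3 first.
- apply: emeasurable_funM; first exact: mfx.
  by apply/measurable_EFinP; exact: mpdf.
- by move=> y _; rewrite mule_ge0// lee_fin normal_pdf_ge0.
- by rewrite lee_fin normal_pdf_ge0.
by apply: eq_integral => y _; rewrite -muleA -EFinM mulrC.
Qed.

Lemma ge0_integral_normal2_rot (c s : R) (f : R * R -> \bar R) :
  (c ^+ 2 + s ^+ 2 = 1)%R ->
  measurable_fun setT f -> (forall z, 0 <= f z) ->
  \int[N \x N]_z f (c * z.1 + s * z.2, - s * z.1 + c * z.2)%R = \int[N \x N]_z f z.
Proof.
move=> cs1 mf f0; have mpdf t := @measurable_normal_pdf R 0 t.
(* The shears used below divide by [s]; when [s] is 0 the rotation is the identity or the point
   reflection. *)
have [s0|s0] := eqVneq s 0%R.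
  move: cs1; rewrite s0 expr0n/= addr0 => /eqP.
  rewrite sqrf_eq1 => /orP[]/eqP ->.
    apply: eq_integral => -[x y] _ /=.
    by rewrite !mul1r oppr0 !mul0r addr0 add0r.
  under eq_integral do rewrite oppr0 !mulN1r !mul0r addr0 add0r.
  have mo : measurable_fun setT (fun z : R * R => (- z.1, - z.2)%R).
    apply: measurable_fun_pair.
    - exact: (measurable_funN measurable_fst).
    - exact: (measurable_funN measurable_snd).
  rewrite (fubini_tonelli1 (m1 := N) (m2 := N) _ (measurableT_comp mf mo) (fun z => f0 _)).
  rewrite (fubini_tonelli1 (m1 := N) (m2 := N) f mf f0) /fubini_F/=.
  have mF := measurable_fun_fubini_tonelli_F (m2 := N) f mf f0.
  rewrite [RHS](ge0_integral_gauss1_opp mF); last by move=> x; exact: integral_ge0.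
  apply: eq_integral => x _.
  have mfx : measurable_fun setT (fun y => f (- x, y)%R).
    exact: (measurableT_comp mf (measurable_pair1 (- x)%R)).
  by rewrite /fubini_F [RHS](ge0_integral_gauss1_opp mfx (fun y => f0 _)).
have mr := measurable_lin2 c s (- s) c.
rewrite (ge0_integral_normal2 (measurableT_comp mf mr) (fun z => f0 _)).
rewrite (ge0_integral_normal2 mf f0).
pose g z := f z * (normal_pdf 0 1 z.1 * normal_pdf 0 1 z.2)%:E.
have mpp : measurable_fun setT (fun z : R * R => (normal_pdf 0 1 z.1 * normal_pdf 0 1 z.2)%R).
  apply: measurable_funM.
  - exact: (measurableT_comp (mpdf 1%R) measurable_fst).
  - exact: (measurableT_comp (mpdf 1%R) measurable_snd).
have mg : measurable_fun setT g.
  by apply: emeasurable_funM => //; apply/measurable_EFinP.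
have g0 z : 0 <= g z by rewrite mule_ge0// lee_fin mulr_ge0// normal_pdf_ge0.
(* A rotation that is not the identity is a product of three shears. *)
pose p := ((1 - c) / s)%R.
(* The density depends only on x^2 + y^2, which the rotation fixes, so it may be evaluated at the
   rotated point. *)
transitivity (\int[mu]_x \int[mu]_y
    g (c * (x : R) + s * (y : R), - s * (x : R) + c * (y : R))%R).
  apply: eq_integral => x _; apply: eq_integral => y _; congr (_ * _%:E).
  rewrite !normal_pdfE ?oner_eq0// /normal_fun /= !mulrA.
  rewrite ![(_ * normal_peak 1)%R]mulrC !mulrA -!mulrA -!expRD.
  congr (_ * (_ * expR _))%R.
  rewrite -!mulrDl; congr (_ * _)%R; rewrite !subr0.
  have -> : (- (c * x + s * y) ^+ 2 + - (- s * x + c * y) ^+ 2 =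
    - ((c ^+ 2 + s ^+ 2) * (x ^+ 2 + y ^+ 2)))%R by ring.
  by rewrite cs1 mul1r opprD.
have E z : (c * z.1 + s * z.2, - s * z.1 + c * z.2)%R =
   let x1 := (z.1 + p * z.2)%R in let y1 := (- s * x1 + z.2)%R in (x1 + p * y1, y1)%R.
  have s21 : (s ^+ 2 = 1 - c ^+ 2)%R by rewrite -cs1 addrC addKr.
  rewrite /= /p; congr pair; last first.
    by field.
  (* Uses c^2 + s^2 = 1 once, so that the remaining identity holds for rational functions. *)
  have {1}-> : s = ((1 - c ^+ 2) / s)%R by rewrite -s21 expr2 mulfK.
  by field.
have mg1 : measurable_fun setT (fun z : R * R => g (z.1 + p * z.2, z.2)%R).
  apply: measurableT_comp => //; apply: measurable_fun_pair => //.
  by apply: measurable_funD => //; exact: measurable_funM.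
have mg2 : measurable_fun setT (fun z : R * R => g (z.1 + p * (- s * z.1 + z.2), - s * z.1 + z.2)%R).
  apply: (measurableT_comp mg1 (g := fun z : R * R => (z.1, - s * z.1 + z.2)%R)).
  apply: measurable_fun_pair => //.
  by apply: measurable_funD => //; exact: measurable_funM.
transitivity (\int[mu]_x \int[mu]_y g (let x1 := ((x : R) + p * (y : R))%R in
   let y1 := (- s * x1 + (y : R))%R in (x1 + p * y1, y1)%R)).
  by apply: eq_integral => x _; apply: eq_integral => y _; rewrite -(E (x, y)).
rewrite /=.
apply: (etrans (ge0_integral_shear2 p mg2 (fun z => g0 _))).
apply: (etrans (ge0_integral_shear1 (- s) mg1 (fun z => g0 _))).
exact: (ge0_integral_shear2 p mg g0).
Qed.

End rotation.

(** * Measures on products are determined by boxes *)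

Section product_unique.
Local Open Scope ereal_scope.
Context d1 d2 (T1 : measurableType d1) (T2 : measurableType d2) (R : realType).

Lemma measure_prod_unique (m m' : {measure set (T1 * T2) -> \bar R}) :
  m setT < +oo ->
  (forall A B, measurable A -> measurable B -> m (A `*` B) = m' (A `*` B)) ->
  forall X, measurable X -> m X = m' X.
Proof.
move=> moo mm' X mX.
apply: (measure_unique [set A `*` B | A in measurable & B in measurable]
   (fun=> setT)) => //=.
- exact: measurable_prod_measurableType.
- move=> _ _ [A mA [B mB <-]] [C mC [D mD <-]].
  rewrite -setXI; exists (A `&` C); first exact: measurableI.
  by exists (B `&` D) => //; exact: measurableI.
- by move=> _; exists setT => //; exists setT => //; rewrite setXTT.
- by rewrite bigcup_const.
- by move=> _ [A mA [B mB <-]]; exact: mm'.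
Qed.

End product_unique.

Section product3_unique.
Local Open Scope ereal_scope.
Context d1 d2 d3 (T1 : measurableType d1) (T2 : measurableType d2)
  (T3 : measurableType d3) (R : realType).

(** With [C] fixed, E -> m (E x C) is a finite measure on the first two factors, so the statement
    for two factors is applied twice. *)
Lemma measure_prod3_unique (m m' : {measure set (T1 * T2 * T3) -> \bar R}) :
  m setT < +oo ->
  (forall A B C, measurable A -> measurable B -> measurable C ->
     m (A `*` B `*` C) = m' (A `*` B `*` C)) ->
  forall X, measurable X -> m X = m' X.
Proof.
move=> moo mm'; apply: measure_prod_unique => // D C mD mC.
have mTC : measurable ([set: T1 * T2] `*` C) by exact: measurableX.
pose r (n : {measure set (T1 * T2 * T3) -> \bar R}) :=
  image_measure (mrestr n mTC) measurable_fst.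
have rE n E : r n E = n (E `*` C).
  rewrite /r/= /pushforward /mrestr/=; congr (n _).
  by apply/seteqP; split => -[x y] /=; [move=> [? []]|move=> []].
rewrite -!rE; apply: measure_prod_unique => //.
- rewrite rE; apply: le_lt_trans moo.
  by apply: le_measure; rewrite ?inE//; exact: measurableX.
- by move=> A B mA mB; rewrite !rE mm'.
Qed.

End product3_unique.

(** * The standard normal law in dimension three and its symmetries *)

Section std_normal3.
Context {R : realType}.
Local Notation N := (gauss1 R).
Local Notation g3 := (@std_normal3 R).

Let std_normal3_semi_sigma_additive : semi_sigma_additive g3.
Proof.
exact: (@measure_semi_sigma_additive _ _ _ [the measure _ _ of
 ((normal_prob (0 : R) 1 \x normal_prob (0 : R) 1) \x normal_prob (0 : R) 1)%E]).
Qed.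

Let std_normal3_set0 : g3 set0 = 0%E.
Proof.
exact: (@measure0 _ _ _ [the measure _ _ of
 ((normal_prob (0 : R) 1 \x normal_prob (0 : R) 1) \x normal_prob (0 : R) 1)%E]).
Qed.

Let std_normal3_ge0 A : (0 <= g3 A)%E.
Proof.
exact: (@measure_ge0 _ _ _ [the measure _ _ of
 ((normal_prob (0 : R) 1 \x normal_prob (0 : R) 1) \x normal_prob (0 : R) 1)%E]).
Qed.

HB.instance Definition _ := isMeasure.Build _ (R * R * R)%type R g3
  std_normal3_set0 std_normal3_ge0 std_normal3_semi_sigma_additive.

Lemma std_normal3X (A B C : set R) : measurable A -> measurable B -> measurable C ->
  g3 (A `*` B `*` C) = (N A * N B * N C)%E.
Proof.
move=> mA mB mC; have pE := @product_measure1E.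
transitivity ((normal_prob (0 : R) 1 \x normal_prob (0 : R) 1)%E (A `*` B) *
  normal_prob (0 : R) 1 C)%E.
  by apply: pE => //; exact: measurableX.
by congr (_ * _)%E; apply: pE.
Qed.

Let std_normal3T : g3 setT = 1%E.
Proof. by rewrite -!setXTT std_normal3X// !probability_setT !mule1. Qed.

HB.instance Definition _ :=
  Measure_isProbability.Build _ (R * R * R)%type R g3 std_normal3T.

Lemma std_normal3_unique (m : {measure set (R * R * R) -> \bar R}) :
  (forall A B C, measurable A -> measurable B -> measurable C ->
     m (A `*` B `*` C) = (N A * N B * N C)%E) ->
  forall X, measurable X -> m X = g3 X.
Proof.
move=> mE X mX; apply/esym.
apply: (measure_prod3_unique (m := g3)) => //.
  have : (g3 setT < +oo)%E by rewrite std_normal3T ltry.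
  by [].
by move=> A B C mA mB mC; rewrite mE//; exact: std_normal3X.
Qed.

(** Lets the factors be read as [gauss1] instead of [normal_prob]: the two products agree on
    boxes. *)
Lemma std_normal3E X : measurable X -> ((N \x N) \x N)%E X = g3 X.
Proof.
move: X; apply: std_normal3_unique => A B C mA mB mC.
have mAB : measurable (A `*` B) by exact: measurableX.
apply: (etrans (product_measure1E (N \x N)%E N mAB mC)).
by rewrite -(product_measure1E N N mA mB).
Qed.

Definition preserves3 (f : R * R * R -> R * R * R) :=
  measurable_fun setT f /\ forall X, measurable X -> g3 (f @^-1` X) = g3 X.

Lemma preserves3_comp f g : preserves3 f -> preserves3 g -> preserves3 (f \o g).
Proof.
move=> [mf pf] [mg pg]; split; first exact: measurableT_comp.
move=> X mX; rewrite comp_preimage pg ?pf//.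
by rewrite -[X in measurable X]setTI; exact: mf.
Qed.

Lemma preserves3_rect f : measurable_fun setT f ->
  (forall A B C, measurable A -> measurable B -> measurable C ->
     g3 (f @^-1` (A `*` B `*` C)) = (N A * N B * N C)%E) -> preserves3 f.
Proof.
move=> mf fE; split; first exact: mf.
move=> X mX.
exact: (@std_normal3_unique (image_measure g3 mf) fE X mX).
Qed.

Lemma measurable_fst3 : measurable_fun setT (fun x : R * R * R => x.1.1).
Proof. exact: (measurableT_comp measurable_fst measurable_fst). Qed.

Lemma measurable_snd3 : measurable_fun setT (fun x : R * R * R => x.1.2).
Proof. exact: (measurableT_comp measurable_snd measurable_fst). Qed.

Lemma measurable_thd3 : measurable_fun setT (fun x : R * R * R => x.2).
Proof. exact: measurable_snd. Qed.

Lemma preserves3_swap12 : preserves3 (fun x => (x.1.2, x.1.1, x.2)).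
Proof.
apply: preserves3_rect.
  apply: measurable_fun_pair; last exact: measurable_thd3.
  by apply: measurable_fun_pair; [exact: measurable_snd3|exact: measurable_fst3].
move=> A B C mA mB mC; rewrite [(N A * N B)%E]muleC -(std_normal3X mB mA mC); congr g3.
by apply/seteqP; split => -[[x y] z]/= [[]].
Qed.

Lemma preserves3_swap23 : preserves3 (fun x => (x.1.1, x.2, x.1.2)).
Proof.
apply: preserves3_rect.
  apply: measurable_fun_pair; last exact: measurable_snd3.
  by apply: measurable_fun_pair; [exact: measurable_fst3|exact: measurable_thd3].
move=> A B C mA mB mC; rewrite -muleA [(N B * N C)%E]muleC muleA -(std_normal3X mA mC mB); congr g3.
by apply/seteqP; split => -[[x y] z]/= [[]].
Qed.

Lemma preserves3_opp1 : preserves3 (fun x => (- x.1.1, x.1.2, x.2)).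
Proof.
have mo : measurable_fun setT (fun x : R => - x) by exact: oppr_measurable.
apply: preserves3_rect.
  apply: measurable_fun_pair; last exact: measurable_thd3.
  apply: measurable_fun_pair; last exact: measurable_snd3.
  exact: (measurableT_comp mo measurable_fst3).
move=> A B C mA mB mC.
have mA' : measurable ((fun x : R => - x) @^-1` A).
  by rewrite -[X in measurable X]setTI; exact: mo.
have -> : N A = N ((fun x : R => - x) @^-1` A).
  rewrite -(integral_indicT N mA) -(integral_indicT N mA').
  rewrite ge0_integral_gauss1_opp//.
  exact/measurable_EFinP/measurable_indic.
by rewrite -(std_normal3X mA' mB mC).
Qed.

Lemma gauss2_rot (c s : R) X : c ^+ 2 + s ^+ 2 = 1 -> measurable X ->
  (N \x N)%E ((fun z => (c * z.1 + s * z.2, - s * z.1 + c * z.2)) @^-1` X) =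
  (N \x N)%E X.
Proof.
move=> cs mX; have mr := measurable_lin2 c s (- s) c.
have mX' : measurable ((fun z => (c * z.1 + s * z.2, - s * z.1 + c * z.2)) @^-1` X).
  by rewrite -[X in measurable X]setTI; exact: mr.
rewrite -(integral_indicT (N \x N)%E mX) -(integral_indicT (N \x N)%E mX').
apply: (ge0_integral_normal2_rot (f := fun z => (\1_X z)%:E) cs).
  exact/measurable_EFinP/measurable_indic.
by move=> z; rewrite lee_fin.
Qed.

Lemma preserves3_rot12 (c s : R) : c ^+ 2 + s ^+ 2 = 1 ->
  preserves3 (fun x => (c * x.1.1 + s * x.1.2, - s * x.1.1 + c * x.1.2, x.2)).
Proof.
move=> cs; have mr := measurable_lin2 c s (- s) c.
apply: preserves3_rect.
  apply: measurable_fun_pair; last exact: measurable_thd3.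
  exact: (measurableT_comp mr measurable_fst).
move=> A B C mA mB mC.
have mAB : measurable (A `*` B) by exact: measurableX.
pose r z := (c * z.1 + s * z.2, - s * z.1 + c * z.2).
have mAB' : measurable (r @^-1` (A `*` B)).
  by rewrite -[X in measurable X]setTI; exact: mr.
rewrite -(product_measure1E N N mA mB) -(gauss2_rot cs mAB) -/r.
rewrite -(product_measure1E (N \x N)%E N mAB' mC) std_normal3E//.
exact: measurableX.
Qed.

(** Conjugating by a coordinate swap carries the symmetry to another plane; the other rotation and
    the other sign changes arise in the same way. *)
Lemma preserves3_rot13 (c s : R) : c ^+ 2 + s ^+ 2 = 1 ->
  preserves3 (fun x => (c * x.1.1 + s * x.2, x.1.2, - s * x.1.1 + c * x.2)).
Proof.
move=> cs; exact: (preserves3_comp preserves3_swap23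
  (preserves3_comp (preserves3_rot12 cs) preserves3_swap23)).
Qed.

Lemma preserves3_rot23 (c s : R) : c ^+ 2 + s ^+ 2 = 1 ->
  preserves3 (fun x => (x.1.1, c * x.1.2 + s * x.2, - s * x.1.2 + c * x.2)).
Proof.
move=> cs; exact: (preserves3_comp preserves3_swap12
  (preserves3_comp (preserves3_rot13 cs) preserves3_swap12)).
Qed.

Lemma preserves3_opp2 : preserves3 (fun x => (x.1.1, - x.1.2, x.2)).
Proof.
exact: (preserves3_comp preserves3_swap12
  (preserves3_comp preserves3_opp1 preserves3_swap12)).
Qed.

Lemma preserves3_opp3 : preserves3 (fun x => (x.1.1, x.1.2, - x.2)).
Proof.
exact: (preserves3_comp preserves3_swap23
  (preserves3_comp preserves3_opp2 preserves3_swap23)).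
Qed.

End std_normal3.

(** * Trivariate normal laws *)

Section matrix3.
Context {R : realType}.
Local Notation g3 := (@std_normal3 R).

Definition mx3 (a b c d e f g h i : R) : 'M[R]_3 :=
  \matrix_(k, l) (nth [::] [:: [:: a; b; c]; [:: d; e; f]; [:: g; h; i]] k)`_l.

Lemma ord3P (P : 'I_3 -> Prop) :
  P (inord 0) -> P (inord 1) -> P (inord 2) -> forall i, P i.
Proof.
move=> P0 P1 P2 [[|[|[|//]]] Hi].
- by have -> : Ordinal Hi = inord 0 by apply: val_inj; rewrite /= inordK.
- by have -> : Ordinal Hi = inord 1 by apply: val_inj; rewrite /= inordK.
- by have -> : Ordinal Hi = inord 2 by apply: val_inj; rewrite /= inordK.
Qed.

Lemma sum_ord3 (V : nmodType) (F : 'I_3 -> V) :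
  \sum_i F i = F (inord 0) + F (inord 1) + F (inord 2).
Proof.
rewrite !big_ord_recr big_ord0 /= add0r.
by congr (F _ + F _ + F _); apply: val_inj; rewrite /= inordK.
Qed.

Lemma mx3_eta (A : 'M[R]_3) : exists a b c d e f g h i, A = mx3 a b c d e f g h i.
Proof.
exists (A (inord 0) (inord 0)), (A (inord 0) (inord 1)), (A (inord 0) (inord 2)),
 (A (inord 1) (inord 0)), (A (inord 1) (inord 1)), (A (inord 1) (inord 2)),
 (A (inord 2) (inord 0)), (A (inord 2) (inord 1)), (A (inord 2) (inord 2)).
by apply/matrixP; apply: ord3P; apply: ord3P; rewrite mxE !inordK.
Qed.

Lemma mx3_mul a b c d e f g h i a' b' c' d' e' f' g' h' i' :
  mx3 a b c d e f g h i *m mx3 a' b' c' d' e' f' g' h' i' =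
  mx3 (a * a' + b * d' + c * g') (a * b' + b * e' + c * h') (a * c' + b * f' + c * i')
      (d * a' + e * d' + f * g') (d * b' + e * e' + f * h') (d * c' + e * f' + f * i')
      (g * a' + h * d' + i * g') (g * b' + h * e' + i * h') (g * c' + h * f' + i * i').
Proof.
by apply/matrixP; apply: ord3P; apply: ord3P; rewrite !mxE sum_ord3 !mxE !inordK.
Qed.

Lemma mx3_tr a b c d e f g h i : (mx3 a b c d e f g h i)^T = mx3 a d g b e h c f i.
Proof. by apply/matrixP; apply: ord3P; apply: ord3P; rewrite !mxE !inordK. Qed.

Lemma mx3_inj a b c d e f g h i a' b' c' d' e' f' g' h' i' :
  mx3 a b c d e f g h i = mx3 a' b' c' d' e' f' g' h' i' ->
  [/\ [/\ a = a', b = b' & c = c'], [/\ d = d', e = e' & f = f'] &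
      [/\ g = g', h = h' & i = i']].
Proof.
move=> /matrixP E; split; split.
- by have := E (inord 0) (inord 0); rewrite !mxE !inordK.
- by have := E (inord 0) (inord 1); rewrite !mxE !inordK.
- by have := E (inord 0) (inord 2); rewrite !mxE !inordK.
- by have := E (inord 1) (inord 0); rewrite !mxE !inordK.
- by have := E (inord 1) (inord 1); rewrite !mxE !inordK.
- by have := E (inord 1) (inord 2); rewrite !mxE !inordK.
- by have := E (inord 2) (inord 0); rewrite !mxE !inordK.
- by have := E (inord 2) (inord 1); rewrite !mxE !inordK.
- by have := E (inord 2) (inord 2); rewrite !mxE !inordK.
Qed.

Lemma mx3_1 : 1%:M = mx3 1 0 0 0 1 0 0 0 1.
Proof.
apply/matrixP; apply: ord3P; apply: ord3P; rewrite !mxE -val_eqE /= !inordK//.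
Qed.

Lemma linmap3_mx3 a b c d e f g h i x : linmap3 (mx3 a b c d e f g h i) x =
  (a * x.1.1 + b * x.1.2 + c * x.2, d * x.1.1 + e * x.1.2 + f * x.2,
   g * x.1.1 + h * x.1.2 + i * x.2).
Proof. by rewrite /linmap3 /= !mxE !sum_ord3 !mxE !inordK. Qed.

Lemma linmap3M (A B : 'M[R]_3) x : linmap3 (A *m B) x = linmap3 A (linmap3 B x).
Proof.
have [a [b [c [d [e [f [g [h [i ->]]]]]]]]] := mx3_eta A.
have [a' [b' [c' [d' [e' [f' [g' [h' [i' ->]]]]]]]]] := mx3_eta B.
by rewrite mx3_mul !linmap3_mx3 /=; congr (_, _, _); ring.
Qed.

Lemma measurable_linmap3 (A : 'M[R]_3) : measurable_fun setT (linmap3 A).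
Proof.
have [a [b [c [d [e [f [g [h [i ->]]]]]]]]] := mx3_eta A.
rewrite (_ : @linmap3 R _ = fun x =>
  (a * x.1.1 + b * x.1.2 + c * x.2, d * x.1.1 + e * x.1.2 + f * x.2,
   g * x.1.1 + h * x.1.2 + i * x.2)); last by apply/funext => x; rewrite linmap3_mx3.
have m1 := @measurable_fst3 R; have m2 := @measurable_snd3 R.
have m3 := @measurable_thd3 R.
have M k l m : measurable_fun setT (fun x : R * R * R => k * x.1.1 + l * x.1.2 + m * x.2).
  apply: measurable_funD; last first.
    by apply: measurable_funM; [exact: measurable_cst|exact: m3].
  apply: measurable_funD.
    by apply: measurable_funM; [exact: measurable_cst|exact: m1].
  by apply: measurable_funM; [exact: measurable_cst|exact: m2].
apply: measurable_fun_pair; last exact: M.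
by apply: measurable_fun_pair; exact: M.
Qed.

(** The two halves are what replacing A by A G requires: the first keeps the law of A N, the second
    keeps A A^T. Membership is proved only for products of plane rotations and sign changes, which
    suffice. *)
Definition isometry3 (G : 'M[R]_3) := preserves3 (linmap3 G) /\ G *m G^T = 1%:M.

Lemma isometry3M G H : isometry3 G -> isometry3 H -> isometry3 (G *m H).
Proof.
move=> [pG oG] [pH oH]; split.
  rewrite (_ : @linmap3 R _ = linmap3 G \o linmap3 H); first exact: preserves3_comp.
  by apply/funext => x; rewrite linmap3M.
by rewrite trmx_mul mulmxA -(mulmxA G) oH mulmx1.
Qed.

Lemma isometry3_rot12 (c s : R) : c ^+ 2 + s ^+ 2 = 1 ->
  isometry3 (mx3 c s 0 (- s) c 0 0 0 1).
Proof.
move=> cs; split.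
  rewrite (_ : @linmap3 R _ = fun x =>
    (c * x.1.1 + s * x.1.2, - s * x.1.1 + c * x.1.2, x.2)).
    exact: preserves3_rot12.
  by apply/funext => x; rewrite linmap3_mx3; congr (_, _, _); ring.
rewrite mx3_tr mx3_mul mx3_1; congr mx3; first [ring | rewrite -cs; ring].
Qed.

Lemma isometry3_rot13 (c s : R) : c ^+ 2 + s ^+ 2 = 1 ->
  isometry3 (mx3 c 0 s 0 1 0 (- s) 0 c).
Proof.
move=> cs; split.
  rewrite (_ : @linmap3 R _ = fun x =>
    (c * x.1.1 + s * x.2, x.1.2, - s * x.1.1 + c * x.2)).
    exact: preserves3_rot13.
  by apply/funext => x; rewrite linmap3_mx3; congr (_, _, _); ring.
rewrite mx3_tr mx3_mul mx3_1; congr mx3; first [ring | rewrite -cs; ring].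
Qed.

Lemma isometry3_rot23 (c s : R) : c ^+ 2 + s ^+ 2 = 1 ->
  isometry3 (mx3 1 0 0 0 c s 0 (- s) c).
Proof.
move=> cs; split.
  rewrite (_ : @linmap3 R _ = fun x =>
    (x.1.1, c * x.1.2 + s * x.2, - s * x.1.2 + c * x.2)).
    exact: preserves3_rot23.
  by apply/funext => x; rewrite linmap3_mx3; congr (_, _, _); ring.
rewrite mx3_tr mx3_mul mx3_1; congr mx3; first [ring | rewrite -cs; ring].
Qed.

Lemma isometry3_1 : isometry3 1%:M.
Proof.
have := @isometry3_rot12 1 0; rewrite mx3_1 oppr0; apply.
by rewrite expr1n expr0n addr0.
Qed.

Lemma isometry3_opp1 : isometry3 (mx3 (-1) 0 0 0 1 0 0 0 1).
Proof.
split.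
  rewrite (_ : @linmap3 R _ = fun x => (- x.1.1, x.1.2, x.2)).
    exact: preserves3_opp1.
  by apply/funext => x; rewrite linmap3_mx3; congr (_, _, _); ring.
by rewrite mx3_tr mx3_mul mx3_1; congr mx3; ring.
Qed.

Lemma isometry3_opp2 : isometry3 (mx3 1 0 0 0 (-1) 0 0 0 1).
Proof.
split.
  rewrite (_ : @linmap3 R _ = fun x => (x.1.1, - x.1.2, x.2)).
    exact: preserves3_opp2.
  by apply/funext => x; rewrite linmap3_mx3; congr (_, _, _); ring.
by rewrite mx3_tr mx3_mul mx3_1; congr mx3; ring.
Qed.

Lemma isometry3_opp3 : isometry3 (mx3 1 0 0 0 1 0 0 0 (-1)).
Proof.
split.
  rewrite (_ : @linmap3 R _ = fun x => (x.1.1, x.1.2, - x.2)).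
    exact: preserves3_opp3.
  by apply/funext => x; rewrite linmap3_mx3; congr (_, _, _); ring.
by rewrite mx3_tr mx3_mul mx3_1; congr mx3; ring.
Qed.

(** Givens rotation: (c, s) is (b, a) normalized, so that a c - b s, an entry of the rotated matrix,
    vanishes. *)
Lemma exists_rotation (a b : R) : exists c s, c ^+ 2 + s ^+ 2 = 1 /\ a * c = b * s.
Proof.
have [->|a0] := eqVneq a 0.
  by exists 1, 0; rewrite expr1n expr0n addr0 mul0r mulr0.
pose r := Num.sqrt (a ^+ 2 + b ^+ 2).
have ab0 : 0 < a ^+ 2 + b ^+ 2.
  by rewrite ltr_pwDl ?sqr_ge0// lt_def sqrf_eq0 a0 sqr_ge0.
have r0 : r != 0 by rewrite gt_eqF// sqrtr_gt0.
exists (b / r), (a / r); split; last by field.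
rewrite !expr_div_n -mulrDl addrC sqr_sqrtr ?(ltW ab0)// divff// gt_eqF//.
Qed.

(** An RQ decomposition by three Givens rotations, clearing the entries (3,1), (3,2) and (2,1) in
    this order: each rotation combines two columns and preserves the zeros already made. *)
Lemma upper_triangular3 (A : 'M[R]_3) : exists2 G, isometry3 G &
  exists a b c e f i, A *m G = mx3 a b c 0 e f 0 0 i.
Proof.
have [a1 [b1 [c1 [d1 [e1 [f1 [g1 [h1 [i1 ->]]]]]]]]] := mx3_eta A.
have [c [s [cs k]]] := exists_rotation g1 i1.
have {cs} gG := isometry3_rot13 cs; set G := mx3 _ _ _ _ _ _ _ _ _ in gG.
have [a2 [b2 [c2 [d2 [e2 [f2 [h2 [i2 E2]]]]]]]] : exists a b c d e f h i,
    mx3 a1 b1 c1 d1 e1 f1 g1 h1 i1 *m G = mx3 a b c d e f 0 h i.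
  rewrite mx3_mul; do 8 eexists; congr mx3.
  by rewrite mulr0 addr0 k mulrN subrr.
have [c' [s' [cs' k']]] := exists_rotation h2 i2.
have {cs'} gG' := isometry3_rot23 cs'; set G' := mx3 _ _ _ _ _ _ _ _ _ in gG'.
have [a3 [b3 [c3 [d3 [e3 [f3 [i3 E3]]]]]]] : exists a b c d e f i,
    mx3 a2 b2 c2 d2 e2 f2 0 h2 i2 *m G' = mx3 a b c d e f 0 0 i.
  rewrite mx3_mul; do 7 eexists; congr mx3.
    by rewrite mul0r !mulr0 !addr0.
  by rewrite mul0r add0r k' mulrN subrr.
have [c4 [s4 [cs4 k4]]] := exists_rotation d3 e3.
have {cs4} gG4 := isometry3_rot12 cs4; set G4 := mx3 _ _ _ _ _ _ _ _ _ in gG4.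
exists (G *m G' *m G4); first exact: (isometry3M (isometry3M gG gG') gG4).
rewrite !mulmxA E2 E3 mx3_mul; do 6 eexists; congr mx3.
- by rewrite mulr0 addr0 k4 mulrN subrr.
- by rewrite !mul0r !mulr0 !addr0.
- by rewrite !mul0r !mulr0 !addr0.
Qed.

End matrix3.

(** * Uniqueness of centered normal laws and evaluation of [Phi3] *)

Section Phi3_eval.
Context {R : realType}.
Local Notation g3 := (@std_normal3 R).

(** Changing the sign of one normal coordinate negates one column, hence the corresponding diagonal
    entry. *)
Lemma upper_triangular3_ge0 (A : 'M[R]_3) : exists2 G, isometry3 G &
  exists a b c e f i, [/\ A *m G = mx3 a b c 0 e f 0 0 i, 0 <= a, 0 <= e & 0 <= i].
Proof.
have [G gG [a [b [c [e [f [i E]]]]]]] := upper_triangular3 A.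
have [H1 gH1 [a1 [a10 F1]]] : exists2 H : 'M[R]_3, isometry3 H & exists a',
    0 <= a' /\ forall b c e f i, mx3 a b c 0 e f 0 0 i *m H = mx3 a' b c 0 e f 0 0 i.
  have [a0|a0] := leP 0 a.
    exists 1%:M; first exact: isometry3_1.
    by exists a; split=> // *; rewrite mulmx1.
  exists (mx3 (-1) 0 0 0 1 0 0 0 1); first exact: isometry3_opp1.
  exists (- a); split; first by rewrite oppr_ge0 ltW.
  by move=> *; rewrite mx3_mul; congr mx3; ring.
have [H2 gH2 [e1 [e10 [b' F2]]]] : exists2 H : 'M[R]_3, isometry3 H & exists e',
    0 <= e' /\ exists b', forall a c f i, mx3 a b c 0 e f 0 0 i *m H = mx3 a b' c 0 e' f 0 0 i.
  have [e0|e0] := leP 0 e.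
    exists 1%:M; first exact: isometry3_1.
    by exists e; split=> //; exists b => *; rewrite mulmx1.
  exists (mx3 1 0 0 0 (-1) 0 0 0 1); first exact: isometry3_opp2.
  exists (- e); split; first by rewrite oppr_ge0 ltW.
  exists (- b) => *; rewrite mx3_mul; congr mx3; ring.
have [H3 gH3 [i1 [i10 [c' [f' F3]]]]] : exists2 H : 'M[R]_3, isometry3 H & exists i',
    0 <= i' /\ exists c' f', forall a b e, mx3 a b c 0 e f 0 0 i *m H = mx3 a b c' 0 e f' 0 0 i'.
  have [i0|i0] := leP 0 i.
    exists 1%:M; first exact: isometry3_1.
    by exists i; split=> //; exists c, f => *; rewrite mulmx1.
  exists (mx3 1 0 0 0 1 0 0 0 (-1)); first exact: isometry3_opp3.
  exists (- i); split; first by rewrite oppr_ge0 ltW.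
  by exists (- c), (- f) => *; rewrite mx3_mul; congr mx3; ring.
exists (G *m H1 *m H2 *m H3); first exact: (isometry3M (isometry3M (isometry3M gG gH1) gH2) gH3).
exists a1, b', c', e1, f', i1; split => //.
by rewrite !mulmxA E F1 F2 F3.
Qed.

Lemma corr_mx3E (r12 r13 r23 : R) :
  corr_mx3 r12 r13 r23 = mx3 1 r12 r13 r12 1 r23 r13 r23 1.
Proof. by []. Qed.

Lemma isometry3_law (A G : 'M[R]_3) B : isometry3 G -> measurable B ->
  g3 (linmap3 (A *m G) @^-1` B) = g3 (linmap3 A @^-1` B).
Proof.
move=> [[_ pG] _] mB; rewrite -[RHS]pG; last first.
  by rewrite -[X in measurable X]setTI; exact: measurable_linmap3.
have -> : linmap3 (A *m G) = linmap3 A \o linmap3 G.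
  by apply/funext => x; exact: linmap3M.
by rewrite comp_preimage.
Qed.

Lemma isometry3_gram (A G : 'M[R]_3) : isometry3 G -> (A *m G) *m (A *m G)^T = A *m A^T.
Proof. by move=> [_ oG]; rewrite trmx_mul mulmxA -(mulmxA A) oG mulmx1. Qed.

(* The law of a centered normal vector only depends on its covariance matrix:
   rotating the standard normal vector makes [A] upper triangular with a
   nonnegative diagonal, and such a square root of the covariance is unique. *)
Lemma normal_law3_unique (r12 r13 r23 : R) (A A' : 'M[R]_3) : r23 ^+ 2 < 1 ->
  A *m A^T = corr_mx3 r12 r13 r23 -> A' *m A'^T = corr_mx3 r12 r13 r23 ->
  forall B, measurable B -> g3 (linmap3 A @^-1` B) = g3 (linmap3 A' @^-1` B).
Proof.
move=> r1 AS AS' B mB.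
have [G gG [a [b [c [e [f [i [E a0 e0 i0]]]]]]]] := upper_triangular3_ge0 A.
have [G' gG' [a' [b' [c' [e' [f' [i' [E' a0' e0' i0']]]]]]]] :=
  upper_triangular3_ge0 A'.
rewrite -(isometry3_law A gG mB) -(isometry3_law A' gG' mB) E E'.
move: AS AS'; rewrite -(isometry3_gram A gG) -(isometry3_gram A' gG') E E'.
rewrite !corr_mx3E !mx3_tr !mx3_mul.
move=> /mx3_inj [[h1 h2 h3] [_ h4 h5] [_ _ h6]].
move=> /mx3_inj [[k1 k2 k3] [_ k4 k5] [_ _ k6]].
have sqr_inj (x y : R) : 0 <= x -> 0 <= y -> x ^+ 2 = y ^+ 2 -> x = y.
  by move=> x0 y0 /eqP; rewrite eqrXn2// => /eqP.
(* The entries of the triangular root are recovered from the last row upwards: i^2 = 1, then f and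
   c, then e^2, b e and a^2. *)
have I : i = i' by apply: sqr_inj => //; lra.
have i1 : i = 1 by apply: sqr_inj => //; rewrite expr1n; lra.
subst i'; subst i.
have F : f = f' by lra.
have C : c = c' by lra.
subst f' c'.
have Ee : e = e' by apply: sqr_inj => //; lra.
subst e'.
(* Here e^2 = 1 - r23^2 is positive, so b can be recovered from b e. The entry a may still be 0,
   which is the degenerate case. *)
have e_neq0 : e != 0.
  apply/eqP => ez; subst e.
  have fr : f = r23 by lra.
  by subst f; lra.
have Bb : b = b' by apply: (mulIf e_neq0); lra.
subst b'.
have Aa : a = a' by apply: sqr_inj => //; lra.
by subst a'.
Qed.

Definition orthant3 (z1 z2 z3 : R) : set (R * R * R) :=
  [set x | [/\ x.1.1 <= z1, x.1.2 <= z2 & x.2 <= z3]].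

Lemma measurable_orthant3 (z1 z2 z3 : R) : measurable (orthant3 z1 z2 z3).
Proof.
rewrite (_ : orthant3 _ _ _ = `]-oo, z1]%classic `*` `]-oo, z2]%classic `*` `]-oo, z3]%classic).
  by apply: measurableX => //; exact: measurableX.
by apply/seteqP; split => -[[x y] z] /=; rewrite !in_itv /= => -[] // [].
Qed.

(** Turns the value chosen by [xget] into a Gaussian measure: a square root [A] supplies one
    admissible law, and uniqueness of the law makes all candidates for the value equal. *)
Lemma Phi3E (A : 'M[R]_3) (z1 z2 z3 r12 r13 r23 : R) : r23 ^+ 2 < 1 ->
  A *m A^T = corr_mx3 r12 r13 r23 ->
  Phi3 z1 z2 z3 r12 r13 r23 = fine (g3 (linmap3 A @^-1` orthant3 z1 z2 z3)).
Proof.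
move=> r1 AS; apply: xget_unique.
  pose fM := isMeasurableFun.Build _ _ _ _ _ (measurable_linmap3 A).
  pose F : {mfun _ >-> _} := HB.pack (linmap3 A) fM.
  exists (distribution g3 F) => //.
  by exists A.
move=> p [Q [A' AS' QE] ->]; congr fine.
rewrite QE; last exact: measurable_orthant3.
exact: (normal_law3_unique r1 AS' AS (measurable_orthant3 _ _ _)).
Qed.

End Phi3_eval.

Lemma ge0_integral_mrestr d (T : measurableType d) (R : realType)
    (m : {measure set T -> \bar R}) (E : set T) (mE : measurable E) (f : T -> \bar R) :
  measurable_fun setT f -> (forall x, (0 <= f x)%E) ->
  (\int[mrestr m mE]_x f x = \int[m]_(x in E) f x)%E.
Proof.
move=> mf f0.
have mEC : measurable (~` E) by exact: measurableC.
have disj : [disjoint ~` E & E] by rewrite disj_set2E setICl.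
have mfU : measurable_fun (~` E `|` E) f by rewrite setvU.
rewrite -(setvU E) (ge0_integral_setU _ mEC mE mfU (fun x _ => f0 x) disj).
rewrite (eq_measure_integral mzero); last first.
  move=> A mA AE; rewrite /mzero /= /mrestr.
  rewrite (_ : A `&` E = set0) ?measure0// -subset0 => x [] /AE /= nEx Ex.
  exact: nEx.
rewrite integral_measure_zero add0e; apply: eq_measure_integral => A mA AE.
by rewrite /= /mrestr setIidl.
Qed.

(** * Increments of Brownian motion *)

Section independence.
Context d (Omega : measurableType d) (R : realType) (P : probability Omega R).
Variable W : R -> {RV P >-> R}.
Hypothesis bm : brownian_motion W.

Definition incr (a : nat -> R) (i : nat) (w : Omega) : R := W (a i.+1) w - W (a i) w.

(** A pi-system generating the information in the first [n] increments, of the exact shape to which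
    [bm_independent] applies. *)
Definition incr_cylinder (n : nat) (a : nat -> R) : set (set Omega) :=
  [set E | exists2 B : nat -> set R, (forall i, measurable (B i)) &
     E = [set w | forall i, (i < n)%N -> B i (incr a i w)]].

Lemma measurable_incr a i : measurable_fun setT (incr a i).
Proof. by apply: measurable_funB. Qed.

Lemma measurable_incr_cylinder n a : incr_cylinder n a `<=` measurable.
Proof.
move=> _ [B mB ->].
rewrite (_ : [set _ | _] = \bigcap_(i in `I_n) (incr a i @^-1` B i)); last first.
  by apply/seteqP; split => w /= H i; exact: H.
case: n => [|n].
  by rewrite II0 bigcap_set0.
apply: bigcap_measurable; first by exists 0%N.
move=> i _; rewrite -[X in measurable X]setTI; apply: measurable_incr => //.
Qed.

Lemma incr_cylinderI n a : setI_closed (incr_cylinder n a).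
Proof.
move=> _ _ [B mB ->] [C mC ->]; exists (fun i => B i `&` C i).
  by move=> i; exact: measurableI.
apply/seteqP; split => w /=; first by move=> [H1 H2] i iN; split; [exact: H1|exact: H2].
by move=> H; split => i iN; have [] := H i iN.
Qed.

Lemma incr_cylinderT n a : incr_cylinder n a setT.
Proof. by exists (fun=> setT) => //; apply/seteqP; split. Qed.

Definition past n a : set (set Omega) := <<s incr_cylinder n a >>.

Lemma past_measurable n a : past n a `<=` measurable.
Proof.
apply: smallest_sub; last exact: measurable_incr_cylinder.
exact: sigma_algebra_measurable.
Qed.

Lemma measurable_diff r q C : measurable C -> measurable [set w | C (W r w - W q w)].
Proof.
move=> mC.
have m : measurable_fun setT (fun w => W r w - W q w) by exact: measurable_funB.
by rewrite -[X in measurable X]setTI; exact: (m measurableT C mC).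
Qed.

(** For fixed [C] both sides are finite measures in [E]. On cylinders they agree by the product rule
    for n + 1 increments, and the pi-system argument extends this to the whole past. Equality of
    [a n] and [r] is allowed: the increment is then constantly 0 and its event is trivial. *)
Lemma past_indep_incr n a r E C : 0 <= a 0%N ->
  (forall i, (i < n)%N -> a i < a i.+1) -> a n <= r -> past n a E -> measurable C ->
  P (E `&` [set w | C (W r w - W (a n) w)]) =
  (P E * P [set w | C (W r w - W (a n) w)%R])%E.
Proof.
move=> a0 ainc; rewrite le_eqVlt => /predU1P[<-|ar] pE mC.
  under eq_set do rewrite subrr.
  have [C0|C0] := pselect (C 0).
    rewrite (_ : [set _ | _] = setT); last by apply/seteqP; split.
    by rewrite setIT probability_setT mule1.
  rewrite (_ : [set _ | _] = set0); last by apply/seteqP; split.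
  by rewrite setI0 measure0 mule0.
have mZ := measurable_diff r (a n) mC.
set ZC := [set w | _] in mZ *.
have PZ : P ZC = (fine (P ZC))%:E by rewrite fineK// fin_num_measure.
have PZ0 : 0 <= fine (P ZC) by rewrite fine_ge0.
have scaleE F : mscale (NngNum PZ0) P F = (P F * P ZC)%E.
  by rewrite /mscale/= muleC PZ.
suff : mrestr P mZ E = mscale (NngNum PZ0) P E by rewrite scaleE.
apply: (g_sigma_algebra_measure_unique (incr_cylinder n a)
   (@measurable_incr_cylinder n a) (fun=> setT) (fun=> incr_cylinderT n a)
   _ (mrestr P mZ) (mscale (NngNum PZ0) P) (@incr_cylinderI n a)); last exact: pE.
- by rewrite bigcup_const//; exists 0%N.
- move=> _ [B mB ->]; apply: (etrans _ (esym (scaleE _))).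
  (* The times are extended by [r], and the constraints by [C] on the additional increment. *)
  pose a' i := if (i <= n)%N then a i else r.
  pose B' i := if (i < n)%N then B i else C.
  have mB' i : measurable (B' i) by rewrite /B'; case: ifP.
  have a'0 : 0 <= a' 0%N by rewrite /a'.
  have a'inc i : (i < n.+1)%N -> a' i < a' i.+1.
    rewrite ltnS leq_eqVlt => /predU1P[->|iN]; first by rewrite /a' leqnn ltnn.
    by rewrite /a' iN (ltnW iN) ainc.
  have a'n : a' n = a n by rewrite /a' leqnn.
  have a'n1 : a' n.+1 = r by rewrite /a' ltnn.
  have a'i i : (i < n)%N -> (a' i = a i) * (a' i.+1 = a i.+1).
    by move=> iN; rewrite /a' iN (ltnW iN).
  have := bm_independent bm a'0 a'inc mB'.
  rewrite big_nat_recr//= a'n a'n1.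
  have := bm_independent bm a0 ainc mB.
  under [X in _ = (X * _)%E -> _]eq_big_nat => i /andP[_ iN] do
    rewrite !(a'i _ iN) /B' iN.
  move=> <-; rewrite {2}/B' ltnn muleC => <-.
  congr (P _); apply/seteqP; split => w /=.
    move=> [H1 H2] i; rewrite ltnS leq_eqVlt => /predU1P[->|iN].
      by rewrite a'n a'n1 /B' ltnn.
    by rewrite !(a'i _ iN) /B' iN; exact: H1.
  move=> H1; split => [i iN|].
    by have := H1 i (ltnW iN); rewrite !(a'i _ iN) /B' iN.
  by have := H1 n (ltnSn n); rewrite a'n a'n1 /B' ltnn.
- move=> _; have H : (P (setT `&` ZC) < +oo)%E.
    by rewrite setTI (le_lt_trans (probability_le1 _ _)) ?ltry.
  exact: H.
Qed.

Lemma pastI n a E F : past n a E -> past n a F -> past n a (E `&` F).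
Proof.
exact: (@measurableI _ (g_sigma_algebraType (incr_cylinder n a))).
Qed.

Lemma past_incr n a i C : (i < n)%N -> measurable C ->
  past n a [set w | C (incr a i w)].
Proof.
move=> iN mC; apply: sub_sigma_algebra.
exists (fun j => if j == i then C else setT); first by move=> j; case: ifP.
apply/seteqP; split => w /=; first by move=> Cw j _; case: eqP => [->|].
by move=> /(_ i iN); rewrite eqxx.
Qed.

Lemma past_mono n m a a' : (n <= m)%N ->
  (forall i, (i <= n)%N -> a' i = a i) -> past n a `<=` past m a'.
Proof.
move=> nm aa'; apply: smallest_sub; first exact: smallest_sigma_algebra.
move=> _ [B mB ->]; apply: sub_sigma_algebra.
exists (fun i => if (i < n)%N then B i else setT).
  by move=> i; case: ifP.
apply/seteqP; split => w /= H i im.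
  case: ifP => // iN; rewrite /incr !aa'//; [exact: H|exact: ltnW].
have := H i (leq_trans im nm); rewrite im /incr !aa'//; exact: ltnW.
Qed.

(** [Omega] with the sigma-algebra of the past, so that being determined by the past is plain
    measurability on this type. *)
Definition past_space n a := g_sigma_algebraType (incr_cylinder n a).

(** Since W starts at 0 at time [a 0], its value is a sum of increments. *)
Lemma past_measurable_W n a j : a 0%N = 0 -> (j <= n)%N ->
  measurable_fun [set: past_space n a] (W (a j) : past_space n a -> R).
Proof.
move=> a0; elim: j => [_|j IH jn].
  rewrite a0 (_ : (W 0 : _ -> R) = cst 0); first exact: measurable_cst.
  by apply/funext => w; exact: bm_start bm w.
rewrite (_ : (W (a j.+1) : _ -> R) = (fun w => W (a j) w + incr a j w)); last first.
  by apply/funext => w; rewrite /incr addrC subrK.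
apply: measurable_funD; first exact: IH (ltnW jn).
move=> _ B mB; rewrite setTI; exact: past_incr.
Qed.

Lemma incr_law q r C : 0 <= q -> q <= r -> measurable C ->
  P [set w | C (W r w - W q w)] = gauss1 R [set z : R | C (Num.sqrt (r - q) * z)].
Proof.
move=> q0; rewrite le_eqVlt => /predU1P[<-|qr] mC.
  rewrite subrr sqrtr0.
  have -> : [set w | C (W q w - W q w)] = [set _ | C 0].
    by apply/seteqP; split => w /=; rewrite subrr.
  have -> : [set z : R | C (0 * z)] = [set _ | C 0].
    by apply/seteqP; split => z /=; rewrite mul0r.
  have [C0|C0] := pselect (C 0).
    have CT (U : Type) : [set _ : U | C 0] = setT by apply/seteqP; split.
    by rewrite !CT !probability_setT.
  have CT (U : Type) : [set _ : U | C 0] = set0 by apply/seteqP; split.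
  by rewrite !CT !measure0.
rewrite (bm_normal bm q0 qr mC); apply: gauss1_scale => //.
by rewrite sqrtr_gt0 subr_gt0.
Qed.

(** [past_indep_incr] is used twice: the increment up to [t] is first absorbed into the past of the
    times extended by [t]. *)
Lemma past_indep_incr2 n a t T E C D : 0 <= a 0%N ->
  (forall i, (i < n)%N -> a i < a i.+1) -> a n <= t -> t <= T ->
  past n a E -> measurable C -> measurable D ->
  P (E `&` [set w | C (W t w - W (a n) w)] `&` [set w | D (W T w - W t w)]) =
  (P E * P [set w | C (W t w - W (a n) w)%R] * P [set w | D (W T w - W t w)%R])%E.
Proof.
move=> a0 ainc; rewrite le_eqVlt => /predU1P[<-|ant] tT pE mC mD.
  have -> : [set w | C (W (a n) w - W (a n) w)] = [set _ | C 0].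
    by apply/seteqP; split => w /=; rewrite subrr.
  have [C0|C0] := pselect (C 0).
    have -> : [set _ : Omega | C 0] = setT by apply/seteqP; split.
    by rewrite setIT probability_setT mule1 (past_indep_incr a0 ainc tT pE mD).
  have -> : [set _ : Omega | C 0] = set0 by apply/seteqP; split.
  by rewrite setI0 set0I measure0 mule0 mul0e.
pose a' i := if (i <= n)%N then a i else t.
have a'n : a' n = a n by rewrite /a' leqnn.
have a'n1 : a' n.+1 = t by rewrite /a' ltnn.
have a'0 : 0 <= a' 0%N by rewrite /a'.
have a'inc i : (i < n.+1)%N -> a' i < a' i.+1.
  rewrite ltnS leq_eqVlt => /predU1P[->|iN]; first by rewrite /a' leqnn ltnn.
  by rewrite /a' iN (ltnW iN) ainc.
have pE' : past n.+1 a' E.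
  apply: past_mono pE; first exact: leqnSn.
  by move=> i iN; rewrite /a' iN.
have pZ : past n.+1 a' [set w | C (W t w - W (a n) w)].
  have := @past_incr n.+1 a' n C (ltnSn n) mC.
  by rewrite /incr a'n a'n1.
have a'T : a' n.+1 <= T by rewrite a'n1.
have := past_indep_incr a'0 a'inc a'T (pastI pE' pZ) mD.
rewrite a'n1 => ->; congr (_ * _)%E.
by rewrite (past_indep_incr a0 ainc (ltW ant) pE mC).
Qed.

(** Independence for integrands: restricted to [E], the pair of increments has a law equal on
    rectangles to P E times a Gaussian product law. *)
Lemma past_integral_incr2 n a t T E (f : R * R -> \bar R) : 0 <= a 0%N ->
  (forall i, (i < n)%N -> a i < a i.+1) -> a n <= t -> t <= T ->
  past n a E -> measurable_fun setT f -> (forall z, (0 <= f z)%E) ->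
  (\int[P]_(w in E) f (W t w - W (a n) w, W T w - W t w)%R =
   P E * \int[gauss1 R \x gauss1 R]_z
     f (Num.sqrt (t - a n) * z.1, Num.sqrt (T - t) * z.2)%R)%E.
Proof.
move=> a0 ainc ant tT pE mf f0.
have an0 : 0 <= a n.
  by elim: n ainc {ant pE} => [//|n IH] H; apply: (le_trans (IH _)); [move=> i ?; apply: H; exact: ltnW|apply/ltW/H].
have t0 : 0 <= t by exact: le_trans ant.
have mE := past_measurable pE.
have mZD : measurable_fun setT (fun w => (W t w - W (a n) w, W T w - W t w)).
  by apply: measurable_fun_pair; exact: measurable_funB.
have msc : measurable_fun setT (fun z : R * R =>
    (Num.sqrt (t - a n) * z.1, Num.sqrt (T - t) * z.2)).
  have m1 := measurableT_comp (@mulrl_measurable R setT (Num.sqrt (t - a n))) (@measurable_fst _ _ R R).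
  have m2 := measurableT_comp (@mulrl_measurable R setT (Num.sqrt (T - t))) (@measurable_snd _ _ R R).
  exact: (measurable_fun_pair m1 m2).
have mfZD : measurable_fun setT (fun w => f (W t w - W (a n) w, W T w - W t w)).
  exact: (measurableT_comp mf mZD).
rewrite -(ge0_integral_mrestr P mE mfZD (fun x => f0 _)).
rewrite -(ge0_integral_image_measure (mrestr P mE) mZD mf f0).
rewrite -(ge0_integral_image_measure (gauss1 R \x gauss1 R)%E msc mf f0).
have PE : (fine (P E))%:E = P E by rewrite fineK// fin_num_measure.
have PE0 : 0 <= fine (P E) by rewrite fine_ge0.
rewrite -PE -(ge0_integral_mscale _ measurableT (NngNum PE0) mf (fun x _ => f0 x)).
apply: eq_measure_integral => A mA _.
apply: measure_prod_unique => //.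
  have H : (P (setT `&` E) < +oo)%E.
    by rewrite setTI (le_lt_trans (probability_le1 _ _)) ?ltry.
  exact: H.
move=> C D mC mD.
have mC' : measurable [set z : R | C (Num.sqrt (t - a n) * z)].
  rewrite -[X in measurable X]setTI.
  exact: (@mulrl_measurable R setT (Num.sqrt (t - a n))).
have mD' : measurable [set z : R | D (Num.sqrt (T - t) * z)].
  rewrite -[X in measurable X]setTI.
  exact: (@mulrl_measurable R setT (Num.sqrt (T - t))).
transitivity (P E * gauss1 R [set z : R | C (Num.sqrt (t - a n) * z)%R] *
    gauss1 R [set z : R | D (Num.sqrt (T - t) * z)%R])%E; last first.
  rewrite -muleA -(product_measure1E (gauss1 R) (gauss1 R) mC' mD') -[X in (X * _)%E = _]PE.
  by [].
rewrite -(incr_law an0 ant mC) -(incr_law t0 tT mD).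
rewrite -(past_indep_incr2 a0 ainc ant tT pE mC mD).
rewrite image_measureE /= /mrestr; congr (P _).
by apply/seteqP; split => w /=; [move=> [[]]|move=> [[]]].
Qed.

End independence.

(** * Joint law of the increments over [0, s], [s, t] and [t, T] *)

Section triple_law.
Context d (Omega : measurableType d) (R : realType) (P : probability Omega R).
Variable W : R -> {RV P >-> R}.
Hypothesis bm : brownian_motion W.
Local Notation g3 := (@std_normal3 R).

(** The latest increment comes first, which makes the matrix leading to (W_T, W_t, W_s) upper
    triangular. *)
Definition incr3 (s t T : R) (w : Omega) : R * R * R :=
  (W T w - W t w, W t w - W s w, W s w).

Definition scale3 (a b c : R) (x : R * R * R) : R * R * R :=
  (a * x.1.1, b * x.1.2, c * x.2).

Lemma measurable_incr3 s t T : measurable_fun setT (incr3 s t T).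
Proof.
have m1 : measurable_fun setT (fun w => W T w - W t w) by exact: measurable_funB.
have m2 : measurable_fun setT (fun w => W t w - W s w) by exact: measurable_funB.
have m3 : measurable_fun setT (fun w => W s w) by [].
exact: (measurable_fun_pair (measurable_fun_pair m1 m2) m3).
Qed.

Lemma measurable_scale3 a b c : measurable_fun setT (scale3 a b c).
Proof.
have m1 := measurableT_comp (@mulrl_measurable R setT a) (@measurable_fst3 R).
have m2 := measurableT_comp (@mulrl_measurable R setT b) (@measurable_snd3 R).
have m3 := measurableT_comp (@mulrl_measurable R setT c) (@measurable_thd3 R).
exact: (measurable_fun_pair (measurable_fun_pair m1 m2) m3).
Qed.

Lemma incr3_law s t T B : 0 < s -> s <= t -> t <= T -> measurable B ->
  P (incr3 s t T @^-1` B) =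
  g3 (scale3 (Num.sqrt (T - t)) (Num.sqrt (t - s)) (Num.sqrt s) @^-1` B).
Proof.
move=> s0 st tT; set sc := scale3 _ _ _.
have m1 := @measurable_incr3 s t T.
have m2 : measurable_fun setT sc by exact: measurable_scale3.
apply: (@measure_prod3_unique _ _ _ _ _ _ _ (image_measure P m1) (image_measure g3 m2)).
  have H : (P (incr3 s t T @^-1` setT) < +oo)%E.
    by rewrite preimage_setT probability_setT ltry.
  exact: H.
move=> A C D mA mC mD.
(* With the two times 0 and s, the past is the information in W_s, because W_0 = 0. *)
pose a (i : nat) : R := if i is 0 then 0 else s.
have a0 : 0 <= a 0%N by [].
have ainc i : (i < 1)%N -> a i < a i.+1 by case: i.
have mk k (F : set R) : measurable F -> measurable [set z : R | F (k * z)].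
  by move=> mF; rewrite -[X in measurable X]setTI; exact: (@mulrl_measurable R setT k).
have pE : past W 1 a [set w | D (W s w)].
  have := @past_incr _ _ _ _ W 1 a 0 D erefl mD.
  by under eq_set do rewrite /incr /= (bm_start bm) subr0.
have s0' := ltW s0.
have t0 : 0 <= t by exact: le_trans st.
have H := past_indep_incr2 bm a0 ainc st tT pE mC mA.
have L1 := incr_law bm t0 tT mA.
have L2 := incr_law bm s0' st mC.
have L3 := incr_law bm (lexx 0) s0' mD.
have {}L3 : P [set w | D (W s w)] = gauss1 R [set z : R | D (Num.sqrt s * z)].
  by rewrite -[in RHS](subr0 s) -L3; congr (P _); apply/seteqP; split => w /=;
    rewrite (bm_start bm) subr0.
transitivity (P ([set w | D (W s w)] `&` [set w | C (W t w - W s w)]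
   `&` [set w | A (W T w - W t w)])).
  rewrite image_measureE; congr (P _).
  by apply/seteqP; split => w /=; [move=> [[]]|move=> [[]]].
rewrite {}H L1 L2 L3.
transitivity (g3 ([set z : R | A (Num.sqrt (T - t) * z)] `*`
  [set z : R | C (Num.sqrt (t - s) * z)] `*` [set z : R | D (Num.sqrt s * z)])); last first.
  transitivity (g3 (sc @^-1` (A `*` C `*` D))); last by [].
  apply: (congr1 (fun B => g3 B)).
  by apply/seteqP; split => -[[x y] z] /=; move=> [[]].
rewrite (std_normal3X (mk _ _ mA) (mk _ _ mC) (mk _ _ mD)).
by rewrite -muleA muleC [X in (X * _)%E = _]muleC.
Qed.

Lemma ge0_integral_incr3 s t T (f : R * R * R -> \bar R) :
  0 < s -> s <= t -> t <= T ->
  measurable_fun setT f -> (forall x, (0 <= f x)%E) ->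
  (\int[P]_w f (incr3 s t T w) = \int[g3]_x
    f (scale3 (Num.sqrt (T - t)) (Num.sqrt (t - s)) (Num.sqrt s) x))%E.
Proof.
move=> s0 st tT mf f0.
rewrite -(ge0_integral_image_measure P (@measurable_incr3 s t T) mf f0).
rewrite -(ge0_integral_image_measure g3 (@measurable_scale3 _ _ _) mf f0).
by apply: eq_measure_integral => A mA _; exact: incr3_law.
Qed.

End triple_law.

(** * Integrals against the trivariate standard normal law *)

Section std_normal3_integrals.
Context {R : realType}.
Local Notation g3 := (@std_normal3 R).
Local Notation N := (gauss1 R).

Definition gauss2 : set (R * R) -> \bar R := (N \x N)%E.

HB.instance Definition _ := isMeasure.Build _ (R * R)%type R gauss2
  (measure0 (N \x N)%E) (measure_ge0 (N \x N)%E)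
  (@measure_semi_sigma_additive _ _ _ (N \x N)%E).

Let gauss2T : gauss2 setT = 1%E.
Proof.
rewrite -setXTT; apply: (etrans (product_measure1E N N measurableT measurableT)).
have N1 : gauss1 R setT = 1%E by exact: probability_setT.
by apply: (etrans (congr2 mule N1 N1)); rewrite mule1.
Qed.

HB.instance Definition _ :=
  Measure_isProbability.Build _ (R * R)%type R gauss2 gauss2T.

Lemma ge0_integral_std_normal3 (f : R * R * R -> \bar R) :
  measurable_fun setT f -> (forall x, (0 <= f x)%E) ->
  (\int[g3]_x f x = \int[gauss2]_p \int[N]_z f (p, z))%E.
Proof.
move=> mf f0; rewrite -(fubini_tonelli1 (m1 := gauss2) (m2 := N) f mf f0).
by apply: eq_measure_integral => A mA _; apply/esym; exact: std_normal3E.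
Qed.

(** Since [e] is nonzero, each slice in the last coordinate is a single point, which the normal law
    does not charge. *)
Lemma std_normal3_hyperplane (a b e c : R) : e != 0 ->
  g3 [set x | a * x.1.1 + b * x.1.2 + e * x.2 = c] = 0%E.
Proof.
move=> e0.
have ml : measurable_fun setT (fun x : R * R * R => a * x.1.1 + b * x.1.2 + e * x.2).
  have m1 := measurableT_comp (@mulrl_measurable R setT a) (@measurable_fst3 R).
  have m2 := measurableT_comp (@mulrl_measurable R setT b) (@measurable_snd3 R).
  have m3 := measurableT_comp (@mulrl_measurable R setT e) (@measurable_thd3 R).
  exact: (measurable_funD (measurable_funD m1 m2) m3).
have mH : measurable [set x : R * R * R | a * x.1.1 + b * x.1.2 + e * x.2 = c].
  by rewrite -[X in measurable X]setTI; exact: (ml measurableT [set c]).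
set H := [set x | _] in mH *.
have mI : measurable_fun setT (fun x : R * R * R => (\1_H x : R)%:E).
  exact/measurable_EFinP/measurable_indic.
have I0 x : (0 <= (\1_H x : R)%:E)%E by rewrite lee_fin.
rewrite -(integral_indicT g3 mH) (ge0_integral_std_normal3 mI I0).
apply: integral0_eq => -[x y] _ /=.
have mc := measurable_set1 ((c - (a * x + b * y)) / e).
rewrite -(@gauss1_set1 R ((c - (a * x + b * y)) / e)) -(integral_indicT N mc).
apply: eq_integral => z _; congr (_%:E).
rewrite !indicE; congr ((nat_of_bool _)%:R); apply/idP/idP; rewrite !inE /=.
- by move=> <-; rewrite addrAC subrr add0r mulrC mulKf.
- by move=> ->; rewrite /H /=; field.
Qed.

Lemma preserves3_integral f (g : R * R * R -> \bar R) : preserves3 f ->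
  measurable_fun setT g -> (forall x, (0 <= g x)%E) ->
  (\int[g3]_x g (f x) = \int[g3]_x g x)%E.
Proof.
move=> [mf pf] mg g0; rewrite -(ge0_integral_image_measure g3 mf mg g0).
by apply: eq_measure_integral => A mA _; exact: pf.
Qed.

(** This is phi(- z - c) / phi(z) for the standard normal density phi. For c = 2 mu sigma it equals
    exp(- 2 mu Y), where Y = mu sigma^2 + sigma z is the drifted increment. *)
Definition tilt_density (c z : R) : R := expR (- (c * z) - c ^+ 2 / 2).

Lemma measurable_tilt_density c : measurable_fun setT (tilt_density c).
Proof.
by apply: measurableT_comp => //; apply: measurable_funB => //;
  apply: measurableT_comp => //; exact: measurable_funM.
Qed.

Lemma std_normal3_tilt3 (c : R) (f : R * R * R -> \bar R) :
  measurable_fun setT f -> (forall x, (0 <= f x)%E) ->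
  (\int[g3]_x f x =
   \int[g3]_x (f (x.1, - x.2 - c)%R * (tilt_density c x.2)%:E))%E.
Proof.
move=> mf f0; have mr : measurable_fun setT (fun x : R * R * R => (x.1, - x.2 - c)).
  apply: measurable_fun_pair; first exact: measurable_fst.
  by apply: measurable_funB => //; exact: measurable_funN.
have mg : measurable_fun setT (fun x : R * R * R =>
    f (x.1, - x.2 - c)%R * (tilt_density c x.2)%:E)%E.
  apply: emeasurable_funM; first exact: (measurableT_comp mf mr).
  apply/measurable_EFinP.
  exact: (measurableT_comp (@measurable_tilt_density c) (@measurable_thd3 R)).
have g0 (x : R * R * R) : (0 <= f (x.1, - x.2 - c)%R * (tilt_density c x.2)%:E)%E.
  by rewrite mule_ge0// lee_fin expR_ge0.
rewrite (ge0_integral_std_normal3 mf f0) (ge0_integral_std_normal3 mg g0).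
apply: eq_integral => p _.
exact: (ge0_integral_gauss1_tilt c (measurableT_comp mf (measurable_pair1 p)) (fun z => f0 _)).
Qed.

Lemma std_normal3_tilt2 (c : R) (f : R * R * R -> \bar R) :
  measurable_fun setT f -> (forall x, (0 <= f x)%E) ->
  (\int[g3]_x f x =
   \int[g3]_x (f (x.1.1, - x.1.2 - c, x.2)%R * (tilt_density c x.1.2)%:E))%E.
Proof.
move=> mf f0; have sw := @preserves3_swap23 R.
have msw := measurableT_comp mf sw.1.
rewrite -(preserves3_integral sw mf f0) (std_normal3_tilt3 c msw (fun x => f0 _)).
have mr : measurable_fun setT (fun x : R * R * R => (x.1.1, - x.1.2 - c, x.2)).
  apply: measurable_fun_pair; last exact: measurable_thd3.
  apply: measurable_fun_pair; first exact: measurable_fst3.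
  by apply: measurable_funB => //; apply: measurable_funN; exact: measurable_snd3.
have mg : measurable_fun setT (fun x : R * R * R =>
    f (x.1.1, - x.1.2 - c, x.2)%R * (tilt_density c x.1.2)%:E)%E.
  apply: emeasurable_funM; first exact: (measurableT_comp mf mr).
  apply/measurable_EFinP.
  exact: (measurableT_comp (@measurable_tilt_density c) (@measurable_snd3 R)).
have g0 (x : R * R * R) :
    (0 <= f (x.1.1, - x.1.2 - c, x.2)%R * (tilt_density c x.1.2)%:E)%E.
  by rewrite mule_ge0// lee_fin expR_ge0.
by rewrite -[RHS](preserves3_integral sw mg g0).
Qed.

End std_normal3_integrals.

(** * Stopping on a grid *)

Section paths.
Context {R : realType}.
Variables (f : R -> R) (D : set R).
Hypothesis cf : {within D, continuous f}.

Lemma within_continuousE (x e : R) : D x -> 0 < e ->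
  exists2 h, 0 < h & forall y, D y -> `|x - y| < h -> `|f x - f y| < e.
Proof.
move=> Dx e0.
have /cvgrPdist_lt /(_ e e0) : f y @[y --> within D (nbhs x)] --> f x.
  by have /subspace_continuousP := cf; apply.
rewrite near_withinE => -[h /= h0 H]; exists h => // y Dy xy.
exact: H.
Qed.

(** Heine's theorem, through the covering form of compactness with the modulus as the small
    parameter. *)
Lemma segment_unif_continuous (s t e : R) : `[s, t]%classic `<=` D -> 0 < e ->
  exists2 h, 0 < h & forall x y, s <= x <= t -> s <= y <= t ->
    `|x - y| < h -> `|f x - f y| < e.
Proof.
move=> stD e0; pose K := `[s, t]%classic.
have cK : compact K by exact: segment_compact.
pose Q (h : R) (x : R) := forall y, K y -> `|x - y| < h -> `|f x - f y| < e.
have /near_covering_withinP cov := (compact_near_coveringP K).1 cK.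
have := cov R (0^'+) Q _.
case=> [x Kx|h /= h0 H].
  have e20 : 0 < e / 2 by rewrite divr_gt0.
  have [h h0 H] := within_continuousE (stD x Kx) e20.
  have h20 : 0 < h / 2 by rewrite divr_gt0.
  exists (ball x (h / 2), [set k : R | k < h / 2]) => /=.
    split; first exact: nbhsx_ballx.
    by exists (h / 2) => //= k; rewrite /= sub0r normrN => /ltr_normlW.
  move=> [x' k] /= [xx' kh] Kx' y Ky x'y.
  have xx'h : `|x - x'| < h / 2 by [].
  have -> : f x' - f y = (f x - f y) - (f x - f x') by ring.
  rewrite (splitr e); apply: (le_lt_trans (ler_normB _ _)); apply: ltrD.
    apply: H; first exact: stD.
    have -> : x - y = (x - x') + (x' - y) by ring.
    rewrite (splitr h); apply: (le_lt_trans (ler_normD _ _)); apply: ltrD => //.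
    exact: lt_trans x'y _.
  apply: H; first exact: stD.
  by apply: lt_trans xx'h _; rewrite ltr_pdivrMr// ltr_pMr// ltr1n.
exists (h / 2); first by rewrite divr_gt0.
move=> x y xst yst xy; apply: (H (h / 2)) => //=.
- by rewrite sub0r normrN gtr0_norm ?divr_gt0// ltr_pdivrMr// ltr_pMr// ltr1n.
- by rewrite divr_gt0.
Qed.

(** There are [n.+1] steps, so the mesh makes sense for every [n] and [t] has index [n.+1]. *)
Definition grid (s t : R) (n k : nat) : R := s + k%:R * ((t - s) / n.+1%:R).

Lemma grid0 s t n : grid s t n 0 = s.
Proof. by rewrite /grid mul0r addr0. Qed.

Lemma gridS s t n : grid s t n n.+1 = t.
Proof. by rewrite /grid mulrCA divff ?pnatr_eq0// mulr1 subrKC. Qed.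

Lemma grid_inc s t n k : s < t -> grid s t n k < grid s t n k.+1.
Proof.
move=> st; rewrite /grid ltrD2l ltr_pM2r ?ltr_nat//.
by rewrite divr_gt0 ?subr_gt0.
Qed.

Lemma grid_step s t n k : grid s t n k.+1 - grid s t n k = (t - s) / n.+1%:R.
Proof. by rewrite /grid -natr1; ring. Qed.

Lemma grid_homo s t n : s < t -> {homo grid s t n : i j / (i <= j)%N >-> i <= j}.
Proof.
move=> st i j ij; rewrite /grid lerD2l ler_wpM2r ?ler_nat//.
by rewrite divr_ge0// subr_ge0 ltW.
Qed.

Lemma grid_itv s t n k : s < t -> (k <= n.+1)%N -> s <= grid s t n k <= t.
Proof.
move=> st kn; apply/andP; split.
  by rewrite -[X in X <= _](grid0 s t n); exact: grid_homo.
by rewrite -[X in _ <= X](gridS s t n); exact: grid_homo.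
Qed.

(** The value of [x] at the smaller of [k] and the first index above [y]: once above [y], it is
    frozen. *)
Fixpoint stopped (x : nat -> R) (y : R) (k : nat) : R :=
  if k is k'.+1 then if y < stopped x y k' then stopped x y k' else x k
  else x 0%N.

Lemma stopped_le x y k : stopped x y k <= y -> forall j, (j <= k)%N -> x j <= y.
Proof.
elim: k => [|k IH] /=; first by move=> H j; rewrite leqn0 => /eqP ->.
case: ltP => [yk|ky]; first by rewrite leNgt yk.
move=> H j; rewrite leq_eqVlt => /predU1P[->//|jk]; exact: IH.
Qed.

Lemma stopped_eq x y k : (forall j, (j < k)%N -> x j <= y) -> stopped x y k = x k.
Proof.
elim: k => [//|k IH] H /=; rewrite IH => [|j jk]; last by apply: H; exact: ltnW.
by rewrite ltNge H.
Qed.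

Lemma stopped_cross x y k : x 0%N <= y -> y < stopped x y k ->
  exists j, [/\ (j < k)%N, x j <= y, y < x j.+1 & stopped x y k = x j.+1].
Proof.
move=> x0; elim: k => [|k IH] /=; first by rewrite ltNge x0.
have [yk _|ky yk] := ltP y (stopped x y k).
  by have [j [jk ? ? ?]] := IH yk; exists j; split=> //; exact: leqW.
by exists k; split=> //; exact: (stopped_le ky).
Qed.

Lemma stopped_grid_le (s t y : R) (n : nat) : s < t -> (forall r, s <= r <= t -> f r <= y) ->
  stopped (f \o grid s t n) y n.+1 <= y.
Proof.
move=> st H; rewrite stopped_eq /=; last first.
  by move=> j jn; apply: H; apply: grid_itv => //; exact: ltnW.
by apply: H; exact: grid_itv.
Qed.

Lemma near_grid_step_lt (s t h : R) : s < t -> 0 < h ->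
  \forall n \near \oo, (t - s) / n.+1%:R < h.
Proof.
move=> st h0; have hd : 0 < h / (t - s) by rewrite divr_gt0 ?subr_gt0.
near=> n; rewrite mulrC -ltr_pdivlMr ?subr_gt0//.
by near: n; exact: (near_infty_natSinv_lt (PosNum hd)).
Unshelve. all: by end_near. Qed.

(** By continuity the path is above [y] near [r], and a fine grid has a point there. *)
Lemma stopped_grid_gt (s t y r : R) : `[s, t]%classic `<=` D -> s < t ->
  s <= r <= t -> y < f r ->
  \forall n \near \oo, y < stopped (f \o grid s t n) y n.+1.
Proof.
move=> stD st rst yr.
have fr0 : 0 < f r - y by rewrite subr_gt0.
have Dr : D r by apply: stD; rewrite /= in_itv.
have [h h0 H] := within_continuousE Dr fr0.
near=> n; rewrite ltNge; apply/negP => /stopped_le le_y.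
have step : (t - s) / n.+1%:R < h by near: n; exact: near_grid_step_lt.
have step0 : 0 < (t - s) / n.+1%:R by rewrite divr_gt0 ?subr_gt0.
move: rst => /andP[sr rt].
(* The integer part of [q] is the index of the last grid point at or before [r], hence within one
   mesh of it. *)
pose q := (r - s) / ((t - s) / n.+1%:R).
have q0 : 0 <= q by rewrite divr_ge0 ?subr_ge0// ltW.
have /andP[kq qk] := truncn_itv q0; set k := Num.truncn q in kq qk.
have kn : (k <= n.+1)%N.
  rewrite -(ler_nat R); apply: le_trans kq _.
  by rewrite ler_pdivrMr// mulrCA divff ?pnatr_eq0// mulr1 lerD2r.
have rgt : `|r - grid s t n k| < h.
  have -> : r - grid s t n k = (q - k%:R) * ((t - s) / n.+1%:R).
    by rewrite mulrBl /q divfK ?gt_eqF// /grid; ring.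
  rewrite ger0_norm; last by rewrite mulr_ge0 ?subr_ge0// ltW.
  apply: le_lt_trans step; rewrite ler_piMl ?(ltW step0)// lerBlDr.
  by rewrite addrC natr1 ltW.
have Dk : D (grid s t n k) by apply: stD; rewrite /= in_itv/= grid_itv.
have := H _ Dk rgt; have := le_y k kn => /= fk.
by rewrite ltr_norml => /andP[_]; rewrite ltNge lerB.
Unshelve. all: by end_near. Qed.

(** The preceding grid value is at most [y], so the overshoot is at most the oscillation over one
    cell, which uniform continuity controls. *)
Lemma stopped_grid_overshoot (s t y e : R) : `[s, t]%classic `<=` D -> s < t ->
  f s <= y -> 0 < e ->
  \forall n \near \oo, y < stopped (f \o grid s t n) y n.+1 ->
    stopped (f \o grid s t n) y n.+1 - y < e.
Proof.
move=> stD st fs e0; have [h h0 H] := segment_unif_continuous stD e0.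
near=> n.
have step : (t - s) / n.+1%:R < h by near: n; exact: near_grid_step_lt.
have x0 : (f \o grid s t n) 0%N <= y by rewrite /= grid0.
move=> /(stopped_cross x0)[j [jn /= fj yfj ->]].
have := H (grid s t n j.+1) (grid s t n j).
rewrite grid_step ger0_norm ?divr_ge0 ?subr_ge0 ?(ltW st)//.
move=> /(_ (grid_itv st jn) (grid_itv st (ltnW jn)) step).
rewrite ltr_norml => /andP[_]; apply: le_lt_trans; exact: lerB.
Unshelve. all: by end_near. Qed.

End paths.

Section measurable_comparison.
Context d (T : measurableType d) (R : realType).
Implicit Types f g : T -> R.

Lemma measurable_set_lt f g : measurable_fun setT f -> measurable_fun setT g ->
  measurable [set x | f x < g x].
Proof.
move=> mf mg; have m := measurable_funB mg mf.
rewrite (_ : [set _ | _] = (g \- f) @^-1` `]0, +oo[).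
  by rewrite -[X in measurable X]setTI; exact: (m measurableT _ (measurable_itv _)).
by apply/seteqP; split => x /=; rewrite in_itv/= andbT subr_gt0.
Qed.

Lemma measurable_set_le f g : measurable_fun setT f -> measurable_fun setT g ->
  measurable [set x | f x <= g x].
Proof.
move=> mf mg; have m := measurable_funB mg mf.
rewrite (_ : [set _ | _] = (g \- f) @^-1` `[0, +oo[).
  by rewrite -[X in measurable X]setTI; exact: (m measurableT _ (measurable_itv _)).
by apply/seteqP; split => x /=; rewrite in_itv/= andbT subr_ge0.
Qed.

Lemma measurable_set_eq f g : measurable_fun setT f -> measurable_fun setT g ->
  measurable [set x | f x = g x].
Proof.
move=> mf mg.
rewrite (_ : [set _ | _] = [set x | f x <= g x] `&` [set x | g x <= f x]).
  by apply: measurableI; exact: measurable_set_le.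
apply/seteqP; split => x /=; first by move=> ->.
by move=> [xy yx]; apply/eqP; rewrite eq_le xy yx.
Qed.

End measurable_comparison.

(** * The reflection principle with drift *)

Section reflection.
Context {R : realType}.
Variables (mu x y : R).
Local Notation N := (gauss1 R).

(* [below] counts an end value [p.1] under the barrier [y] for which
   [p.1 + p.2 <= x]; [reflected] is its mirror image across [y] with the weight
   that makes both have the same expectation when the path starts from [y]. *)
Definition below (p : R * R) : R := \1_[set p : R * R | p.1 < y /\ p.1 + p.2 <= x] p.

Definition reflected (p : R * R) : R :=
  expR (- (2 * mu * (p.1 - y))) *
  \1_[set p : R * R | y < p.1 /\ 2 * y - p.1 + p.2 <= x] p.

Lemma below_ge0 p : 0 <= below p. Proof. by []. Qed.

Lemma below_le1 p : below p <= 1.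
Proof. by rewrite /below indicE; case: (_ \in _). Qed.

Lemma reflected_ge0 p : 0 <= reflected p.
Proof. by rewrite mulr_ge0// expR_ge0. Qed.

Lemma reflected_le p : reflected p <= expR (- (2 * mu * (p.1 - y))).
Proof. by rewrite ler_piMr ?expR_ge0// indicE; case: (_ \in _). Qed.

Lemma reflected_eq0 p : p.1 <= y -> reflected p = 0.
Proof.
move=> py; rewrite /reflected indicE memNset ?mulr0//= => -[yp _].
by move: yp; rewrite ltNge py.
Qed.

Lemma measurable_below : measurable_fun setT below.
Proof.
have m1 := @measurable_fst _ _ R R; have m2 := @measurable_snd _ _ R R.
apply: measurable_indic; apply: measurableI.
- exact: (measurable_set_lt m1 (@measurable_cst _ _ _ _ _ y)).
- exact: (measurable_set_le (measurable_funD m1 m2) (@measurable_cst _ _ _ _ _ x)).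
Qed.

Lemma measurable_reflected : measurable_fun setT reflected.
Proof.
have m1 := @measurable_fst _ _ R R; have m2 := @measurable_snd _ _ R R.
have mc c := @measurable_cst _ _ (R * R)%type R setT c.
apply: measurable_funM.
  apply: measurableT_comp; first exact: measurable_expR.
  apply: measurable_funN; apply: measurable_funM; first exact: mc.
  exact: (measurable_funB m1 (mc y)).
apply: measurable_indic; apply: measurableI.
- exact: (measurable_set_lt (mc y) m1).
- exact: (measurable_set_le (measurable_funD (measurable_funB (mc (2 * y)) m1) m2) (mc x)).
Qed.

(** The substitution z1 -> - z1 - 2 mu sg negates the increment ds + sg z1, since its mean is mu
    times its variance, and produces exactly the weight of [reflected]. The second coordinate stays
    fixed in the outer integral. *)
Lemma reflection_tilt (sg ds tt dt : R) : ds = mu * sg ^+ 2 ->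
  (\int[N \x N]_z (below (y + (ds + sg * z.1), dt + tt * z.2))%:E =
   \int[N \x N]_z (reflected (y + (ds + sg * z.1), dt + tt * z.2))%:E)%E.
Proof.
move=> dsE.
have ma : measurable_fun setT (fun z : R * R => (y + (ds + sg * z.1), dt + tt * z.2)).
  have m1 := measurableT_comp (@mulrl_measurable R setT sg) (@measurable_fst _ _ R R).
  have m2 := measurableT_comp (@mulrl_measurable R setT tt) (@measurable_snd _ _ R R).
  have mc c := @measurable_cst _ _ (R * R)%type R setT c.
  exact: (measurable_fun_pair (measurable_funD (mc y) (measurable_funD (mc ds) m1))
            (measurable_funD (mc dt) m2)).
pose f1 z := (below (y + (ds + sg * z.1), dt + tt * z.2))%:E.
pose f2 z := (reflected (y + (ds + sg * z.1), dt + tt * z.2))%:E.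
have mf1 : measurable_fun setT f1.
  by apply/measurable_EFinP; exact: (measurableT_comp measurable_below ma).
have mf2 : measurable_fun setT f2.
  by apply/measurable_EFinP; exact: (measurableT_comp measurable_reflected ma).
have f10 z : (0 <= f1 z)%E by rewrite lee_fin below_ge0.
have f20 z : (0 <= f2 z)%E by rewrite lee_fin reflected_ge0.
rewrite (fubini_tonelli2 (m1 := N) (m2 := N) f1 mf1 f10).
rewrite (fubini_tonelli2 (m1 := N) (m2 := N) f2 mf2 f20).
apply: eq_integral => z2 _; rewrite /fubini_G.
have mfz : measurable_fun setT (fun z1 => f1 (z1, z2)).
  exact: (measurableT_comp mf1 (measurable_pair2 z2)).
rewrite (ge0_integral_gauss1_tilt (2 * mu * sg) mfz (fun z => f10 _)).
apply: eq_integral => z1 _; rewrite /f1 /f2 /= -EFinM; congr EFin.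
rewrite /below /reflected mulrC /=; congr (expR _ * _).
  by rewrite dsE; field.
rewrite !indicE; congr ((nat_of_bool _)%:R); apply/idP/idP; rewrite !inE /= dsE.
- by move=> [h1 h2]; split; lra.
- by move=> [h1 h2]; split; lra.
Qed.

End reflection.

(** * Reflection at the first grid crossing *)

Section stopping.
Context d (Omega : measurableType d) (R : realType) (P : probability Omega R).
Variable W : R -> {RV P >-> R}.
Hypothesis bm : brownian_motion W.
Variables (mu s t T x y : R).
Hypotheses (s0 : 0 < s) (st : s < t) (tT : t <= T).

Local Notation X := (drifted W mu).
Local Notation F1 := (below x y).
Local Notation F2 := (reflected mu x y).

Lemma measurable_drifted r : measurable_fun setT (X r).
Proof. by apply: measurable_funD. Qed.

(** The path is restarted at [y] at a fixed time. Given an event of the past, only later increments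
    enter, so the Gaussian identity applies with drift mu (t - a n) and variance t - a n. *)
Lemma past_reflection n a E : 0 <= a 0%N ->
  (forall i, (i < n)%N -> a i < a i.+1) -> a n <= t -> past W n a E ->
  (\int[P]_(w in E) (F1 (y + (X t w - X (a n) w), X T w - X t w)%R)%:E =
   \int[P]_(w in E) (F2 (y + (X t w - X (a n) w), X T w - X t w)%R)%:E)%E.
Proof.
move=> a0 ainc ant pE.
pose sh (z : R * R) := (y + (mu * (t - a n) + z.1), mu * (T - t) + z.2).
have msh : measurable_fun setT sh.
  have m1 := @measurable_fst _ _ R R; have m2 := @measurable_snd _ _ R R.
  have mc c := @measurable_cst _ _ (R * R)%type R setT c.
  exact: (measurable_fun_pair (measurable_funD (mc y) (measurable_funD (mc _) m1))
            (measurable_funD (mc _) m2)).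
have mf1 : measurable_fun setT (fun z => (F1 (sh z))%:E).
  by apply/measurable_EFinP; exact: (measurableT_comp (@measurable_below R x y) msh).
have mf2 : measurable_fun setT (fun z => (F2 (sh z))%:E).
  by apply/measurable_EFinP; exact: (measurableT_comp (@measurable_reflected R mu x y) msh).
have f10 z : (0 <= (F1 (sh z))%:E)%E by rewrite lee_fin below_ge0.
have f20 z : (0 <= (F2 (sh z))%:E)%E by rewrite lee_fin reflected_ge0.
have shE w : (y + (X t w - X (a n) w), X T w - X t w) =
    sh (W t w - W (a n) w, W T w - W t w).
  by rewrite /sh /drifted /=; congr pair; ring.
under eq_integral do rewrite shE.
under [RHS]eq_integral do rewrite shE.
rewrite (past_integral_incr2 bm a0 ainc ant tT pE mf1 f10).
rewrite (past_integral_incr2 bm a0 ainc ant tT pE mf2 f20).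
congr (_ * _)%E; apply: reflection_tilt.
by rewrite sqr_sqrtr// subr_ge0.
Qed.

(** Time 0 is put in front because increments determine the path only from its start; hence k + 1
    increments for the grid points 0 to k. *)
Definition grid_time (n i : nat) : R := if i is k.+1 then grid s t n k else 0.

Lemma grid_time_inc n i : grid_time n i < grid_time n i.+1.
Proof. by case: i => [|i] /=; [rewrite grid0|exact: grid_inc]. Qed.

Definition stopped_value (n k : nat) (w : Omega) : R :=
  stopped (fun j => X (grid s t n j) w) y k.

Lemma stopped_valueS n k w : stopped_value n k.+1 w =
  if y < stopped_value n k w then stopped_value n k w else X (grid s t n k.+1) w.
Proof. by []. Qed.

Lemma past_measurable_X n k j : (j <= k)%N ->
  measurable_fun [set: past_space W k.+1 (grid_time n)]
   (X (grid s t n j) : past_space W k.+1 (grid_time n) -> R).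
Proof.
move=> jk; apply: measurable_funD; last exact: measurable_cst.
exact: (past_measurable_W bm (n := k.+1) (a := grid_time n) (j := j.+1)).
Qed.

Lemma past_measurable_stopped_value n k m : (k <= m)%N ->
  measurable_fun [set: past_space W m.+1 (grid_time n)]
   (stopped_value n k : past_space W m.+1 (grid_time n) -> R).
Proof.
elim: k => [km|k IH km]; first exact: past_measurable_X.
have mY := IH (ltnW km); have mX := @past_measurable_X n m k.+1 km.
have mlt := measurable_set_lt (@measurable_cst _ _ _ _ setT y) mY.
have mb : measurable_fun [set: past_space W m.+1 (grid_time n)]
    (fun w => y < stopped_value n k w).
  by apply: (measurable_fun_bool true); rewrite setTI.
exact: (measurable_fun_ifT mb mY mX).
Qed.

Lemma measurable_stopped_value n k : measurable_fun setT (stopped_value n k).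
Proof.
move=> _ B mB; rewrite setTI.
apply: (@past_measurable _ _ _ _ W k.+1 (grid_time n)).
have := @past_measurable_stopped_value n k k (leqnn k); move=> /(_ measurableT B mB).
by rewrite setTI.
Qed.

Definition crossed n k : set Omega := [set w | stopped_value n 0 w <= y /\ y < stopped_value n k w].

Lemma measurable_crossed n k : measurable (crossed n k).
Proof.
have mc := @measurable_cst _ _ Omega R setT y.
apply: measurableI.
- exact: (measurable_set_le (@measurable_stopped_value n 0) mc).
- exact: (measurable_set_lt mc (@measurable_stopped_value n k)).
Qed.

(** Induction on the crossing index. Paths that crossed earlier keep their stopped value; those
    crossing at the new index form an event of the past there, and [past_reflection] handles them. A
    crossing at time t itself is included, with a zero increment. *)
Lemma stopped_reflection n k : (k <= n.+1)%N ->
  (\int[P]_(w in crossed n k) (F1 (y + (X t w - stopped_value n k w), X T w - X t w)%R)%:E =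
   \int[P]_(w in crossed n k) (F2 (y + (X t w - stopped_value n k w), X T w - X t w)%R)%:E)%E.
Proof.
elim: k => [_|k IH kn].
  have -> : crossed n 0 = set0.
    by rewrite -subset0 => w [/= h1]; rewrite ltNge h1.
  by rewrite !integral_set0.
(* The paths whose first grid point above [y] has index [k.+1]. *)
pose H : set Omega := [set w | stopped_value n k w <= y /\ y < X (grid s t n k.+1) w]
  `&` [set w | stopped_value n 0 w <= y].
pose r := grid s t n k.+1.
have pH : past W k.+2 (grid_time n) H.
  have mc := @measurable_cst _ _ (past_space W k.+2 (grid_time n)) R setT y.
  apply: (@measurableI _ (past_space W k.+2 (grid_time n))).
    apply: (@measurableI _ (past_space W k.+2 (grid_time n))).
    - exact: (measurable_set_le (@past_measurable_stopped_value n k k.+1 (leqnSn k)) mc).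
    - exact: (measurable_set_lt mc (@past_measurable_X n k.+1 k.+1 (leqnn k.+1))).
  exact: (measurable_set_le (@past_measurable_stopped_value n 0 k.+1 (leq0n k.+1)) mc).
have mH : measurable H := past_measurable pH.
have mC := measurable_crossed n k.
have disj : [disjoint crossed n k & H].
  rewrite disj_set2E; apply/eqP; rewrite -subset0 => w [[_ h1] [[h2 _] _]].
  by move: h1; rewrite ltNge h2.
have CE : crossed n k.+1 = crossed n k `|` H.
  apply/seteqP; split => w.
    rewrite /crossed /H /= stopped_valueS; have [yk|ky] := ltP y (stopped_value n k w).
      by move=> [h1 _]; left.
    by move=> [h1 h2]; right.
  move=> [[h1 h2]|[[h1 h2] h3]]; split => //=; rewrite stopped_valueS.
    by rewrite h2.
  by rewrite ifN// -leNgt.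
have mpair : measurable_fun setT (fun w => (y + (X t w - stopped_value n k.+1 w), X T w - X t w)).
  have mX r' := @measurable_drifted r'.
  have mc := @measurable_cst _ _ Omega R setT y.
  exact: (measurable_fun_pair
    (measurable_funD mc (measurable_funB (mX t) (@measurable_stopped_value n k.+1)))
    (measurable_funB (mX T) (mX t))).
have mU (F : R * R -> R) : measurable_fun setT F ->
    measurable_fun (crossed n k `|` H)
      (fun w => (F (y + (X t w - stopped_value n k.+1 w), X T w - X t w))%:E).
  move=> mF; apply: measurable_funTS; apply/measurable_EFinP.
  exact: (measurableT_comp mF mpair).
rewrite CE.
rewrite (ge0_integral_setU _ mC mH (mU _ (@measurable_below R x y))); first last.
- exact: disj.
- by move=> w _; rewrite lee_fin below_ge0.
rewrite (ge0_integral_setU _ mC mH (mU _ (@measurable_reflected R mu x y))); first last.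
- exact: disj.
- by move=> w _; rewrite lee_fin reflected_ge0.
have YC w : w \in crossed n k -> stopped_value n k.+1 w = stopped_value n k w.
  by rewrite inE /crossed /= => -[_ h]; rewrite stopped_valueS h.
have YH w : w \in H -> stopped_value n k.+1 w = X (grid_time n k.+2) w.
  by rewrite inE => -[[h _] _]; rewrite stopped_valueS ifN// -leNgt.
congr (_ + _)%E.
  under eq_integral => w wC do rewrite (YC _ wC).
  under [RHS]eq_integral => w wC do rewrite (YC _ wC).
  exact: IH (ltnW kn).
under eq_integral => w wH do rewrite (YH _ wH).
under [RHS]eq_integral => w wH do rewrite (YH _ wH).
apply: past_reflection => //.
- by move=> i _; exact: grid_time_inc.
- by rewrite /=; have /andP[] := grid_itv st kn.
Qed.

End stopping.

Lemma integral_indicM d (T : measurableType d) (R : realType)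
    (m : {measure set T -> \bar R}) (E : set T) (f : T -> R) :
  (\int[m]_(x in E) (f x)%:E = \int[m]_x (\1_E x * f x)%:E)%E.
Proof.
rewrite integral_mkcond; apply: eq_integral => x _.
by rewrite patchE indicE; case: ifP => _; rewrite ?mul1r ?mul0r.
Qed.

Section near_comparison.
Context {R : realFieldType}.

Lemma near_lt_eq (z c : R) : z != c -> \forall z' \near z, (z' < c) = (z < c).
Proof.
rewrite neq_lt => /orP[zc|cz].
  by apply: filterS (lt_nbhsl zc) => z' ->; rewrite zc.
by apply: filterS (lt_nbhsr cz) => z' cz'; rewrite !ltNge (ltW cz) (ltW cz').
Qed.

Lemma near_le_eq (z c : R) : z != c -> \forall z' \near z, (z' <= c) = (z <= c).
Proof.
rewrite neq_lt => /orP[zc|cz].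
  by apply: filterS (lt_nbhsl zc) => z' z'c; rewrite (ltW zc) (ltW z'c).
by apply: filterS (lt_nbhsr cz) => z' cz'; rewrite !leNgt cz cz'.
Qed.

End near_comparison.

(** * Ingredients of the limit of vanishing mesh *)

Section grid_limit.
Context d (Omega : measurableType d) (R : realType) (P : probability Omega R).
Variable W : R -> {RV P >-> R}.
Hypothesis bm : brownian_motion W.
Variables (mu s t T x y : R).
Hypotheses (s0 : 0 < s) (st : s < t) (tT : t <= T).

Local Notation X := (drifted W mu).
Local Notation F1 := (below x y).
Local Notation F2 := (reflected mu x y).
Local Notation stopped_value := (@stopped_value _ _ _ _ W mu s t y).
Local Notation crossed := (@crossed _ _ _ _ W mu s t y).

Lemma drifted_continuous w :
  {within `[0, +oo[, continuous (fun r : R => X r w)}.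
Proof.
have cm : {within `[0, +oo[, continuous (fun r : R => mu * r)}.
  by apply: continuous_subspaceT => r; exact: mulrl_continuous.
have cW : {within `[0, +oo[, continuous (fun r : R => W r w)} by exact: bm_continuous.
exact: (@within_continuousD _ _ (R : pseudoMetricNormedZmodType R) _ _ _ cW cm).
Qed.

Let sub0 : `[s, t]%classic `<=` `[(0 : R), +oo[%classic.
Proof.
move=> r /=; rewrite !in_itv/= andbT => /andP[sr _].
exact: le_trans (ltW s0) sr.
Qed.

Definition under_barrier : set Omega :=
  [set w | forall r, s <= r <= t -> X r w <= y].

(** Continuity replaces uncountably many constraints by countably many, which gives measurability of
    the event. *)
Lemma under_barrierE :
  under_barrier = \bigcap_n [set w | stopped_value n n.+1 w <= y].
Proof.
apply/seteqP; split => w /= H.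
  by move=> n _; exact: (@stopped_grid_le R (fun r => X r w) s t y n st H).
move=> r rst; rewrite leNgt; apply/negP => yr.
have := stopped_grid_gt (@drifted_continuous w) sub0 st rst yr.
move=> [n _ Hn]; have := Hn n (leqnn n); rewrite /=.
by rewrite ltNge (H n I).
Qed.

Lemma measurable_under_barrier : measurable under_barrier.
Proof.
rewrite under_barrierE; apply: bigcapT_measurable => n.
have mc := @measurable_cst _ _ Omega R setT y.
have H := measurable_set_le (@measurable_stopped_value _ _ _ _ _ bm mu s t y n n.+1) mc.
exact: H.
Qed.

(* Dominates the weight of [reflected] uniformly in the mesh when [mu < 0]. *)
Definition decay (w : Omega) : R := expR (- (2 * mu * (X t w - y))).

Lemma measurable_decay : measurable_fun setT decay.
Proof.
apply: measurableT_comp; first exact: measurable_expR.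
apply: measurable_funN; apply: measurable_funM => //.
by apply: measurable_funB => //; exact: measurable_drifted.
Qed.

(** An exponential moment of a normal variable. The constant [k] completes the square, leaving a
    tilt density, whose integral is 1 because it is the tilt of the constant 1. *)
Lemma integrable_decay : P.-integrable setT (EFin \o decay).
Proof.
apply/integrableP; split; first exact/measurable_EFinP/measurable_decay.
pose c := 2 * mu * Num.sqrt t.
pose k := expR (- (2 * mu * (mu * t - y)) + c ^+ 2 / 2).
pose g (z : R) := (k * expR (- (c * z) - c ^+ 2 / 2))%:E.
have t0 : 0 < t by exact: lt_trans st.
have mg0 : measurable_fun setT (fun z : R => expR (- (c * z) - c ^+ 2 / 2)).
  by apply: measurableT_comp => //; apply: measurable_funB => //;
    apply: measurableT_comp => //; exact: measurable_funM.
have mW : measurable_fun setT (W t : Omega -> R) by [].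
have ms := @mulrl_measurable R setT (Num.sqrt t).
pose e (z : R) := (expR (- (2 * mu * (z + mu * t - y))))%:E.
have me : measurable_fun setT e.
  apply/measurable_EFinP; apply: measurableT_comp; first exact: measurable_expR.
  apply: measurable_funN; apply: measurable_funM => //.
  by apply: measurable_funB => //; exact: measurable_funD.
have e0 z : (0 <= e z)%E by rewrite lee_fin expR_ge0.
rewrite (_ : (\int[P]_w _)%E = (\int[P]_w e (W t w))%E); last first.
  by apply: eq_integral => w _; rewrite /= ger0_norm ?expR_ge0.
rewrite -(ge0_integral_image_measure P mW me e0).
rewrite (eq_measure_integral (image_measure (gauss1 R) ms)); last first.
  move=> A mA _; have L := incr_law bm (lexx 0) (ltW t0) mA.
  transitivity (P [set w | A (W t w - W 0 w)]); last by rewrite L subr0.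
  rewrite image_measureE; congr (P _).
  by apply/seteqP; split => w /=; rewrite (bm_start bm) subr0.
rewrite (ge0_integral_image_measure (gauss1 R) ms me e0).
rewrite (_ : (\int[gauss1 R]_z _)%E = (\int[gauss1 R]_z (k%:E * (expR (- (c * z) - c ^+ 2 / 2))%:E))%E); last first.
  apply: eq_integral => z _; rewrite /e /k -EFinM -expRD; congr (expR _)%:E.
  by rewrite /c; ring.
have mg1 : measurable_fun setT (fun z : R => (expR (- (c * z) - c ^+ 2 / 2))%:E).
  exact/measurable_EFinP.
have g10 (z : R) : setT z -> (0 <= (expR (- (c * z) - c ^+ 2 / 2))%:E)%E.
  by rewrite lee_fin expR_ge0.
have k0 : (0 <= k%:E)%E by rewrite lee_fin expR_ge0.
rewrite (ge0_integralZl _ measurableT mg1 g10 k0).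
have -> : (\int[gauss1 R]_z (expR (- (c * z) - c ^+ 2 / 2))%:E = 1)%E.
  transitivity (\int[gauss1 R]_z cst 1 z)%E.
    rewrite (@ge0_integral_gauss1_tilt R c (cst 1%E) (@measurable_cst _ _ _ _ _ _) (fun=> lee01)).
    by apply: eq_integral => z _; rewrite /cst mul1e.
  rewrite integral_cst// [X in (1 * X)%E = _](_ : _ = 1%E) ?mule1//.
  exact: probability_setT.
by rewrite mule1 ltry.
Qed.

Lemma below_near z e : z != y -> z + e != x ->
  \forall z' \near z, below x y (z', e) = below x y (z, e).
Proof.
move=> zy zx; near=> z'.
have h1 : (z' < y) = (z < y) by near: z'; exact: near_lt_eq.
have h2 : (z' <= x - e) = (z <= x - e).
  by near: z'; apply: near_le_eq; apply: contra zx => /eqP ->; rewrite subrK.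
rewrite /below !indicE; congr ((nat_of_bool _)%:R).
by apply/idP/idP; rewrite !inE /= -!lerBrDr h1 h2.
Unshelve. all: by end_near. Qed.

Lemma reflected_near z e : z != y -> 2 * y - z + e != x ->
  \forall z' \near z, \1_[set p : R * R | y < p.1 /\ 2 * y - p.1 + p.2 <= x] (z', e)
    = \1_[set p : R * R | y < p.1 /\ 2 * y - p.1 + p.2 <= x] (z, e) :> R.
Proof.
move=> zy zx; near=> z'.
have h1 : (z' <= y) = (z <= y) by near: z'; exact: near_le_eq.
have h2 : (z' < 2 * y + e - x) = (z < 2 * y + e - x).
  near: z'; apply: near_lt_eq; apply: contra zx => /eqP ->.
  by apply/eqP; ring.
have E q : (2 * y - q + e <= x) = ~~ (q < 2 * y + e - x).
  by rewrite -leNgt; apply/idP/idP => ?; lra.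
rewrite !indicE; congr ((nat_of_bool _)%:R).
by apply/idP/idP; rewrite !inE /= !ltNge h1 !E h2.
Unshelve. all: by end_near. Qed.

(** Away from the boundaries both indicators are locally constant, and the exponential weight is
    continuous. *)
Lemma below_reflected_cvg (z e : R) (z_ : nat -> R) :
  z != y -> z + e != x -> 2 * y - z + e != x -> z_ n @[n --> \oo] --> z ->
  F1 (z_ n, e) - F2 (z_ n, e) @[n --> \oo] --> F1 (z, e) - F2 (z, e).
Proof.
move=> zy zx zx' cz; apply: cvgB.
  apply: cvg_near_cst; exact: (cz _ (below_near zy zx)).
apply: cvgM; last first.
  apply: cvg_near_cst; exact: (cz _ (reflected_near zy zx')).
apply: (cvg_comp _ expR); last exact: continuous_expR.
apply: cvgN; apply: cvgM; first exact: cvg_cst.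
by apply: cvgB => //; exact: cvg_cst.
Qed.

End grid_limit.

Lemma measureU_null d (T : measurableType d) (R : realType)
    (m : {measure set T -> \bar R}) (A B : set T) :
  measurable A -> measurable B -> m A = 0%E -> m B = 0%E -> m (A `|` B) = 0%E.
Proof.
move=> mA mB A0 B0; apply: measure_negligible; first exact: measurableU.
by apply: negligibleU; apply/negligibleP.
Qed.

(** * Dominated convergence along the grids *)

Section compensated_bounds.
Context d (Omega : measurableType d) (R : realType) (P : probability Omega R).
Variable W : R -> {RV P >-> R}.
Hypothesis bm : brownian_motion W.
Variables (mu s t T x y : R).
Hypotheses (s0 : 0 < s) (st : s < t) (tT : t <= T).

Local Notation X := (drifted W mu).
Local Notation F1 := (below x y).
Local Notation F2 := (reflected mu x y).
Local Notation stopped_value := (@stopped_value _ _ _ _ W mu s t y).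
Local Notation crossed := (@crossed _ _ _ _ W mu s t y).
Local Notation under := (@under_barrier _ _ _ _ W mu s t y).
Local Notation decay := (@decay _ _ _ _ W mu t y).

(** The coefficient of W_s decides: s > 0 gives W_s positive variance, while T - t may be 0. *)
Lemma incr3_hyperplane a b e c : e != 0 ->
  P [set w | a * (W T w - W t w) + b * (W t w - W s w) + e * W s w = c] = 0%E.
Proof.
move=> e0.
have mH : measurable [set z : R * R * R | a * z.1.1 + b * z.1.2 + e * z.2 = c].
  have m1 := measurableT_comp (@mulrl_measurable R setT a) (@measurable_fst3 R).
  have m2 := measurableT_comp (@mulrl_measurable R setT b) (@measurable_snd3 R).
  have m3 := measurableT_comp (@mulrl_measurable R setT e) (@measurable_thd3 R).
  exact: (measurable_set_eq (measurable_funD (measurable_funD m1 m2) m3)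
    (@measurable_cst _ _ _ _ _ c)).
have := incr3_law bm s0 (ltW st) tT mH.
rewrite /preimage /incr3 /scale3 /= => ->.
have es0 : e * Num.sqrt s != 0 by rewrite mulf_neq0// gt_eqF// sqrtr_gt0.
rewrite -(std_normal3_hyperplane (a * Num.sqrt (T - t)) (b * Num.sqrt (t - s)) c es0).
by congr (std_normal3 _); apply/seteqP; split => z /=; rewrite !mulrA.
Qed.

(** Contains every path whose end pair is a discontinuity point of [below] or [reflected]. *)
Definition boundary_event : set Omega := [set w | X t w = y] `|` [set w | X T w = x]
  `|` [set w | 2 * y - X t w + (X T w - X t w) = x].

Lemma measurable_boundary_event : measurable boundary_event.
Proof.
have mX r := @measurable_drifted _ _ _ _ W mu r.
have mc c := @measurable_cst _ _ Omega R setT c.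
apply: measurableU; first apply: measurableU.
- exact: (measurable_set_eq (mX t) (mc y)).
- exact: (measurable_set_eq (mX T) (mc x)).
- exact: (measurable_set_eq (measurable_funD (measurable_funB (mc (2 * y)) (mX t))
    (measurable_funB (mX T) (mX t))) (mc x)).
Qed.

Lemma drifted_eq_null c : P [set w | X t w = c] = 0%E.
Proof.
rewrite -(@incr3_hyperplane 0 1 1 (c - mu * t) (oner_neq0 _)); congr (P _).
by apply/seteqP; split => w /=; rewrite /drifted => h; lra.
Qed.

Lemma boundary_event_null : P boundary_event = 0%E.
Proof.
have mX r := @measurable_drifted _ _ _ _ W mu r.
have mc c := @measurable_cst _ _ Omega R setT c.
have m1 := measurable_set_eq (mX t) (mc y).
have m2 := measurable_set_eq (mX T) (mc x).
have m3 := measurable_set_eq (measurable_funD (measurable_funB (mc (2 * y)) (mX t))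
    (measurable_funB (mX T) (mX t))) (mc x).
have z1 := drifted_eq_null y.
have z2 : P [set w | X T w = x] = 0%E.
  rewrite -(@incr3_hyperplane 1 1 1 (x - mu * T) (oner_neq0 _)); congr (P _).
  by apply/seteqP; split => w /=; rewrite /drifted => h; lra.
have z3 : P [set w | 2 * y - X t w + (X T w - X t w) = x] = 0%E.
  have n1 : (-1 : R) != 0 by rewrite oppr_eq0 oner_neq0.
  rewrite -(@incr3_hyperplane 1 (-1) (-1) (x - 2 * y - mu * T + 2 * mu * t) n1).
  by congr (P _); apply/seteqP; split => w /=; rewrite /drifted => h; lra.
exact: (measureU_null (measurableU _ _ m1 m2) m3 (measureU_null m1 m2 z1 z2) z3).
Qed.

Definition start_below : set Omega := [set w | X s w <= y].
Definition end_pair w : R * R := (X t w, X T w - X t w).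
(** After a crossing, this is the end pair of the path lowered by its overshoot, so that it restarts
    exactly at [y]. *)
Definition shifted_pair n w : R * R := (y + (X t w - stopped_value n n.+1 w), X T w - X t w).

(* The crossed part has zero expectation by [stopped_reflection], so the mean
   does not depend on the mesh; as the mesh shrinks, the overshoot vanishes and
   the value tends to [below (end_pair w)] on [under_barrier] and to 0 elsewhere. *)
Definition compensated n w : R :=
  \1_start_below w * (F1 (end_pair w) - F2 (end_pair w)) -
  \1_(crossed n n.+1) w * (F1 (shifted_pair n w) - F2 (shifted_pair n w)).

Lemma measurable_start_below : measurable start_below.
Proof.
exact: (measurable_set_le (@measurable_drifted _ _ _ _ W mu s) (@measurable_cst _ _ _ _ _ y)).
Qed.

Lemma measurable_end_pair : measurable_fun setT end_pair.
Proof.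
have mX r := @measurable_drifted _ _ _ _ W mu r.
exact: (measurable_fun_pair (mX t) (measurable_funB (mX T) (mX t))).
Qed.

Lemma measurable_shifted_pair n : measurable_fun setT (shifted_pair n).
Proof.
have mX r := @measurable_drifted _ _ _ _ W mu r.
have mY := @measurable_stopped_value _ _ _ _ _ bm mu s t y n n.+1.
exact: (measurable_fun_pair (measurable_funD (@measurable_cst _ _ _ _ _ y)
   (measurable_funB (mX t) mY)) (measurable_funB (mX T) (mX t))).
Qed.

(** The bound adds up those of the four terms of [compensated]: 1 and [decay] for the end pair, 1
    and 1 + [decay] for the shifted pair. *)
Lemma integrable_le_decay (f : Omega -> R) : measurable_fun setT f ->
  (forall w, `|f w| <= 3 + 2 * decay w) -> P.-integrable setT (EFin \o f).
Proof.
move=> mf fle; have id := integrable_decay bm mu y s0 st.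
have i1 : P.-integrable setT (EFin \o (fun w => 3 + 2 * decay w)).
  have i3 : P.-integrable setT (EFin \o cst 3) by exact: finite_measure_integrable_cst.
  have i2 := integrableZl measurableT 2 id.
  exact: (integrableD measurableT i3 i2).
apply: le_integrable i1 => //; first exact/measurable_EFinP.
move=> w _ /=; rewrite lee_fin; apply: le_trans (fle w) _.
exact: ler_norm.
Qed.

Lemma decay_ge0 w : 0 <= decay w. Proof. exact: expR_ge0. Qed.

(** For mu >= 0 the weight is at most 1 above the barrier. For mu < 0 it increases with the end
    value, and the shift only lowers that value, so [decay] bounds it. *)
Lemma shifted_le n w : w \in crossed n n.+1 -> F2 (shifted_pair n w) <= 1 + decay w.
Proof.
rewrite inE => -[/= _ yY].
have [wy|yw] := leP (shifted_pair n w).1 y.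
  by rewrite reflected_eq0// addr_ge0// decay_ge0.
apply: le_trans (reflected_le _ _ _ _) _; rewrite /shifted_pair /=.
have [m0|m0] := leP 0 mu.
  apply: (@le_trans _ _ 1); last by rewrite lerDl decay_ge0.
  rewrite -expR0 ler_expR oppr_le0 mulr_ge0 ?mulr_ge0// subr_ge0.
  exact: ltW yw.
apply: (@le_trans _ _ (decay w)); last by rewrite lerDr.
rewrite /decay ler_expR lerN2 -!mulrA ler_pM2l// ler_nM2l//.
by move: yY; rewrite /shifted_pair /=; lra.
Qed.

End compensated_bounds.

Section compensated_limit.
Context d (Omega : measurableType d) (R : realType) (P : probability Omega R).
Variable W : R -> {RV P >-> R}.
Hypothesis bm : brownian_motion W.
Variables (mu s t T x y : R).
Hypotheses (s0 : 0 < s) (st : s < t) (tT : t <= T).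

Local Notation X := (drifted W mu).
Local Notation F1 := (below x y).
Local Notation F2 := (reflected mu x y).
Local Notation stopped_value := (@stopped_value _ _ _ _ W mu s t y).
Local Notation crossed := (@crossed _ _ _ _ W mu s t y).
Local Notation under := (@under_barrier _ _ _ _ W mu s t y).
Local Notation decay := (@decay _ _ _ _ W mu t y).
Local Notation start_below := (@start_below _ _ _ _ W mu s y).
Local Notation end_pair := (@end_pair _ _ _ _ W mu t T).
Local Notation shifted_pair := (@shifted_pair _ _ _ _ W mu s t T y).
Local Notation compensated := (@compensated _ _ _ _ W mu s t T x y).
Local Notation boundary_event := (@boundary_event _ _ _ _ W mu t T x y).

Let u1 w := \1_start_below w * F1 (end_pair w).
Let u2 w := \1_start_below w * F2 (end_pair w).
Let v1 n w := \1_(crossed n n.+1) w * F1 (shifted_pair n w).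
Let v2 n w := \1_(crossed n n.+1) w * F2 (shifted_pair n w).

Let indic01 (A : set Omega) w : 0 <= (\1_A w : R) <= 1.
Proof. by rewrite indicE; case: (_ \in _); rewrite ?lexx ler01. Qed.

Let decay0 w : 0 <= decay w. Proof. exact: expR_ge0. Qed.

Let mu1 : measurable_fun setT u1.
Proof.
apply: measurable_funM; first exact/measurable_indic/measurable_start_below.
exact: (measurableT_comp (@measurable_below R x y) (@measurable_end_pair _ _ _ _ W mu t T)).
Qed.

Let mu2 : measurable_fun setT u2.
Proof.
apply: measurable_funM; first exact/measurable_indic/measurable_start_below.
exact: (measurableT_comp (@measurable_reflected R mu x y) (@measurable_end_pair _ _ _ _ W mu t T)).
Qed.

Let mv1 n : measurable_fun setT (v1 n).
Proof.
apply: measurable_funM; first exact/measurable_indic/measurable_crossed.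
exact: (measurableT_comp (@measurable_below R x y) (@measurable_shifted_pair _ _ _ _ _ bm mu s t T y n)).
Qed.

Let mv2 n : measurable_fun setT (v2 n).
Proof.
apply: measurable_funM; first exact/measurable_indic/measurable_crossed.
exact: (measurableT_comp (@measurable_reflected R mu x y) (@measurable_shifted_pair _ _ _ _ _ bm mu s t T y n)).
Qed.

Let u1_01 w : 0 <= u1 w <= 1.
Proof.
have /andP[i0 i1] := indic01 start_below w; rewrite /u1 mulr_ge0 ?below_ge0//=.
by apply: mulr_ile1 => //; exact: below_le1.
Qed.

Let v1_01 n w : 0 <= v1 n w <= 1.
Proof.
have /andP[i0 i1] := indic01 (crossed n n.+1) w; rewrite /v1 mulr_ge0 ?below_ge0//=.
by apply: mulr_ile1 => //; exact: below_le1.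
Qed.

Let u2_le w : 0 <= u2 w <= decay w.
Proof.
have /andP[i0 i1] := indic01 start_below w; rewrite /u2 mulr_ge0 ?reflected_ge0//=.
apply: le_trans (reflected_le mu x y (end_pair w)).
by rewrite ler_piMl// reflected_ge0.
Qed.

Let v2_le n w : 0 <= v2 n w <= 1 + decay w.
Proof.
rewrite /v2 indicE; have [wC|] := boolP (w \in crossed n n.+1); last first.
  by rewrite mul0r lexx addr_ge0.
rewrite mul1r reflected_ge0/=; exact: shifted_le.
Qed.

Let iu1 : P.-integrable setT (EFin \o u1).
Proof.
apply: (@integrable_le_decay _ _ _ _ _ bm mu s t y s0 st _ mu1) => w.
have /andP[h0 h1] := u1_01 w; rewrite ger0_norm//; have := decay0 w; lra.
Qed.

Let iu2 : P.-integrable setT (EFin \o u2).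
Proof.
apply: (@integrable_le_decay _ _ _ _ _ bm mu s t y s0 st _ mu2) => w.
have /andP[h0 h1] := u2_le w; rewrite ger0_norm//; have := decay0 w; lra.
Qed.

Let iv1 n : P.-integrable setT (EFin \o v1 n).
Proof.
apply: (@integrable_le_decay _ _ _ _ _ bm mu s t y s0 st _ (@mv1 n)) => w.
have /andP[h0 h1] := v1_01 n w; rewrite ger0_norm//; have := decay0 w; lra.
Qed.

Let iv2 n : P.-integrable setT (EFin \o v2 n).
Proof.
apply: (@integrable_le_decay _ _ _ _ _ bm mu s t y s0 st _ (@mv2 n)) => w.
have /andP[h0 h1] := v2_le n w; rewrite ger0_norm//; have := decay0 w; lra.
Qed.

Let compensatedE n w : compensated n w = (u1 w - u2 w) - (v1 n w - v2 n w).
Proof. by rewrite /compensated /u1 /u2 /v1 /v2; ring. Qed.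

Lemma measurable_compensated n : measurable_fun setT (compensated n).
Proof.
rewrite (_ : compensated n = fun w => (u1 w - u2 w) - (v1 n w - v2 n w)).
  exact: (measurable_funB (measurable_funB mu1 mu2) (measurable_funB (@mv1 n) (@mv2 n))).
by apply/funext => w; exact: compensatedE.
Qed.

Lemma compensated_le n w : `|compensated n w| <= 3 + 2 * decay w.
Proof.
rewrite compensatedE.
have /andP[a1 a2] := u1_01 w; have /andP[b1 b2] := u2_le w.
have /andP[c1 c2] := v1_01 n w; have /andP[e1 e2] := v2_le n w.
by rewrite ler_norml; apply/andP; split; lra.
Qed.

Lemma integral_compensated n :
  (\int[P]_w (compensated n w)%:E =
   \int[P]_(w in start_below) (F1 (end_pair w))%:E -
   \int[P]_(w in start_below) (F2 (end_pair w))%:E)%E.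
Proof.
have eu1 : (\int[P]_(w in start_below) (F1 (end_pair w))%:E = \int[P]_w (u1 w)%:E)%E.
  exact: integral_indicM.
have eu2 : (\int[P]_(w in start_below) (F2 (end_pair w))%:E = \int[P]_w (u2 w)%:E)%E.
  exact: integral_indicM.
rewrite eu1 eu2.
transitivity (\int[P]_w ((u1 w - u2 w)%:E - (v1 n w - v2 n w)%:E))%E.
  by apply: eq_integral => w _; rewrite -EFinB compensatedE.
have iu : P.-integrable setT (EFin \o (fun w => u1 w - u2 w)).
  exact: (integrableB measurableT iu1 iu2).
have iv : P.-integrable setT (EFin \o (fun w => v1 n w - v2 n w)).
  exact: (integrableB measurableT (@iv1 n) (@iv2 n)).
rewrite (integralB_EFin measurableT iu iv).
have -> : (\int[P]_w (v1 n w - v2 n w)%:E = 0)%E.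
  transitivity (\int[P]_w ((v1 n w)%:E - (v2 n w)%:E))%E.
    by apply: eq_integral => w _; rewrite -EFinB.
  rewrite (integralB_EFin measurableT (@iv1 n) (@iv2 n)).
  have ev1 : (\int[P]_(w in crossed n n.+1) (F1 (shifted_pair n w))%:E =
      \int[P]_w (v1 n w)%:E)%E by exact: integral_indicM.
  have ev2 : (\int[P]_(w in crossed n n.+1) (F2 (shifted_pair n w))%:E =
      \int[P]_w (v2 n w)%:E)%E by exact: integral_indicM.
  rewrite -ev1 [X in (X - _)%E](stopped_reflection bm mu x y s0 st tT (leqnn n.+1)).
  rewrite ev2 subee//; exact: (integrable_fin_num measurableT (@iv2 n)).
rewrite sube0.
transitivity (\int[P]_w ((u1 w)%:E - (u2 w)%:E))%E.
  by apply: eq_integral => w _; rewrite -EFinB.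
exact: (integralB_EFin measurableT iu1 iu2).
Qed.

(** A path starting above [y] makes both indicators vanish. A path staying under the barrier never
    crosses, and [reflected] vanishes at its end. Any other path is eventually seen crossing, and
    its shifted pair tends to its end pair, so the two terms cancel. *)
Lemma compensated_cvg w : ~ boundary_event w ->
  compensated n w @[n --> \oo] --> (\1_under w * F1 (end_pair w)).
Proof.
move=> nbad.
have Y0 n : stopped_value n 0 w = X s w by rewrite /stopped_value /= grid0.
have sst : s <= s <= t by rewrite lexx ltW.
have tst : s <= t <= t by rewrite lexx ltW.
have sub0 : `[s, t]%classic `<=` `[(0 : R), +oo[%classic.
  move=> r /=; rewrite !in_itv/= andbT => /andP[sr _].
  exact: le_trans (ltW s0) sr.
have cX := @drifted_continuous _ _ _ _ _ bm mu w.
have [Xs|Xs] := leP (X s w) y; last first.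
  have -> : \1_under w = 0 :> R.
    by rewrite indicE memNset// => /(_ s sst); rewrite leNgt Xs.
  rewrite mul0r; apply: cvg_near_cst; apply: nearW => n.
  rewrite /compensated !indicE !memNset ?mul0r ?subrr//=.
    by rewrite /crossed/= Y0 leNgt Xs => -[].
  by rewrite /start_below/= leNgt Xs.
have S1 : \1_start_below w = 1 :> R by rewrite indicE mem_set.
have [uw|nuw] := pselect (under w).
  have -> : \1_under w = 1 :> R by rewrite indicE mem_set.
  rewrite mul1r; apply: cvg_near_cst; apply: nearW => n.
  rewrite /compensated S1 indicE memNset; last first.
    rewrite /crossed/= => -[_]; rewrite ltNge /stopped_value.
    by rewrite (@stopped_grid_le R (fun r => X r w) s t y n st uw).
  rewrite mul0r subr0 mul1r reflected_eq0 ?subr0//.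
  exact: (uw t tst).
have -> : \1_under w = 0 :> R by rewrite indicE memNset.
rewrite mul0r.
have [r rst yr] : exists2 r, s <= r <= t & y < X r w.
  apply: contrapT => H; apply: nuw => r rst; rewrite leNgt; apply/negP => yr.
  by apply: H; exists r.
have evY := stopped_grid_gt cX sub0 st rst yr.
(* Defaulting to X_t before a crossing is detected makes the distance to X_t either 0 or the
   overshoot. *)
pose z_ n := if y < stopped_value n n.+1 w then y + (X t w - stopped_value n n.+1 w) else X t w.
have cz : z_ n @[n --> \oo] --> X t w.
  apply/cvgrPdist_lt => e e0.
  apply: filterS (stopped_grid_overshoot cX sub0 st Xs e0) => n Hn.
  rewrite /z_; case: ifPn => [yY|_]; last by rewrite subrr normr0.
  have -> : X t w - (y + (X t w - stopped_value n n.+1 w)) = stopped_value n n.+1 w - y by ring.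
  by rewrite ger0_norm; [exact: Hn|rewrite subr_ge0 ltW].
have zy : X t w != y by apply/eqP => h; apply: nbad; left; left.
have zx : X t w + (X T w - X t w) != x.
  by rewrite subrKC; apply/eqP => h; apply: nbad; left; right.
have zx' : 2 * y - X t w + (X T w - X t w) != x.
  by apply/eqP => h; apply: nbad; right.
have cG := below_reflected_cvg (mu := mu) zy zx zx' cz.
pose G := F1 (end_pair w) - F2 (end_pair w).
have c0 : G - (F1 (z_ n, X T w - X t w) - F2 (z_ n, X T w - X t w)) @[n --> \oo] --> G - G.
  exact: (cvgB (cvg_cst _) cG).
rewrite subrr in c0.
apply: cvg_trans c0; apply: near_eq_cvg.
apply: filterS evY => n yY; rewrite /compensated S1 mul1r.
have -> : \1_(crossed n n.+1) w = 1 :> R.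
  by rewrite indicE mem_set//= /crossed /= Y0.
by rewrite mul1r /shifted_pair /z_ yY.
Qed.

Lemma reflection_principle :
  (P (under `&` [set w | (X t w < y)%R /\ (X T w <= x)%R]) =
   \int[P]_(w in start_below) (F1 (end_pair w))%:E -
   \int[P]_(w in start_below) (F2 (end_pair w))%:E)%E.
Proof.
have mU := @measurable_under_barrier _ _ _ _ _ bm mu s t y s0 st.
have mX r := @measurable_drifted _ _ _ _ W mu r.
have mc c := @measurable_cst _ _ Omega R setT c.
have mE : measurable [set w | X t w < y /\ X T w <= x].
  by apply: measurableI; [exact: (measurable_set_lt (mX t) (mc y))
    |exact: (measurable_set_le (mX T) (mc x))].
have ml : measurable_fun setT (fun w => \1_under w * F1 (end_pair w)).
  apply: measurable_funM; first exact: measurable_indic.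
  exact: (measurableT_comp (@measurable_below R x y) (@measurable_end_pair _ _ _ _ W mu t T)).
rewrite -(integral_indicT P (measurableI _ _ mU mE)).
transitivity (\int[P]_w (\1_under w * F1 (end_pair w))%:E)%E.
  apply: eq_integral => w _; congr EFin; rewrite indicI /=; congr (_ * _).
  rewrite /below !indicE; congr ((nat_of_bool _)%:R).
  by apply/idP/idP; rewrite !inE /= subrKC.
have ae : {ae P, forall w, setT w ->
    (compensated n w)%:E @[n --> \oo] --> (\1_under w * F1 (end_pair w))%:E}.
  exists boundary_event; split.
  - exact: measurable_boundary_event.
  - exact: (boundary_event_null bm mu x y s0 st tT).
  - move=> w /= H; apply: contrapT => nbad; apply: H => _.
    by apply: cvg_EFin; [exact: nearW|exact: (compensated_cvg nbad)].
have ig : P.-integrable setT (EFin \o (fun w => 3 + 2 * decay w)).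
  apply: (@integrable_le_decay _ _ _ _ _ bm mu s t y s0 st).
    apply: measurable_funD => //; apply: measurable_funM => //.
    exact: measurable_decay.
  by move=> w; rewrite ger0_norm// addr_ge0// mulr_ge0.
have [_ _] := dominated_convergence measurableT
  (fun n => (measurable_EFinP _ _).2 (@measurable_compensated n))
  ((measurable_EFinP _ _).2 ml) ae ig
  (aeW _ (fun w n _ => compensated_le n w)).
(* The integrals do not depend on [n], so their limit is their common value. *)
under eq_fun do rewrite integral_compensated.
by move=> /cvg_lim <-//; rewrite lim_cst.
Qed.

End compensated_limit.

Lemma eq_measure_null d (T : measurableType d) (R : realType)
    (m : {measure set T -> \bar R}) (A B N : set T) :
  measurable A -> measurable B -> measurable N -> m N = 0%E ->
  A `\` N = B `\` N -> m A = m B.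
Proof.
move=> mA mB mN N0 AB.
have H C : measurable C -> m C = m (C `\` N).
  move=> mC; rewrite (measureDI m mC mN) [X in (_ + X)%E](_ : _ = 0%E) ?adde0//.
  apply: (@subset_measure0 _ _ _ m _ N) => //; exact: measurableI.
by rewrite (H A mA) (H B mB) AB.
Qed.

Lemma measurable_linmap3_orthant (R : realType) (A : 'M[R]_3) (z1 z2 z3 : R) :
  measurable (linmap3 A @^-1` orthant3 z1 z2 z3).
Proof.
rewrite -[X in measurable X]setTI.
exact: (@measurable_linmap3 R A measurableT _ (measurable_orthant3 z1 z2 z3)).
Qed.

(** * From increments to normal orthants *)

Section gauss_form.
Context {R : realType}.
Local Notation g3 := (@std_normal3 R).
Variables (mu s t T : R).
Hypotheses (s0 : 0 < s) (st : s < t) (tT : t <= T).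

(** Sends the standardized increments to (W_T / sqrt T, W_t / sqrt t, e W_s / sqrt s). The sign [e]
    = -1 is for the mirrored event, which bounds W_s from below. *)
Definition chol_mx (e : R) : 'M[R]_3 :=
  mx3 (Num.sqrt (T - t) / Num.sqrt T) (Num.sqrt (t - s) / Num.sqrt T) (Num.sqrt s / Num.sqrt T)
      0 (Num.sqrt (t - s) / Num.sqrt t) (Num.sqrt s / Num.sqrt t)
      0 0 e.

Let t0 : 0 < t. Proof. exact: lt_trans st. Qed.
Let T0 : 0 < T. Proof. exact: lt_le_trans tT. Qed.
Let rs0 : Num.sqrt s != 0. Proof. by rewrite gt_eqF// sqrtr_gt0. Qed.
Let rt0 : Num.sqrt t != 0. Proof. by rewrite gt_eqF// sqrtr_gt0. Qed.
Let rT0 : Num.sqrt T != 0. Proof. by rewrite gt_eqF// sqrtr_gt0. Qed.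
Let ss : Num.sqrt s ^+ 2 = s. Proof. by rewrite sqr_sqrtr// ltW. Qed.
Let tt : Num.sqrt t ^+ 2 = t. Proof. by rewrite sqr_sqrtr// ltW. Qed.
Let TT : Num.sqrt T ^+ 2 = T. Proof. by rewrite sqr_sqrtr// ltW. Qed.
Let dts : Num.sqrt (t - s) ^+ 2 = Num.sqrt t ^+ 2 - Num.sqrt s ^+ 2.
Proof. by rewrite tt ss sqr_sqrtr// subr_ge0 ltW. Qed.
Let dTt : Num.sqrt (T - t) ^+ 2 = Num.sqrt T ^+ 2 - Num.sqrt t ^+ 2.
Proof. by rewrite tt TT sqr_sqrtr// subr_ge0. Qed.

Lemma chol_mx_gram (e : R) : e ^+ 2 = 1 ->
  chol_mx e *m (chol_mx e)^T =
  corr_mx3 (Num.sqrt (t / T)) (e * Num.sqrt (s / T)) (e * Num.sqrt (s / t)).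
Proof.
move=> e1.
have sq a b : 0 < a -> 0 < b -> Num.sqrt (a / b) = Num.sqrt a / Num.sqrt b.
  by move=> a0 b0; rewrite sqrtrM ?sqrtrV// ltW.
rewrite !sq// corr_mx3E /chol_mx mx3_tr mx3_mul.
(* Only h^2 = b^2 - c^2 and k^2 = a^2 - b^2 are kept about the square roots, which are abstracted
   into variables. *)
move: rt0 rT0 dts dTt.
move: (Num.sqrt T) (Num.sqrt t) (Num.sqrt s) (Num.sqrt (t - s)) (Num.sqrt (T - t)).
move=> a b c h k b0 a0 hE kE.
have E1 : k / a * (k / a) + h / a * (h / a) + c / a * (c / a) = 1.
  have -> : k / a * (k / a) + h / a * (h / a) + c / a * (c / a) =
    (k ^+ 2 + h ^+ 2 + c ^+ 2) / a ^+ 2 by field.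
  by rewrite kE hE; field.
have E2 : h / a * (h / b) + c / a * (c / b) = b / a.
  have -> : h / a * (h / b) + c / a * (c / b) = (h ^+ 2 + c ^+ 2) / (a * b).
    by field; rewrite a0 b0.
  by rewrite hE; field; rewrite a0 b0.
have E3 : h / b * (h / b) + c / b * (c / b) = 1.
  have -> : h / b * (h / b) + c / b * (c / b) = (h ^+ 2 + c ^+ 2) / b ^+ 2 by field.
  by rewrite hE; field.
congr mx3; first [ring | exact: E1 | rewrite -E2; ring
  | rewrite -[RHS]E3; ring | rewrite -[RHS]e1; ring].
Qed.

Let sc := scale3 (Num.sqrt (T - t)) (Num.sqrt (t - s)) (Num.sqrt s).

(** [level1], [level2] and [level3] recover X_T, X_t and X_s from the triple of increments. *)
Definition level1 (p : R * R * R) : R := p.2 + p.1.2 + p.1.1 + mu * T.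
Definition level2 (p : R * R * R) : R := p.2 + p.1.2 + mu * t.
Definition level3 (p : R * R * R) : R := p.2 + mu * s.

Let mlevel1 : measurable_fun setT level1.
Proof.
have m1 := @measurable_fst3 R; have m2 := @measurable_snd3 R; have m3 := @measurable_thd3 R.
exact: (measurable_funD (measurable_funD (measurable_funD m3 m2) m1) (@measurable_cst _ _ _ _ _ (mu * T))).
Qed.

Let mlevel2 : measurable_fun setT level2.
Proof.
have m2 := @measurable_snd3 R; have m3 := @measurable_thd3 R.
exact: (measurable_funD (measurable_funD m3 m2) (@measurable_cst _ _ _ _ _ (mu * t))).
Qed.

Let mlevel3 : measurable_fun setT level3.
Proof.
have m3 := @measurable_thd3 R.
exact: (measurable_funD m3 (@measurable_cst _ _ _ _ _ (mu * s))).
Qed.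

Lemma chol_mx_orthant (e z1 z2 z3 : R) x :
  orthant3 z1 z2 z3 (linmap3 (chol_mx e) x) <->
  [/\ level1 (sc x) <= mu * T + Num.sqrt T * z1,
      level2 (sc x) <= mu * t + Num.sqrt t * z2 & e * x.2 <= z3].
Proof.
have sT0 : 0 < Num.sqrt T by rewrite sqrtr_gt0.
have st0 : 0 < Num.sqrt t by rewrite sqrtr_gt0.
rewrite /chol_mx linmap3_mx3 /orthant3 /level1 /level2 /sc /scale3 /=.
have -> : Num.sqrt (T - t) / Num.sqrt T * x.1.1 + Num.sqrt (t - s) / Num.sqrt T * x.1.2
   + Num.sqrt s / Num.sqrt T * x.2 = (Num.sqrt (T - t) * x.1.1
   + Num.sqrt (t - s) * x.1.2 + Num.sqrt s * x.2) / Num.sqrt T by field.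
have -> : 0 * x.1.1 + Num.sqrt (t - s) / Num.sqrt t * x.1.2
   + Num.sqrt s / Num.sqrt t * x.2 =
   (Num.sqrt (t - s) * x.1.2 + Num.sqrt s * x.2) / Num.sqrt t by field.
rewrite !mul0r !add0r !ler_pdivrMr// [z1 * _]mulrC [z2 * _]mulrC.
by split => -[h1 h2 h3]; split => //; lra.
Qed.

Definition below_event (x y : R) : set (R * R * R) :=
  [set p | [/\ level3 p <= y, level2 p < y & level1 p <= x]].

(** The constraints X_s <= y, X_t > y and 2 y - 2 X_t + X_T <= x after (X_s, X_t, X_T) becomes (-
    X_s, - X_t, X_T - 2 X_t), a substitution that is its own inverse. *)
Definition mirror_event (x y : R) : set (R * R * R) :=
  [set p | [/\ - y <= level3 p, level2 p < - y & level1 p <= x - 2 * y]].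

Lemma measurable_below_event x y : measurable (below_event x y).
Proof.
have mc c := @measurable_cst _ _ (R * R * R)%type R setT c.
rewrite (_ : below_event x y = [set p | level3 p <= y] `&` [set p | level2 p < y]
   `&` [set p | level1 p <= x]); last first.
  by apply/seteqP; split => p /=; [move=> []|move=> [[]]].
apply: measurableI; first apply: measurableI.
- exact: (measurable_set_le mlevel3 (mc y)).
- exact: (measurable_set_lt mlevel2 (mc y)).
- exact: (measurable_set_le mlevel1 (mc x)).
Qed.

Lemma measurable_mirror_event x y : measurable (mirror_event x y).
Proof.
have mc c := @measurable_cst _ _ (R * R * R)%type R setT c.
rewrite (_ : mirror_event x y = [set p | - y <= level3 p] `&` [set p | level2 p < - y]
   `&` [set p | level1 p <= x - 2 * y]); last first.
  by apply/seteqP; split => p /=; [move=> []|move=> [[]]].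
apply: measurableI; first apply: measurableI.
- exact: (measurable_set_le (mc (- y)) mlevel3).
- exact: (measurable_set_lt mlevel2 (mc (- y))).
- exact: (measurable_set_le mlevel1 (mc (x - 2 * y))).
Qed.

Let msc : measurable_fun setT sc. Proof. exact: measurable_scale3. Qed.

Let mpre B : measurable B -> measurable (sc @^-1` B).
Proof. by move=> mB; rewrite -[X in measurable X]setTI; exact: msc. Qed.

Let hyper_level2 c : measurable [set x | level2 (sc x) = c] /\
   g3 [set x | level2 (sc x) = c] = 0%E.
Proof.
split.
  exact: (measurable_set_eq (measurableT_comp mlevel2 msc) (@measurable_cst _ _ _ _ _ c)).
rewrite -(std_normal3_hyperplane 0 (Num.sqrt (t - s)) (c - mu * t) rs0).
congr (g3 _); apply/seteqP; split => x /=; rewrite /level2 /sc /scale3 /= => h; lra.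
Qed.

(** Standardizing the thresholds leaves only strict against weak inequality for [level2], a null
    hyperplane. *)
Lemma below_event_orthant x y q : x = mu * T + Num.sqrt T * q ->
  g3 (sc @^-1` below_event x y) =
  g3 (linmap3 (chol_mx 1) @^-1`
    orthant3 q ((y - mu * t) / Num.sqrt t) ((y - mu * s) / Num.sqrt s)).
Proof.
move=> xq; have [mH H0] := hyper_level2 y.
have sc0 : 0 < Num.sqrt s by rewrite sqrtr_gt0.
have E2 z : mu * t + Num.sqrt t * ((z - mu * t) / Num.sqrt t) = z by field.
have h3E (p : R * R * R) : (1 * p.2 <= (y - mu * s) / Num.sqrt s) = (level3 (sc p) <= y).
  by rewrite ler_pdivlMr// /level3 /sc /scale3 /=; apply/idP/idP; lra.
apply: (@eq_measure_null _ _ _ g3 _ _ _ _ _ mH H0).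
- exact: (mpre (measurable_below_event x y)).
- exact: (measurable_linmap3_orthant (chol_mx _)).
apply/seteqP; split => p [] /=; rewrite chol_mx_orthant -xq E2 h3E.
- by move=> [h1 h2 h3] h; split => //; split => //; exact: ltW.
- move=> [h1 h2 h3] h; split => //; split => //.
  by rewrite lt_neqAle h2 andbT; exact/eqP.
Qed.

(** The lower bound on [level3] becomes an upper bound on the negated coordinate, the origin of the
    negative correlations; lowering [x] by 2 y lowers [q] by 2 y / sqrt T. *)
Lemma mirror_event_orthant x y q : x = mu * T + Num.sqrt T * q ->
  g3 (sc @^-1` mirror_event x y) =
  g3 (linmap3 (chol_mx (-1)) @^-1`
    orthant3 (q - 2 * y / Num.sqrt T) ((- y - mu * t) / Num.sqrt t)
       ((y + mu * s) / Num.sqrt s)).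
Proof.
move=> xq; have [mH H0] := hyper_level2 (- y).
have sc0 : 0 < Num.sqrt s by rewrite sqrtr_gt0.
have xq' : mu * T + Num.sqrt T * (q - 2 * y / Num.sqrt T) = x - 2 * y.
  by rewrite xq; field.
have E2 z : mu * t + Num.sqrt t * ((z - mu * t) / Num.sqrt t) = z by field.
have h3E (p : R * R * R) : (-1 * p.2 <= (y + mu * s) / Num.sqrt s) =
    (- y <= level3 (sc p)).
  by rewrite ler_pdivlMr// /level3 /sc /scale3 /=; apply/idP/idP; lra.
apply: (@eq_measure_null _ _ _ g3 _ _ _ _ _ mH H0).
- exact: (mpre (measurable_mirror_event x y)).
- exact: (measurable_linmap3_orthant (chol_mx _)).
apply/seteqP; split => p [] /=; rewrite chol_mx_orthant xq' E2 h3E.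
- by move=> [h1 h2 h3] h; split => //; split => //; exact: ltW.
- move=> [h1 h2 h3] h; split => //; split => //.
  by rewrite lt_neqAle h2 andbT; exact/eqP.
Qed.

(* The Gaussian tilt reverses the sign of both [level2] and [level3]. *)
Lemma mirror_event_tilt x y :
  (\int[g3]_z (\1_[set p | level3 p <= y] (sc z) *
     reflected mu x y (level2 (sc z), level1 (sc z) - level2 (sc z)))%:E =
   (expR (2 * mu * y))%:E * g3 (sc @^-1` mirror_event x y))%E.
Proof.
have mC := mpre (measurable_mirror_event x y).
set C := sc @^-1` _ in mC *.
pose f (z : R * R * R) := (\1_C z : R)%:E.
have mf : measurable_fun setT f by exact/measurable_EFinP/measurable_indic.
have f0 z : (0 <= f z)%E by rewrite lee_fin.
rewrite -(integral_indicT g3 mC) -/f.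
(* For c = 2 mu sigma, the map z -> - z - c negates the drifted increment mu sigma^2 + sigma z. *)
pose c3 := 2 * mu * Num.sqrt s; pose c2 := 2 * mu * Num.sqrt (t - s).
pose f3 (z : R * R * R) := (f (z.1, - z.2 - c3)%R * (tilt_density c3 z.2)%:E)%E.
have mf3 : measurable_fun setT f3.
  have mr : measurable_fun setT (fun x : R * R * R => (x.1, - x.2 - c3)).
    apply: measurable_fun_pair; first exact: measurable_fst.
    by apply: measurable_funB => //; exact: measurable_funN.
  apply: emeasurable_funM; first exact: (measurableT_comp mf mr).
  apply/measurable_EFinP.
  exact: (measurableT_comp (@measurable_tilt_density R c3) (@measurable_thd3 R)).
have f30 z : (0 <= f3 z)%E by rewrite mule_ge0// lee_fin expR_ge0.
rewrite (std_normal3_tilt3 c3 mf f0) -/f3 (std_normal3_tilt2 c2 mf3 f30).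
pose G (z : R * R * R) : R := \1_[set p | level3 p <= y] (sc z) *
     reflected mu x y (level2 (sc z), level1 (sc z) - level2 (sc z)).
have mG : measurable_fun setT (EFin \o G).
  apply/measurable_EFinP; apply: measurable_funM.
    apply: measurableT_comp; last exact: msc.
    apply: measurable_indic.
    exact: (measurable_set_le mlevel3 (@measurable_cst _ _ _ _ _ y)).
  apply: (measurableT_comp (@measurable_reflected R mu x y)).
  have m2 := measurableT_comp mlevel2 msc; have m1 := measurableT_comp mlevel1 msc.
  exact: (measurable_fun_pair m2 (measurable_funB m1 m2)).
have G0 z : setT z -> (0 <= (EFin \o G) z)%E.
  by rewrite lee_fin mulr_ge0// reflected_ge0.
have k0 : (0 <= (expR (- (2 * mu * y)))%:E :> \bar R)%E by rewrite lee_fin expR_ge0.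
have E z : (f3 (z.1.1, - z.1.2 - c2, z.2)%R * (tilt_density c2 z.1.2)%:E =
    (expR (- (2 * mu * y)))%:E * (EFin \o G) z)%E.
  rewrite /f3 /f /G /= -!EFinM; congr EFin.
  (* The two densities multiply to exp(- 2 mu [level2]), whereas [reflected] has the weight exp(- 2
     mu ([level2] - y)): the quotient is the source of the factor exp(2 mu y). *)
  have dens : tilt_density c3 z.2 * tilt_density c2 z.1.2 =
     expR (- (2 * mu * y)) * expR (- (2 * mu * (level2 (sc z) - y))).
    rewrite /tilt_density -!expRD /level2 /sc /scale3 /c2 /c3 /=; congr expR.
    have -> : (2 * mu * Num.sqrt s) ^+ 2 = 4 * mu ^+ 2 * s by rewrite exprMn ss; ring.
    have -> : (2 * mu * Num.sqrt (t - s)) ^+ 2 = 4 * mu ^+ 2 * (t - s).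
      by rewrite exprMn dts tt ss; ring.
    by field.
  rewrite -mulrA dens /reflected mulrCA; congr (_ * _).
  rewrite [RHS]mulrCA mulrC; congr (_ * _).
  have s2 := ss; have ds2 : Num.sqrt (t - s) ^+ 2 = t - s by rewrite dts tt ss.
  have L3 : level3 (sc ((z.1.1, - z.1.2 - c2), - z.2 - c3)) = - level3 (sc z).
    rewrite /level3 /sc /scale3 /c3 /=.
    have -> : Num.sqrt s * (- z.2 - 2 * mu * Num.sqrt s) =
      - (Num.sqrt s * z.2) - 2 * mu * Num.sqrt s ^+ 2 by ring.
    by rewrite ss; ring.
  have L2 : level2 (sc ((z.1.1, - z.1.2 - c2), - z.2 - c3)) = - level2 (sc z).
    rewrite /level2 /sc /scale3 /c3 /c2 /=.
    have -> : Num.sqrt s * (- z.2 - 2 * mu * Num.sqrt s) +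
        Num.sqrt (t - s) * (- z.1.2 - 2 * mu * Num.sqrt (t - s)) =
      - (Num.sqrt s * z.2) - Num.sqrt (t - s) * z.1.2 -
        2 * mu * (Num.sqrt s ^+ 2 + Num.sqrt (t - s) ^+ 2) by ring.
    by rewrite ss ds2; ring.
  (* The increment over [t, T] is not tilted, so [level1] changes only through [level2]. *)
  have L1 : level1 (sc ((z.1.1, - z.1.2 - c2), - z.2 - c3)) =
      level1 (sc z) - 2 * level2 (sc z).
    have -> p : level1 p = level2 p + (p.1.1 + mu * (T - t)).
      by rewrite /level1 /level2; ring.
    rewrite L2 [in RHS](_ : level1 (sc z) = level2 (sc z) + ((sc z).1.1 + mu * (T - t))).
      by rewrite /sc /scale3 /=; ring.
    by rewrite /level1 /level2; ring.
  rewrite !indicE -natrM mulnb; congr ((nat_of_bool _)%:R).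
  apply/idP/andP; rewrite !inE /C /= /mirror_event /= L1 L2 L3.
    by move=> [h1 h2 h3]; split; [lra|split; lra].
  by move=> [h1 [h2 h3]]; split; lra.
under [X in (_ * X)%E]eq_integral do rewrite E.
rewrite (ge0_integralZl _ measurableT mG G0 k0) muleA -EFinM -expRD subrr expR0.
by rewrite mul1e.
Qed.

End gauss_form.

(** * Joint law of the end value and the event of staying under the barrier *)

Section joint_law.
Context d (Omega : measurableType d) (R : realType) (P : probability Omega R).
Variable W : R -> {RV P >-> R}.
Hypothesis bm : brownian_motion W.
Variables (mu s t T : R).
Hypotheses (s0 : 0 < s) (st : s < t) (tT : t <= T).

Local Notation X := (drifted W mu).
Local Notation g3 := (@std_normal3 R).
Local Notation under y := (@under_barrier _ _ _ _ W mu s t y).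
Local Notation sc := (scale3 (Num.sqrt (T - t)) (Num.sqrt (t - s)) (Num.sqrt s)).

Let level1E w : level1 mu T (incr3 W s t T w) = X T w.
Proof. by rewrite /level1 /incr3 /drifted /=; ring. Qed.

Let level2E w : level2 mu t (incr3 W s t T w) = X t w.
Proof. by rewrite /level2 /incr3 /drifted /=; ring. Qed.

Let level3E w : level3 mu s (incr3 W s t T w) = X s w.
Proof. by []. Qed.

Lemma integral_below_gauss x y :
  (\int[P]_(w in start_below W mu s y) (below x y (end_pair W mu t T w))%:E =
   g3 (sc @^-1` below_event mu s t T x y))%E.
Proof.
have mB := measurable_below_event mu s t T x y.
rewrite -(incr3_law bm s0 (ltW st) tT mB) integral_indicM.
have mB' : measurable (incr3 W s t T @^-1` below_event mu s t T x y).
  by rewrite -[X in measurable X]setTI; exact: measurable_incr3.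
rewrite -(integral_indicT P mB'); apply: eq_integral => w _; congr EFin.
rewrite /below !indicE -natrM mulnb; congr ((nat_of_bool _)%:R).
apply/andP/idP; rewrite !inE /below_event /= level1E level2E level3E subrKC.
- by move=> [h1 [h2 h3]].
- by move=> [h1 h2 h3].
Qed.

Lemma integral_reflected_gauss x y :
  (\int[P]_(w in start_below W mu s y) (reflected mu x y (end_pair W mu t T w))%:E =
   (expR (2 * mu * y))%:E * g3 (sc @^-1` mirror_event mu s t T x y))%E.
Proof.
rewrite -(mirror_event_tilt mu T s0 st x y) integral_indicM.
pose G (p : R * R * R) : R := \1_[set p | level3 mu s p <= y] p *
     reflected mu x y (level2 mu t p, level1 mu T p - level2 mu t p).
have mG : measurable_fun setT (EFin \o G).
  have m1 := @measurable_fst3 R; have m2 := @measurable_snd3 R; have m3 := @measurable_thd3 R.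
  have mc c := @measurable_cst _ _ (R * R * R)%type R setT c.
  have l3 : measurable_fun setT (level3 mu s) by exact: measurable_funD m3 (mc _).
  have l2 : measurable_fun setT (level2 mu t).
    exact: measurable_funD (measurable_funD m3 m2) (mc _).
  have l1 : measurable_fun setT (level1 mu T).
    exact: measurable_funD (measurable_funD (measurable_funD m3 m2) m1) (mc _).
  apply/measurable_EFinP; apply: measurable_funM.
    by apply: measurable_indic; exact: (measurable_set_le l3 (mc y)).
  apply: (measurableT_comp (@measurable_reflected R mu x y)).
  exact: (measurable_fun_pair l2 (measurable_funB l1 l2)).
have G0 z : (0 <= (EFin \o G) z)%E by rewrite lee_fin mulr_ge0// reflected_ge0.
rewrite -[RHS](ge0_integral_incr3 bm s0 (ltW st) tT mG G0).
apply: eq_integral => w _; congr EFin.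
by rewrite /G level1E level2E /start_below.
Qed.

(** Under the barrier X_t <= y, and X_t = y is a null event, so the strict inequality of
    [reflection_principle] may be dropped. *)
Lemma joint_under x y q : x = mu * T + Num.sqrt T * q ->
  (P (under y `&` [set w | (X T w <= x)%R]) =
   g3 (linmap3 (chol_mx s t T 1) @^-1`
     orthant3 q ((y - mu * t) / Num.sqrt t) ((y - mu * s) / Num.sqrt s)) -
   (expR (2 * mu * y))%:E * g3 (linmap3 (chol_mx s t T (-1)) @^-1`
     orthant3 (q - 2 * y / Num.sqrt T) ((- y - mu * t) / Num.sqrt t)
       ((y + mu * s) / Num.sqrt s)))%E.
Proof.
move=> xq.
rewrite -(below_event_orthant s0 st tT y xq) -(mirror_event_orthant s0 st tT y xq).
rewrite -integral_below_gauss -integral_reflected_gauss.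
rewrite -(reflection_principle bm mu x y s0 st tT).
have mX r := @measurable_drifted _ _ _ _ W mu r.
have mc c := @measurable_cst _ _ Omega R setT c.
have mU := @measurable_under_barrier _ _ _ _ _ bm mu s t y s0 st.
have mN := measurable_set_eq (mX t) (mc y).
have N0 := drifted_eq_null bm mu s0 st tT y.
apply: (@eq_measure_null _ _ _ P _ _ _ _ _ mN N0).
- by apply: measurableI => //; exact: (measurable_set_le (mX T) (mc x)).
- apply: measurableI => //; apply: measurableI.
  + exact: (measurable_set_lt (mX t) (mc y)).
  + exact: (measurable_set_le (mX T) (mc x)).
apply/seteqP; split => w [[h1 h2] h3]; split => //=; split => //=.
- split => //; rewrite lt_neqAle; apply/andP; split; first exact/eqP.
  by apply: h1; rewrite lexx ltW.
- by case: h2.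
Qed.

End joint_law.

(** * Quantiles and the copula *)

Lemma cvg_probability_ae d (T : measurableType d) (R : realType)
    (P : probability T R) (A_ : nat -> set T) (A N : set T) :
  (forall n, measurable (A_ n)) -> measurable A -> measurable N -> P N = 0%E ->
  (forall w, ~ N w -> \forall n \near \oo, A_ n w <-> A w) ->
  fine (P (A_ n)) @[n --> \oo] --> fine (P A).
Proof.
move=> mA_ mA mN N0 H.
have mi B : measurable B -> measurable_fun setT (EFin \o (\1_B : T -> R)).
  by move=> mB; exact/measurable_EFinP/measurable_indic.
have ae : {ae P, forall w, setT w ->
    (EFin \o (\1_(A_ n) : T -> R)) w @[n --> \oo] --> (EFin \o (\1_A : T -> R)) w}.
  exists N; split => // w /= Hw; apply: contrapT => nN; apply: Hw => _.
  apply: cvg_near_cst; apply: filterS (H w nN) => n An /=; congr EFin.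
  rewrite !indicE; congr ((nat_of_bool _)%:R).
  by apply/idP/idP; rewrite !inE => ?; apply/An.
have le1 n w : (`|(EFin \o (\1_(A_ n) : T -> R)) w| <= (EFin \o cst (1%R : R)) w)%E.
  by rewrite /= lee_fin indicE; case: (_ \in _); rewrite ?normr1 ?normr0.
have ig : P.-integrable setT (EFin \o cst (1 : R)) by exact: finite_measure_integrable_cst.
have [_ _] := dominated_convergence measurableT (fun n => mi _ (mA_ n)) (mi _ mA) ae ig
  (aeW _ (fun w n _ => le1 n w)).
have E B : measurable B -> (\int[P]_w (EFin \o (\1_B : T -> R)) w = P B)%E.
  by move=> mB; exact: integral_indicT.
under eq_fun do rewrite (E _ (mA_ _)).
rewrite (E _ mA) => c; apply: fine_cvg.
by rewrite fineK ?fin_num_measure.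
Qed.

Lemma cvg_near_le {R : realType} (a : R) (z_ : nat -> R) (z : R) :
  z_ n @[n --> \oo] --> z -> a <> z -> \forall n \near \oo, (a <= z_ n) = (a <= z).
Proof.
move=> cz /eqP az; have za : z != a by rewrite eq_sym.
have : \forall n \near \oo, (z_ n < a) = (z < a) by exact: (cz _ (near_lt_eq za)).
by apply: filterS => n h; rewrite !leNgt h.
Qed.

Lemma cvg_subn1 {R : realType} (y : R) : y - n.+1%:R^-1 @[n --> \oo] --> y.
Proof.
rewrite -[X in _ --> X]subr0; apply: cvgB; first exact: cvg_cst.
exact: cvg_harmonic.
Qed.

Lemma cvg_addn1 {R : realType} (y : R) : y + n.+1%:R^-1 @[n --> \oo] --> y.
Proof.
rewrite -[X in _ --> X]addr0; apply: cvgD; first exact: cvg_cst.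
exact: cvg_harmonic.
Qed.

(** The nonzero entries of the last column make the three boundary hyperplanes null; off them,
    membership is eventually constant. *)
Lemma std_normal3_orthant_cvg (R : realType) (a b c d e f g h i : R)
    (z1_ z2_ z3_ : nat -> R) (z1 z2 z3 : R) : c != 0 -> f != 0 -> i != 0 ->
  z1_ n @[n --> \oo] --> z1 -> z2_ n @[n --> \oo] --> z2 ->
  z3_ n @[n --> \oo] --> z3 ->
  let A := mx3 a b c d e f g h i in
  fine (std_normal3 (linmap3 A @^-1` orthant3 (z1_ n) (z2_ n) (z3_ n)))
    @[n --> \oo] --> fine (std_normal3 (linmap3 A @^-1` orthant3 z1 z2 z3)).
Proof.
move=> c0 f0 i0 cz1 cz2 cz3 A.
have mH k l m z : measurable [set x : R * R * R | k * x.1.1 + l * x.1.2 + m * x.2 = z].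
  have m1 := measurableT_comp (@mulrl_measurable R setT k) (@measurable_fst3 R).
  have m2 := measurableT_comp (@mulrl_measurable R setT l) (@measurable_snd3 R).
  have m3 := measurableT_comp (@mulrl_measurable R setT m) (@measurable_thd3 R).
  exact: (measurable_set_eq (measurable_funD (measurable_funD m1 m2) m3)
    (@measurable_cst _ _ _ _ _ z)).
have mN := measurableU _ _ (measurableU _ _ (mH a b c z1) (mH d e f z2)) (mH g h i z3).
have N0 := measureU_null (measurableU _ _ (mH a b c z1) (mH d e f z2)) (mH g h i z3)
  (measureU_null (mH a b c z1) (mH d e f z2)
    (std_normal3_hyperplane a b z1 c0) (std_normal3_hyperplane d e z2 f0))
  (std_normal3_hyperplane g h z3 i0).
apply: (@cvg_probability_ae _ _ R (@std_normal3 R) _ _ _ _ _ mN N0).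
- by move=> n; exact: (measurable_linmap3_orthant A).
- exact: (measurable_linmap3_orthant A).
move=> w nN.
have n1 : a * w.1.1 + b * w.1.2 + c * w.2 <> z1 by move=> h1; apply: nN; left; left.
have n2 : d * w.1.1 + e * w.1.2 + f * w.2 <> z2 by move=> h1; apply: nN; left; right.
have n3 : g * w.1.1 + h * w.1.2 + i * w.2 <> z3 by move=> h1; apply: nN; right.
apply: filterS3 (cvg_near_le cz1 n1) (cvg_near_le cz2 n2) (cvg_near_le cz3 n3) => n.
by rewrite /A /= linmap3_mx3 /orthant3 /= => -> -> ->.
Qed.

Section atomless.
Context d (Omega : measurableType d) (R : realType) (P : probability Omega R).
Variable X : Omega -> R.
Hypotheses (mX : measurable_fun setT X) (atomless : forall y, P [set w | X w = y] = 0%E).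

Let mle y : measurable [set w | X w <= y].
Proof. exact: (measurable_set_le mX (@measurable_cst _ _ _ _ _ y)). Qed.

Let meq y : measurable [set w | X w = y].
Proof. exact: (measurable_set_eq mX (@measurable_cst _ _ _ _ _ y)). Qed.

Lemma df_cvg (y_ : nat -> R) y : y_ n @[n --> \oo] --> y ->
  df P X (y_ n) @[n --> \oo] --> df P X y.
Proof.
move=> cy; apply: (cvg_probability_ae (fun n => mle (y_ n)) (mle y) (meq y) (atomless y)).
move=> w wy; apply: filterS (cvg_near_le cy wy) => n.
by rewrite /= => ->.
Qed.

Lemma df_nondecreasing x y : x <= y -> df P X x <= df P X y.
Proof.
move=> xy; apply: fine_le; rewrite ?fin_num_measure//.
by apply: le_measure; rewrite ?inE//= => w /= /le_trans; apply.
Qed.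

Lemma df_gt (v : R) : v < 1 -> exists x, v < df P X x.
Proof.
move=> v1.
have c : df P X n%:R @[n --> \oo] --> fine (P setT).
  apply: (cvg_probability_ae (N := set0) (fun n => mle n%:R)) => //.
  move=> w _; near=> n; split => //= _; near: n; exact: nbhs_infty_ger.
have [n _ /(_ n (leqnn n)) H] : \forall n \near \oo, v < df P X n%:R.
  by move: c; rewrite probability_setT => /cvgr_gt; exact.
by exists n%:R.
Unshelve. all: by end_near. Qed.

Lemma df_lt (v : R) : 0 < v -> exists x, df P X x < v.
Proof.
move=> v0.
have c : df P X (- n%:R) @[n --> \oo] --> fine (P set0).
  apply: (cvg_probability_ae (N := set0) (fun n => mle (- n%:R))) => //.
  move=> w _; near=> n; split => //=; apply/negP; rewrite -ltNge ltrNl.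
  near: n; exact: nbhs_infty_gtr.
have [n _ /(_ n (leqnn n)) H] : \forall n \near \oo, df P X (- n%:R) < v.
  by move: c; rewrite measure0 => /cvgr_lt; exact.
by exists (- n%:R).
Unshelve. all: by end_near. Qed.

(** Points left of the infimum have values below [v], and there are points with value at least [v]
    arbitrarily close on the right. Continuity from both sides gives equality. *)
Lemma df_quantile (v : R) : 0 < v < 1 -> df P X (quantile (df P X) v) = v.
Proof.
move=> /andP[v0 v1]; set q := quantile _ _.
have [x1 vx1] := df_gt v1; have [x0 x0v] := df_lt v0.
have hi : has_inf [set x | v <= df P X x].
  split; first by exists x1; exact: ltW.
  exists x0 => z /= vz; rewrite leNgt; apply/negP => zx0.
  have := le_lt_trans (df_nondecreasing (ltW zx0)) x0v.
  by rewrite ltNge vz.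
apply/eqP; rewrite eq_le; apply/andP; split.
- have c := df_cvg (@cvg_subn1 R q).
  apply: (@cvgr_to_le _ _ _ R _ _ v c); apply: nearW => n.
  rewrite leNgt; apply/negP => /ltW vn.
  have /(_ _ vn) := inf_lbound hi.2.
  by rewrite -/(quantile _ _) -/q leNgt gtrBl invr_gt0 ltr0n.
- have c := df_cvg (@cvg_addn1 R q).
  apply: (@cvgr_to_ge _ _ _ R _ _ v c); apply: nearW => n.
  have n0 : 0 < n.+1%:R^-1 :> R by rewrite invr_gt0.
  have [z /= vz zq] := inf_adherent n0 hi.
  exact: le_trans vz (df_nondecreasing (ltW zq)).
Qed.

End atomless.

(** * Continuity of the joint distribution function and absence of atoms *)

Section joint_distribution.
Context d (Omega : measurableType d) (R : realType) (P : probability Omega R).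
Variable W : R -> {RV P >-> R}.
Hypothesis bm : brownian_motion W.
Variables (mu s t T : R).
Hypotheses (s0 : 0 < s) (st : s < t) (tT : t <= T).

Local Notation X := (drifted W mu).
Local Notation M := (path_max X s t).
Local Notation g3 := (@std_normal3 R).
Local Notation under y := (@under_barrier _ _ _ _ W mu s t y).

Let t0 : 0 < t. Proof. exact: lt_trans st. Qed.
Let T0 : 0 < T. Proof. exact: lt_le_trans tT. Qed.

Lemma path_max_le y : [set w | M w <= y] = under y.
Proof.
have sub0 : `[s, t]%classic `<=` `[(0 : R), +oo[%classic.
  move=> r /=; rewrite !in_itv/= andbT => /andP[sr _].
  exact: le_trans (ltW s0) sr.
have sup_w w : has_sup [set X r w | r in `[s, t]].
  split; first by exists (X s w); exists s => //=; rewrite in_itv/= lexx ltW.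
  have cX : {within `[s, t], continuous (fun r => X r w)}.
    exact: (continuous_subspaceW sub0 (@drifted_continuous _ _ _ _ _ bm mu w)).
  have [c _ cmax] := EVT_max (ltW st) cX.
  by exists (X c w) => _ [r rst <-]; exact: cmax.
apply/seteqP; split => w /= H.
  move=> r rst; apply: le_trans H; apply: ub_le_sup; first exact: (sup_w w).2.
  by exists r => //=; rewrite in_itv.
apply: ge_sup; first exact: (sup_w w).1.
by move=> _ [r /= rst <-]; apply: H; move: rst; rewrite in_itv.
Qed.

Lemma measurable_path_max : measurable_fun setT M.
Proof.
apply: (measurability _ (RGenOInfty.measurableE R)) => _ [_ [y ->] <-].
rewrite setTI (_ : _ @^-1` _ = ~` under y).
  by apply: measurableC; exact: (@measurable_under_barrier _ _ _ _ _ bm mu s t y s0 st).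
by rewrite -path_max_le; apply/seteqP; split => w /=; rewrite in_itv/= andbT ltNge => /negP.
Qed.

Let joint_real (q y : R) : R :=
  fine (g3 (linmap3 (chol_mx s t T 1) @^-1`
     orthant3 q ((y - mu * t) / Num.sqrt t) ((y - mu * s) / Num.sqrt s))) -
   expR (2 * mu * y) * fine (g3 (linmap3 (chol_mx s t T (-1)) @^-1`
     orthant3 (q - 2 * y / Num.sqrt T) ((- y - mu * t) / Num.sqrt t)
       ((y + mu * s) / Num.sqrt s))).

Lemma joint_dfE q y :
  joint_df P (X T) M (mu * T + Num.sqrt T * q) y = joint_real q y.
Proof.
rewrite /joint_df (_ : [set w | _ /\ _] =
    under y `&` [set w | X T w <= mu * T + Num.sqrt T * q]); last first.
  by rewrite -path_max_le; apply/seteqP; split => w /= [].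
rewrite (joint_under bm s0 st tT y erefl) fineB ?fin_num_measure//; last first.
- by rewrite fin_numM// fin_num_measure//; exact: (measurable_linmap3_orthant (chol_mx _ _ _ _)).
- exact: (measurable_linmap3_orthant (chol_mx _ _ _ _)).
by rewrite fineM// fin_num_measure//; exact: (measurable_linmap3_orthant (chol_mx _ _ _ _)).
Qed.

Lemma joint_real_cvg q y (y_ : nat -> R) : y_ n @[n --> \oo] --> y ->
  joint_real q (y_ n) @[n --> \oo] --> joint_real q y.
Proof.
move=> cy.
have c0 : Num.sqrt s / Num.sqrt T != 0 by rewrite gt_eqF// divr_gt0// sqrtr_gt0.
have f0 : Num.sqrt s / Num.sqrt t != 0 by rewrite gt_eqF// divr_gt0// sqrtr_gt0.
have n1 : (-1 : R) != 0 by rewrite oppr_eq0 oner_neq0.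
have cq : (fun=> q) n @[n --> \oo] --> q by exact: cvg_cst.
apply: cvgB.
  apply: (std_normal3_orthant_cvg c0 f0 (oner_neq0 _) cq).
  - by apply: cvgMl; apply: cvgB => //; exact: cvg_cst.
  - by apply: cvgMl; apply: cvgB => //; exact: cvg_cst.
apply: cvgM.
  apply: (cvg_comp _ expR); last exact: continuous_expR.
  by apply: cvgM => //; exact: cvg_cst.
apply: (std_normal3_orthant_cvg c0 f0 n1).
- apply: cvgB => //; apply: cvgMl; apply: cvgM => //; exact: cvg_cst.
- by apply: cvgMl; apply: cvgB; [exact: cvgN|exact: cvg_cst].
- by apply: cvgMl; apply: cvgD => //; exact: cvg_cst.
Qed.

(** An atom would be a jump in [y] of the joint distribution function at some bound on X_T, but the
    explicit formula is continuous in [y]. The bounds [level k] exhaust all values of X_T. *)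
Lemma path_max_atomless y : P [set w | M w = y] = 0%E.
Proof.
have mM := measurable_path_max.
have mX r := @measurable_drifted _ _ _ _ W mu r.
have mc c := @measurable_cst _ _ Omega R setT c.
have mMy := measurable_set_eq mM (mc y).
have mMle z := measurable_set_le mM (mc z).
have mXle z := measurable_set_le (mX T) (mc z).
pose level k : R := mu * T + Num.sqrt T * k%:R.
have null k : P ([set w | M w = y] `&` [set w | X T w <= level k]) = 0%E.
  set E := (_ `&` _); have mE : measurable E := measurableI _ _ mMy (mXle _).
  (* The event M = y with X_T bounded lies in the difference of the events M <= y and M <= y -
     1/(n+1). *)
  have le_n n : fine (P E) <= joint_real k%:R y - joint_real k%:R (y - n.+1%:R^-1).
    rewrite -!joint_dfE /joint_df -/(level k).
    set A := [set w | _]; set B := [set w | _].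
    have mA : measurable A := measurableI _ _ (mXle _) (mMle _).
    have mB : measurable B := measurableI _ _ (mXle _) (mMle _).
    have BA : B `<=` A.
      move=> w [h1 h2]; split=> //; apply: le_trans h2 _.
      by rewrite gerBl invr_ge0.
    rewrite -fineB ?fin_num_measure//; apply: fine_le.
    - by rewrite fin_num_measure.
    - by rewrite fin_numB !fin_num_measure.
    rewrite -[X in (_ - P X)%E](setIidr BA) -measureD ?fin_num_measure//; last first.
      by rewrite -ge0_fin_numE// fin_num_measure.
    apply: le_measure; rewrite ?inE//; first exact: measurableD.
    move=> w [/= My Xk]; split; first by split=> //=; rewrite My.
    by move=> [_ /=]; rewrite My leNgt gtrBl invr_gt0 ltr0n.
  have c0 : joint_real k%:R y - joint_real k%:R (y - n.+1%:R^-1) @[n --> \oo] -->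
      joint_real k%:R y - joint_real k%:R y.
    by apply: cvgB; [exact: cvg_cst|exact: joint_real_cvg (@cvg_subn1 R y)].
  have := cvgr_to_ge c0 (nearW _ le_n).
  rewrite subrr => P0; apply/eqP; rewrite -measure_le0 -(fineK (fin_num_measure _ _ mE)).
  by rewrite lee_fin; exact: P0.
have -> : [set w | M w = y] = \bigcup_k ([set w | M w = y] `&` [set w | X T w <= level k]).
  apply/seteqP; split => w /=; last by move=> [k _ []].
  move=> My; have sT : 0 < Num.sqrt T by rewrite sqrtr_gt0.
  have [k Hk] : exists k : nat, (X T w - mu * T) / Num.sqrt T <= k%:R.
    exists (Num.truncn (`|(X T w - mu * T) / Num.sqrt T|)).+1.
    apply: le_trans (ler_norm _) _; apply: ltW.
    by have /andP[] := truncn_itv (normr_ge0 ((X T w - mu * T) / Num.sqrt T)).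
  exists k => //; split => //=; move: Hk; by rewrite ler_pdivrMr// /level; lra.
apply: measure_negligible.
  by apply: bigcupT_measurable => k; exact: (measurableI _ _ mMy (mXle _)).
apply: negligible_bigcup => k.
exact/(negligibleP P (measurableI _ _ mMy (mXle _)))/null.
Qed.

End joint_distribution.

(** Lets the quantile lemma for atomless variables apply to [Phi]. *)
Lemma PhiE (R : realType) : @Phi R = df (gauss1 R : probability R R) idfun.
Proof.
apply/funext => x; rewrite /Phi /df; congr fine.
Qed.

Lemma Phi_quantile (R : realType) (u : R) : 0 < u < 1 -> Phi (quantile (@Phi R) u) = u.
Proof.
rewrite PhiE; apply: df_quantile; first exact: measurable_id.
move=> y; rewrite (_ : [set w | _] = [set y]); first exact: gauss1_set1.
by apply/seteqP; split.
Qed.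

(** The copula is evaluated through its defining identity at the pair of quantiles, where the
    marginal distribution functions take the values [u] and [v]. *)
Theorem mainTheorem4 (R : realType) (d : measure_display)
    (Omega : measurableType d) (P : probability Omega R)
    (W : R -> {RV P >-> R}) (mu s t T : R) (C : R -> R -> R) :
  brownian_motion W ->
  0 < s -> s < t -> t <= T ->
  let X := drifted W mu in
  let M := path_max X s t in
  let zeta2 := quantile (df P M) in
  copula_of P (X T) M C ->
  forall u v : R, 0 < u < 1 -> 0 < v < 1 ->
  C u v =
    Phi3 (quantile (@Phi R) u)
         ((zeta2 v - mu * t) / Num.sqrt t)
         ((zeta2 v - mu * s) / Num.sqrt s)
         (Num.sqrt (t / T)) (Num.sqrt (s / T)) (Num.sqrt (s / t))
    - expR (2 * mu * zeta2 v) *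
    Phi3 (quantile (@Phi R) u - 2 * zeta2 v / Num.sqrt T)
         ((- zeta2 v - mu * t) / Num.sqrt t)
         ((zeta2 v + mu * s) / Num.sqrt s)
         (Num.sqrt (t / T)) (- Num.sqrt (s / T)) (- Num.sqrt (s / t)).
Proof.
move=> bm s0 st tT X M zeta2 [_ CE] u v u01 v01.
have t0 : 0 < t by exact: lt_trans st.
have T0 : 0 < T by exact: lt_le_trans tT.
set q := quantile (@Phi R) u; set y := zeta2 v.
have vE : df P M y = v.
  apply: df_quantile v01; first exact: measurable_path_max.
  exact: path_max_atomless.
have sT : 0 < Num.sqrt T by rewrite sqrtr_gt0.
(* X_T is normal with mean mu T and variance T, so [q] standardizes its [u]-quantile. *)
have uE : df P (X T) (mu * T + Num.sqrt T * q) = u.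
  rewrite -[RHS](Phi_quantile u01) -/q PhiE /df; congr fine.
  have mq : measurable `]-oo, Num.sqrt T * q]%classic by [].
  have L := incr_law bm (lexx 0) (ltW T0) mq.
  transitivity (P [set w | `]-oo, Num.sqrt T * q]%classic (W T w - W 0 w)]).
    congr (P _); apply/seteqP; split => w /=; rewrite in_itv/= (bm_start bm) subr0;
      by rewrite /X /drifted addrC lerD2l.
  rewrite L subr0; congr (gauss1 R _).
  by apply/seteqP; split => z /=; rewrite in_itv/= ler_pM2l.
(* From s < t: the condition under which a square root of the correlation matrix determines
   [Phi3]. *)
have r1 : Num.sqrt (s / t) ^+ 2 < 1.
  by rewrite sqr_sqrtr ?divr_ge0 ?ltW// ltr_pdivrMr// mul1r.
have r2 : (- Num.sqrt (s / t)) ^+ 2 < 1 by rewrite sqrrN.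
have G1 := chol_mx_gram s0 st tT (expr1n R 2).
have n1 : (-1 : R) ^+ 2 = 1 by rewrite sqrrN expr1n.
have G2 := chol_mx_gram s0 st tT n1.
rewrite !mul1r in G1; rewrite !mulN1r in G2.
rewrite (Phi3E _ _ _ r1 G1) (Phi3E _ _ _ r2 G2).
rewrite -{1}uE -{1}vE -CE; exact: joint_dfE.
Qed.
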